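(* Let $(M,\mathsf c)$ be a selfdual conformal $4$-manifold with a selfdual projective conformal submersion $\pi\colon M\to B$ over an Einstein-Weyl space $(B,\mathsf c_B,D^B)$ (with $D^B$ the induced Weyl derivative $D^0+\omega$). Then with respect to an arbitrary projective coordinate $t$ on $M\to B$, the conformal structure on $M$ is $$\mathsf c=\pi^*\mathsf c_B+(t^2w_2+tw_1+w_0)^{-2}(dt+t^2A_2+tA_1+A_0)^2,$$ where $$*_B(D^Bw_2+A_2w_1-A_1w_2)=dA_2+A_2\wedge A_1,$$ $$*_B(\tfrac12D^Bw_1+A_2w_0-A_0w_2)=\tfrac12dA_1+A_2\wedge A_0,$$ $$*_B(D^Bw_0+A_1w_0-A_0w_1)=dA_0+A_1\wedge A_0,$$ for some $w_0,w_1,w_2\in C^\infty(B,L_B^{-1})$ and $A_0,A_1,A_2\in C^\infty(B,T^*B)$. Conversely, for any solution $(w_0,w_1,w_2,A_0,A_1,A_2)$ of the projective monopole equations $*_B(D^Bw_2+A_2w_1-A_1w_2)=dA_2+A_2\wedge A_1$, $*_B(\tfrac12D^Bw_1+A_2w_0-A_0w_2)=\tfrac12dA_1+A_2\wedge A_0$ and $*_B(D^Bw_0+A_1w_0-A_0w_1)=dA_0+A_1\wedge A_0$ on a three dimensional Einstein-Weyl space $(B,\mathsf c_B,D^B)$, the conformal structure $\mathsf c=\pi^*\mathsf c_B+(t^2w_2+tw_1+w_0)^{-2}(dt+t^2A_2+tA_1+A_0)^2$ is selfdual, and the projection $\pi$, with horizontal bundle $\mathcal H=\ker(dt+t^2A_2+tA_1+A_0)$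 and relative length scale $w=t^2w_2+tw_1+w_0$, defines a selfdual projective conformal submersion over $B$.
   Context: Everything is smooth and local; in the formula $M$ is (locally) an open subset of $B\times\mathbb R$ with $\pi$ the projection, on which $w=t^2w_2+tw_1+w_0>0$. On an $n$-manifold $M$, $L^w$ denotes the oriented real line bundle of densities of weight $w$, associated to the frame bundle by $A\mapsto|\det A|^{w/n}$; $L=L^1$. A conformal structure $\mathsf c$ is a (unit determinant) metric on $L^{-1}TM$, i.e. an $L^2$-valued inner product $\langle\cdot,\cdot\rangle$ on $TM$; it identifies vectors and $1$-forms of the same weight. A Weyl derivative $D$ is a covariant derivative on $L$ (hence on every $L^w$), with curvature $2$-form $F^D$; on a conformal manifold it determines a unique torsion-free connection $D$ on $TM$ with $D\mathsf c=0$. $D$ is Einstein-Weyl if the symmetric tracefree part of its Ricci tensor vanishes. A conformal submersion with oriented one dimensional fibres is a surjective submersion $\pi\colon M\to B$ of conformal manifolds with $d\pi_x$ restricted to $\mathcal H_x=\mathcal V_x^\perp$ a nonzero conformal map, $\mathcal V=\ker d\pi$. Let $\xi\in L^{-1}\mathcal V$ be the weightless positive unit vertical vector field (also viewed as a weightless $1$-form); $L\cong\mathcal V$ via $\xi$ and $L\cong\pi^*L_B$ via $\mathcal H\cong\pi^*TB$; the composite positive isomorphism $\pi^*L_B\to\mathcal V$ is the relative length scale. In a fibre coordinate $t$ it is a section $w$ of $\pi^*L_B^{-1}$, $\mathcal H=\ker(dt+A)$ with $A$ a section of $\pi^*T^*B$, and $\mathsf c=\pi^*\mathsf c_B+w^{-2}(dt+A)^2$.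 The minimal Weyl derivative $D^0$ is the unique one with $D^0_\xi\xi=0$, $\mathrm{tr}\,D^0\xi=0$; $F^0$ is its Faraday curvature. A projective structure on a $1$-manifold is a second order linear differential operator from $L^{1/2}$ to $L^{-3/2}$ (densities of the $1$-manifold) of the form $\mu\mapsto D(D\mu)+\frac12\rho\,\mu$ for some (hence any) covariant derivative $D$ on $L$, i.e. with no first order term; a projective coordinate is a coordinate $t$ in which it is $f(dt)^{-1/2}\mapsto f''(dt)^{3/2}$, and projective vector fields are those of the form $(a+bt+ct^2)\partial_t$ in a projective coordinate. The conformal submersion $\pi$ is projective if there is a (smoothly varying) projective structure on its fibres such that (i) $\mathcal H$ is projective: for each vector field $X$ on $B$ with horizontal lift $\tilde X$, $U\mapsto[\tilde X,U]$ preserves the vertical vector fields which are projective on each fibre; (ii) the relative length scale maps sections of $L_B$ to vertical vector fields which are projective on each fibre. For $M$ oriented of dimension $4$ the star operator on weighted forms satisfies $\iota_X{*\alpha}=*(\langle X,\cdot\rangle\wedge\alpha)$ with $*1$ the orientation; $*^2=1$ on $2$-forms. The same convention is used for $*_B$ on $B$ (so $*_B^2=-1$), and $*1=*_B1\wedge\xi$. $\mathsf c$ is selfdual if the antiselfdual part of its Weyl curvature vanishes. With $\omega=-( *d^D\xi)(\xi,\cdot)$ (independent of $D$), $\xi$ is selfdual if $F^0$ is selfdual; then $D^0+\omega$ is the pullback of a Weyl derivative $D^B$ on $B$. *)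

(* Defs.v *)
From HB Require Import structures.
From mathcomp Require Import all_boot all_order all_algebra.
From mathcomp Require Import all_classical all_reals all_analysis.
Set Implicit Arguments.
Unset Strict Implicit.
Unset Printing Implicit Defensive.
Import Order.TTheory GRing.Theory Num.Theory.
Import numFieldNormedType.Exports.
Local Open Scope classical_set_scope.
Local Open Scope ring_scope.

(* Local differential geometry in coordinates: base and total space are open
   subsets of R^3 and R^4, and the submersion is the projection forgetting the
   last coordinate.  Points, tangent vectors and 1-forms are rows; metrics and
   2-forms are square matrices of components, with
     (da)_ij = d_i a_j - d_j a_i,    (a /\ b)_ij = a_i b_j - a_j b_i.
   Open sets carry the orientation dx_1 /\ ... /\ dx_n; the fibres are oriented
   by the last coordinate, so that *1 = *_B 1 /\ xi.

   A conformal structure is given by a representative metric g.  Its length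
   scale mu_g (the positive section of L with c = mu_g^2 g) trivialises every
   L^w: a section f mu_g^w of L^w is written as the function f, a Weyl
   derivative D as the 1-form a with D mu_g = a mu_g, so that
   D (f mu_g^w) = (df + w f a) mu_g^w, and F^D = da. *)

Section Calculus.
Variables (R : realType) (n : nat).
Local Notation V := 'rV[R]_n.+1.
Local Notation I := 'I_n.+1.

Definition partial (i : I) (f : V -> R) (x : V) : R := 'D_(delta_mx 0 i) f x.

Fixpoint Ck (k : nat) (U : set V) (f : V -> R) : Prop :=
  (forall x, U x -> {for x, continuous f}) /\
  match k with
  | 0 => True
  | k'.+1 => forall i, (forall x, U x -> derivable f x (delta_mx 0 i)) /\
                       Ck k' U (partial i f)
  end.

Definition smooth (U : set V) (f : V -> R) : Prop := forall k, Ck k U f.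

Definition smooth_row (m : nat) (U : set V) (X : V -> 'rV[R]_m) : Prop :=
  forall i, smooth U (fun x => X x 0 i).

Definition smooth_mx (m : nat) (U : set V) (A : V -> 'M[R]_m) : Prop :=
  forall i j, smooth U (fun x => A x i j).

Definition dfun (f : V -> R) (x : V) : V := \row_i partial i f x.

Definition dform (a : V -> V) (x : V) : 'M[R]_n.+1 :=
  \matrix_(i, j) (partial i (fun y => a y 0 j) x - partial j (fun y => a y 0 i) x).

Definition wedge (a b : V) : 'M[R]_n.+1 :=
  \matrix_(i, j) (a 0 i * b 0 j - a 0 j * b 0 i).

Definition bracket (X Y : V -> V) (x : V) : V :=
  \row_k \sum_i (X x 0 i * partial i (fun y => Y y 0 k) x
               - Y x 0 i * partial i (fun y => X y 0 k) x).

Definition ip (m : nat) (G : 'M[R]_m) (X Y : 'rV[R]_m) : R :=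
  (X *m G *m Y^T) 0 0.

Definition is_metric (U : set V) (g : V -> 'M[R]_n.+1) : Prop :=
  smooth_mx U g /\
  forall x, U x -> (g x)^T = g x /\ forall X, X != 0 -> 0 < ip (g x) X X.

(* Gamma^k_ij, the coefficient of d_k in D_(d_i) d_j, for the torsion-free
   connection with D c = 0, i.e. D g = - 2 a (x) g: Koszul's formula, each
   derivative d_i g_jl being replaced by d_i g_jl + 2 a_i g_jl.  For a = 0 it is
   the Levi-Civita connection of g. *)
Definition christoffel (g : V -> 'M[R]_n.+1) (a : V -> V) (x : V) (k i j : I) : R :=
  let dg i j l := partial i (fun y => g y j l) x + 2 * a x 0 i * g x j l in
  2^-1 * \sum_l invmx (g x) k l * (dg i j l + dg j i l - dg l i j).

(* R^k_lij, the coefficient of d_k in [D_i, D_j] d_l. *)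
Definition curvature (Gam : V -> I -> I -> I -> R) (x : V) (k l i j : I) : R :=
  partial i (fun y => Gam y k j l) x - partial j (fun y => Gam y k i l) x
  + \sum_m (Gam x k i m * Gam x m j l - Gam x k j m * Gam x m i l).

Definition ricci (Gam : V -> I -> I -> I -> R) (x : V) : 'M[R]_n.+1 :=
  \matrix_(l, j) \sum_k curvature Gam x k l k j.

(* Value of the volume form of G on the coordinate vectors listed in s. *)
Definition vol (G : 'M[R]_n.+1) (s : n.+1.-tuple I) : R :=
  Num.sqrt (\det G) * \det (\matrix_i (delta_mx 0 (tnth s i) : V)).

End Calculus.

Section Base.
Variable R : realType.
Local Notation B3 := 'rV[R]_3.

Definition einstein_weyl (B : set B3) (h : B3 -> 'M[R]_3) (a : B3 -> B3) : Prop :=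
  forall b, B b ->
    let Ric := ricci (christoffel h a) b in
    let S := 2^-1 *: (Ric + Ric^T) in
    S - (\tr (invmx (h b) *m S) / 3) *: h b = 0.

(* Both stars follow the convention i_X *b = *(X /\ b), *1 = vol; on the
   1-forms of a 3-manifold this gives *b = i_b vol. *)
Definition star1 (H : 'M[R]_3) (b : B3) : 'M[R]_3 :=
  \matrix_(j, k) \sum_i (b *m invmx H) 0 i * vol H [tuple i; j; k].

(* D^B on sections of L_B^-1. *)
Definition weyl_der (a : B3 -> B3) (w : B3 -> R) (b : B3) : B3 :=
  dfun w b - w b *: a b.

Definition projective_monopole (B : set B3) (h : B3 -> 'M[R]_3) (a : B3 -> B3)
    (w2 w1 w0 : B3 -> R) (A2 A1 A0 : B3 -> B3) : Prop :=
  forall b, B b ->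
  [/\ star1 (h b) (weyl_der a w2 b + w1 b *: A2 b - w2 b *: A1 b)
        = dform A2 b + wedge (A2 b) (A1 b),
      star1 (h b) (2^-1 *: weyl_der a w1 b + w0 b *: A2 b - w2 b *: A0 b)
        = 2^-1 *: dform A1 b + wedge (A2 b) (A0 b)
    & star1 (h b) (weyl_der a w0 b + w0 b *: A1 b - w1 b *: A0 b)
        = dform A0 b + wedge (A1 b) (A0 b)].

End Base.

Section Total.
Variable R : realType.
Local Notation B3 := 'rV[R]_3.
Local Notation M4 := 'rV[R]_4.

(* On 2-forms of a 4-manifold the convention above gives
   *(X /\ Y) = i_X i_Y vol, hence the order j, i of the indices. *)
Definition star2 (G a : 'M[R]_4) : 'M[R]_4 :=
  let up := invmx G *m a *m (invmx G)^T in
  \matrix_(k, l) (2^-1 * \sum_i \sum_j up i j * vol G [tuple j; i; k; l]).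

Definition antiselfdual_part (G a : 'M[R]_4) : 'M[R]_4 :=
  2^-1 *: (a - star2 G a).

(* W_ijkl, with R_ijkl = g (R (d_k, d_l) d_j, d_i). *)
Definition weyl_tensor (g : M4 -> 'M[R]_4) (x : M4) (i j k l : 'I_4) : R :=
  let Gam := christoffel g (fun=> 0) in
  let G := g x in
  let Ric := ricci Gam x in
  let s := \tr (invmx G *m Ric) in
  \sum_m G i m * curvature Gam x m j k l
  - 2^-1 * (G i k * Ric j l - G i l * Ric j k - G j k * Ric i l + G j l * Ric i k)
  + s / 6 * (G i k * G j l - G i l * G j k).

Definition selfdual (M : set M4) (g : M4 -> 'M[R]_4) : Prop :=
  forall x, M x -> forall i j,
    antiselfdual_part (g x) (\matrix_(k, l) weyl_tensor g x i j k l) = 0.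

(* The projection pi is x |-> x *m dpr; it is its own differential. *)
Definition dpr : 'M[R]_(4, 3) := \matrix_(i, j) (i == lift ord_max j)%:R.
Definition pr (x : M4) : B3 := x *m dpr.
Definition fib : M4 := delta_mx 0 ord_max.
Definition pt (b : B3) (s : R) : M4 := b *m dpr^T + s *: fib.
Definition pull1 (a : B3 -> B3) (x : M4) : M4 := a (pr x) *m dpr^T.
Definition pull2 (h : B3 -> 'M[R]_3) (x : M4) : 'M[R]_4 :=
  dpr *m h (pr x) *m dpr^T.

Definition vertical (X : M4) : Prop := X *m dpr = 0.
Definition horizontal (G : 'M[R]_4) (X : M4) : Prop :=
  forall U, vertical U -> ip G X U = 0.

(* lam is the conformal factor of dpi on horizontal vectors, so that the
   isomorphism L = pi^* L_B sends mu_g to lam^(-1/2) pi^* mu_h. *)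
Definition conformal_submersion (M : set M4) (B : set B3)
    (g : M4 -> 'M[R]_4) (h : B3 -> 'M[R]_3) (lam : M4 -> R) : Prop :=
  [/\ pr @` M = B, smooth M lam &
      forall x, M x -> 0 < lam x /\
        forall X Y, horizontal (g x) X -> horizontal (g x) Y ->
          ip (g x) X Y = lam x * ip (h (pr x)) (X *m dpr) (Y *m dpr)].

(* The vector field xi_g and the 1-form with xi = mu_g^-1 xi_g as a vector
   and xi = mu_g xi_flat as a 1-form. *)
Definition xi (g : M4 -> 'M[R]_4) (x : M4) : M4 :=
  (Num.sqrt (ip (g x) fib fib))^-1 *: fib.
Definition xi_flat (g : M4 -> 'M[R]_4) (x : M4) : M4 := xi g x *m g x.

(* (D xi)_i^k: xi has values in L^-1 TM, hence the last term. *)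
Definition Dxi (g : M4 -> 'M[R]_4) (a : M4 -> M4) (x : M4) : 'M[R]_4 :=
  \matrix_(i, k) (partial i (fun y => xi g y 0 k) x
    + \sum_j christoffel g a x k i j * xi g x 0 j - a x 0 i * xi g x 0 k).

Definition minimal_weyl (M : set M4) (g : M4 -> 'M[R]_4) (a : M4 -> M4) : Prop :=
  smooth_row M a /\
  forall x, M x -> xi g x *m Dxi g a x = 0 /\ \tr (Dxi g a x) = 0.

(* omega = - i_xi *(d^D xi); being independent of D, it is computed with
   the D for which mu_g is parallel. *)
Definition omega (g : M4 -> 'M[R]_4) (x : M4) : M4 :=
  - (xi g x *m star2 (g x) (dform (xi_flat g) x)).

(* D^0 + omega is the pullback of the Weyl derivative aB; the logarithmic
   derivative of lam^(1/2) comes from the comparison of mu_g with mu_h. *)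
Definition induces_weyl (M : set M4) (g : M4 -> 'M[R]_4) (lam : M4 -> R)
    (a0 : M4 -> M4) (aB : B3 -> B3) : Prop :=
  forall x, M x ->
    a0 x + omega g x + (2 * lam x)^-1 *: dfun lam x = pull1 aB x.

(* Coefficient of d_s in the image of mu_h under L_B -> L -> V. *)
Definition length_scale (g : M4 -> 'M[R]_4) (lam : M4 -> R) (x : M4) : R :=
  Num.sqrt (lam x) / Num.sqrt (ip (g x) fib fib).

Definition horizontal_lift (M : set M4) (g : M4 -> 'M[R]_4)
    (X : B3 -> B3) (Y : M4 -> M4) : Prop :=
  forall x, M x -> horizontal (g x) (Y x) /\ Y x *m dpr = X (pr x).

Definition smooth1 (J : set R) (f : R -> R) : Prop :=
  forall k s, J s -> derivable (derive1n k f) s 1.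

(* The projective structure f (ds)^(-1/2) |-> (f'' + rho f / 2) (ds)^(3/2) on an
   open subset of R with coordinate s: this is D(D mu) + rho mu / 2 for the D
   with D ds = 0.  The coordinate tau is projective if the operator takes
   phi(tau) (dtau)^(-1/2) to phi''(tau) (dtau)^(3/2), where dtau = tau' ds. *)
Definition projective_operator (rho f : R -> R) (s : R) : R :=
  derive1n 2 f s + 2^-1 * rho s * f s.

Definition projective_coordinate (rho : R -> R) (J : set R) (tau : R -> R) : Prop :=
  [/\ smooth1 J tau, forall s, J s -> 0 < derive1 tau s &
      forall phi : R -> R, smooth1 setT phi -> forall s, J s ->
        projective_operator rho
          (fun r => phi (tau r) / Num.sqrt (derive1 tau r)) s
        = derive1n 2 phi (tau s) * Num.sqrt (derive1 tau s) ^+ 3].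

Definition fibre (N : set M4) (b : B3) : set R := [set s | N (pt b s)].

(* Vertical vector fields on N that are projective on each fibre: locally on
   the fibre of the form (c0 + c1 tau + c2 tau^2) d/dtau. *)
Definition projective_field (rho : M4 -> R) (N : set M4) (U : M4 -> M4) : Prop :=
  [/\ smooth_row N U, forall x, N x -> vertical (U x) &
      forall b s0, N (pt b s0) -> exists (J : set R) (tau : R -> R) (c0 c1 c2 : R),
        [/\ open J, J s0, J `<=` fibre N b,
            projective_coordinate (fun s => rho (pt b s)) J tau &
            forall s, J s -> U (pt b s) 0 ord_max * derive1 tau s
                             = c0 + c1 * tau s + c2 * tau s ^+ 2]].

(* The projective structure on the fibres is given by rho as above, in terms
   of the last coordinate. *)
Definition projective_submersion (M : set M4) (B : set B3)
    (g : M4 -> 'M[R]_4) (lam rho : M4 -> R) : Prop :=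
  [/\ smooth M rho,
      forall X Y, smooth_row B X -> horizontal_lift M g X Y ->
        forall N U, open N -> N `<=` M ->
          projective_field rho N U -> projective_field rho N (bracket Y U) &
      forall f, smooth B f ->
        projective_field rho M (fun x => (f (pr x) * length_scale g lam x) *: fib)].

Definition selfdual_projective_submersion (M : set M4) (B : set B3)
    (g : M4 -> 'M[R]_4) (h : B3 -> 'M[R]_3) (aB : B3 -> B3)
    (lam rho : M4 -> R) : Prop :=
  [/\ conformal_submersion M B g h lam,
      exists a0, [/\ minimal_weyl M g a0,
        forall x, M x -> star2 (g x) (dform a0 x) = dform a0 x &
        induces_weyl M g lam a0 aB] &
      projective_submersion M B g lam rho].

(* A function on N that is a projective coordinate on each fibre; N has
   connected fibres, so that it is a fibre coordinate on N. *)
Definition fibrewise_projective_coordinate (rho : M4 -> R) (N : set M4)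
    (tau : M4 -> R) : Prop :=
  [/\ smooth N tau, forall b, connected (fibre N b) &
      forall b, projective_coordinate (fun s => rho (pt b s)) (fibre N b)
                  (fun s => tau (pt b s))].

(* t^2 w2 + t w1 + w0 *)
Definition quad_scale (t : M4 -> R) (w2 w1 w0 : B3 -> R) (x : M4) : R :=
  t x ^+ 2 * w2 (pr x) + t x * w1 (pr x) + w0 (pr x).

(* dt + t^2 A2 + t A1 + A0 *)
Definition quad_form (t : M4 -> R) (A2 A1 A0 : B3 -> B3) (x : M4) : M4 :=
  dfun t x + t x ^+ 2 *: pull1 A2 x + t x *: pull1 A1 x + pull1 A0 x.

(* pi^* c_B + w^-2 (dt + A)^2, as a metric, in terms of pi^* mu_h *)
Definition quad_metric (h : B3 -> 'M[R]_3) (t : M4 -> R)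
    (w2 w1 w0 : B3 -> R) (A2 A1 A0 : B3 -> B3) (x : M4) : 'M[R]_4 :=
  let th := quad_form t A2 A1 A0 x in
  pull2 h x + (quad_scale t w2 w1 w0 x) ^- 2 *: (th^T *m th).

End Total.

(* Main.v *)
Require Import Defs.
From HB Require Import structures.
From mathcomp Require Import all_boot all_order all_algebra.
From mathcomp Require Import all_classical all_reals all_analysis.
From mathcomp Require Import ring lra.
Set Implicit Arguments.
Unset Strict Implicit.
Unset Printing Implicit Defensive.
Import Order.TTheory GRing.Theory Num.Theory.
Import numFieldNormedType.Exports.
Local Open Scope classical_set_scope.
Local Open Scope ring_scope.

(** The proof works on the total space with the 1-form theta with kernel the
    horizontal distribution and theta_4 = 1, so that, up to the factor lam, the
    metric is pi^* h + w^-2 theta^2 with w the relative length scale.  Let F be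
    the horizontal part of d theta, the curvature of the distribution, and let
    the 1-form beta be determined by *_B beta = F.

    Conformal submersions.  The two conditions on the minimal Weyl derivative are
    algebraic in its 1-form and give, for lam = 1, the formula
    a0 = d_4 theta + dw / w - (d_4 w / w) theta (minimal_weylP), while omega is
    - beta / w (omegaE).  Hence D^0 + omega is the pullback of D^B if and only if
    beta = w (a0 - aB), that is if and only if
    *_B (e_l w - w aB_l + w d_4 theta_l) = F, for e_l the horizontal lifts of the
    coordinate fields of the base.  This is a monopole equation on the total
    space.  With it, the exterior derivative of a0 is determined by the
    derivative of beta / w along the fibres and is selfdual (faraday_selfdual).

    Selfduality of the metric.  In an orthonormal coframe e_0, e_1, e_2 pulled
    back from the base and e_3 = theta / w, the monopole equation makes all
    exterior derivatives of the coframe explicit, and therefore the Levi-Civita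
    connection.  On the half of the 2-forms spanned by e_j /\ e_k + e_i /\ e_3 it
    is the connection of D^B, changed by the 1-form aB + beta / (2 w).  Its
    curvature block on this half is that of D^B up to a multiple of the identity
    and an antisymmetric part (half_curvature_block), and the Einstein-Weyl
    equation says that the block of D^B is of this form.  The symmetric tracefree
    part of the block is the Weyl curvature on that half, which is the
    antiselfdual one in the present orientation (monopole_selfdual).

    Fibre coordinates.  If theta and w come from a quadratic form and a quadratic
    scale in a fibre coordinate t, then F and w (a0 - aB) are, up to the same
    factor, quadratic in t, with the two sides of the projective monopole
    equations as coefficients (quad_curvature, quad_minimal).  So these equations
    imply the monopole equation on the total space, and by comparing coefficients
    they follow from it.

    Projective structures.  A vertical field u d/ds is projective if and only if
    u satisfies a third order equation (projective_ode), which in a projective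
    coordinate t says that u t' has vanishing third derivative with respect to t
    (projective_flat), hence is quadratic in t.  Applied to the relative length
    scale this shows that it is quadratic.  Applied to the brackets of a
    horizontal lift Y with d/dt and t d/dt it shows that Y t, a component of the
    connection form, is quadratic.  The coefficients are constant along the
    connected fibres and thus come from the base.  In the other direction the
    last coordinate is taken as projective coordinate, and the bracket of a
    horizontal lift with a quadratic vertical field is again quadratic because
    theta is (quadratic_bracket). *)

(** * Smooth functions on open sets *)

Section SmoothFunctions.
Variables (R : realType) (n : nat).
Local Notation V := 'rV[R]_n.+1.
Local Notation I := 'I_n.+1.
Implicit Types (f g : V -> R) (U W : set V) (x : V) (i j : I).

Lemma eq_near_open U f g x : open U -> U x -> (forall y, U y -> f y = g y) ->
  \near x, f x = g x.
Proof.
by move=> oU Ux fg; apply: filterS (open_nbhs_nbhs (conj oU Ux)) => y /fg.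
Qed.

Lemma partial_ext U f g x i : open U -> U x -> (forall y, U y -> f y = g y) ->
  partial i f x = partial i g x.
Proof. by move=> oU Ux /(eq_near_open oU Ux)/near_eq_derive; apply. Qed.

Lemma Ck_continuous k U f x : Ck k U f -> U x -> {for x, continuous f}.
Proof. by case: k => [|k] [fc _]; exact: fc. Qed.

Lemma CkW k U f : Ck k.+1 U f -> Ck k U f.
Proof.
elim: k f => [|k IH] f [fc fd]; first by split.
split=> // i.
by have [d1 d2] := fd i; split=> //; exact: IH.
Qed.

Lemma Ck_sub k U W f : W `<=` U -> Ck k U f -> Ck k W f.
Proof.
move=> WU; elim: k f => [|k IH] f [fc fd]; first by split=> // x /WU/fc.
split=> [x /WU/fc//|i].
by have [d1 d2] := fd i; split=> [x /WU/d1//|]; exact: IH.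
Qed.

Lemma continuous_ext U f g x : open U -> U x -> (forall y, U y -> f y = g y) ->
  {for x, continuous f} -> {for x, continuous g}.
Proof.
move=> oU Ux fg; rewrite /prop_for /continuous_at -(fg x Ux) => fc.
apply: cvg_trans fc; apply: (@near_eq_cvg _ _ (nbhs x)).
exact: eq_near_open oU Ux fg.
Qed.

Lemma Ck_ext k U f g : open U -> (forall x, U x -> f x = g x) ->
  Ck k U f -> Ck k U g.
Proof.
move=> oU; elim: k f g => [|k IH] f g fg [fc fd].
  by split=> // x Ux; exact: (continuous_ext oU Ux fg (fc _ Ux)).
split=> [x Ux|i]; first exact: (continuous_ext oU Ux fg (fc _ Ux)).
have [d1 d2] := fd i; split=> [x Ux|].
  by apply: near_eq_derivable (d1 _ Ux); exact: (eq_near_open oU Ux).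
by apply: IH d2 => x Ux; exact: (partial_ext _ oU Ux).
Qed.

Lemma Ck_local k U f :
  (forall x, U x -> exists W, W x /\ Ck k W f) -> Ck k U f.
Proof.
elim: k f => [|k IH] f loc.
  by split=> // x /loc[W [Wx [fc _]]]; exact: fc.
split=> [x /loc[W [Wx [fc _]]]|i]; first exact: fc.
split=> [x /loc[W [Wx [_ /(_ i)[d _]]]]|]; first exact: d.
by apply: IH => x /loc[W [Wx [_ /(_ i)[_ d]]]]; exists W.
Qed.

Lemma partial_cst (c : R) i x : partial i (fun=> c) x = 0.
Proof. exact: derive_cst. Qed.

Lemma Ck_cst k U (c : R) : Ck k U (fun=> c).
Proof.
elim: k c => [|k IH] c; first by split=> // x _; exact: cst_continuous.
split=> [x _|i]; first exact: cst_continuous.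
split=> [x _|]; first exact: derivable_cst.
rewrite (_ : partial i _ = fun=> 0)//.
by apply/funext => x; exact: partial_cst.
Qed.

Lemma partial_coord i j x : partial i (fun y : V => y 0 j) x = (i == j)%:R.
Proof.
rewrite /partial deriveE; last exact: differentiable_coord.
have L : linear (fun y : V => y 0 j) by move=> a u v; rewrite !mxE.
pose l := GRing.isLinear.Build R V R *:%R _ L.
pose F : {linear V -> R} := HB.pack (fun y : V => y 0 j) l.
rewrite -[fun _ => _]/(F : V -> R) diff_lin /F/= ?mxE ?eqxx 1?eq_sym//.
by move=> y; exact: coord_continuous.
Qed.

Lemma Ck_coord k U j : Ck k U (fun y : V => y 0 j).
Proof.
case: k => [|k]; first by split=> // x _; exact: coord_continuous.
split=> [x _|i]; first exact: coord_continuous.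
split=> [x _|]; first exact/diff_derivable/differentiable_coord.
rewrite (_ : partial i _ = fun=> (i == j)%:R); first exact: Ck_cst.
by apply/funext => x; exact: partial_coord.
Qed.

Section Operations.
Variables (f g : V -> R) (x : V) (i : I).
Hypotheses (df : derivable f x (delta_mx 0 i)) (dg : derivable g x (delta_mx 0 i)).

Lemma partialD : partial i (fun y => f y + g y) x = partial i f x + partial i g x.
Proof. exact: deriveD. Qed.

Lemma partialN : partial i (fun y => - f y) x = - partial i f x.
Proof. exact: deriveN. Qed.

Lemma partialB : partial i (fun y => f y - g y) x = partial i f x - partial i g x.
Proof. exact: deriveB. Qed.

Lemma partialM :
  partial i (fun y => f y * g y) x = f x * partial i g x + g x * partial i f x.
Proof. by rewrite /partial -[fun y => _]/(f * g) (deriveM df dg). Qed.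

Lemma partialV : f x != 0 ->
  partial i (fun y => (f y)^-1) x = - (f x ^- 2 * partial i f x).
Proof. by move=> fx; rewrite /partial (deriveV fx df) scaleNr. Qed.

End Operations.

Lemma CkD k U f g : open U -> Ck k U f -> Ck k U g -> Ck k U (fun y => f y + g y).
Proof.
move=> oU; elim: k f g => [|k IH] f g [fc fd] [gc gd].
  by split=> // x Ux; apply: continuousD; [exact: fc|exact: gc].
split=> [x Ux|i]; first by apply: continuousD; [exact: fc|exact: gc].
have [d1 d2] := fd i; have [e1 e2] := gd i; split=> [x Ux|].
  by apply: derivableD; [exact: d1|exact: e1].
apply: (Ck_ext oU _ (IH _ _ d2 e2)) => x Ux /=.
by rewrite partialD//; [exact: d1|exact: e1].
Qed.

Lemma CkM k U f g : open U -> Ck k U f -> Ck k U g -> Ck k U (fun y => f y * g y).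
Proof.
move=> oU; elim: k f g => [|k IH] f g Cf Cg; have [fc fd] := Cf; have [gc gd] := Cg.
  by split=> // x Ux; apply: continuousM; [exact: fc|exact: gc].
split=> [x Ux|i]; first by apply: continuousM; [exact: fc|exact: gc].
have [d1 d2] := fd i; have [e1 e2] := gd i; split=> [x Ux|].
  by apply: derivableM; [exact: d1|exact: e1].
apply: (Ck_ext oU _ (CkD oU (IH _ _ (CkW Cf) e2) (IH _ _ (CkW Cg) d2))) => x Ux /=.
by rewrite partialM//; [exact: d1|exact: e1].
Qed.

Lemma CkV k U f : open U -> (forall x, U x -> f x != 0) -> Ck k U f ->
  Ck k U (fun y => (f y)^-1).
Proof.
move=> oU f0; elim: k f f0 => [|k IH] f f0 Cf; have [fc fd] := Cf.
  by split=> // x Ux; apply: continuousV; [exact: f0|exact: fc].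
split=> [x Ux|i]; first by apply: continuousV; [exact: f0|exact: fc].
have [d1 d2] := fd i; split=> [x Ux|].
  by apply: derivableV; [exact: f0|exact: d1].
have CV := IH _ f0 (CkW Cf).
apply: (Ck_ext oU _ (CkM oU (CkM oU (Ck_cst k U (-1)) (CkM oU CV CV)) d2)) => x Ux /=.
rewrite partialV ?f0//; last exact: d1.
by rewrite mulN1r mulNr expr2 invfM.
Qed.

Lemma smooth_derivable U f x i : smooth U f -> U x ->
  derivable f x (delta_mx 0 i).
Proof. by move=> /(_ 1%N)[_ /(_ i)[d _]] /d. Qed.

Lemma smooth_continuous U f x : smooth U f -> U x -> {for x, continuous f}.
Proof. by move=> /(_ 0%N); exact: Ck_continuous. Qed.

Lemma smooth_partial U f i : smooth U f -> smooth U (partial i f).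
Proof. by move=> Sf k; have [_ /(_ i)[]] := Sf k.+1. Qed.

Lemma smooth_ext U f g : open U -> (forall x, U x -> f x = g x) ->
  smooth U f -> smooth U g.
Proof. by move=> oU fg Sf k; exact: Ck_ext (Sf k). Qed.

Lemma smooth_sub U W f : W `<=` U -> smooth U f -> smooth W f.
Proof. by move=> WU Sf k; exact: Ck_sub (Sf k). Qed.

Lemma smooth_local U f :
  (forall x, U x -> exists W, W x /\ smooth W f) -> smooth U f.
Proof. by move=> loc k; apply: Ck_local => x /loc[W [Wx Sf]]; exists W. Qed.

Lemma smooth_cst U (c : R) : smooth U (fun=> c).
Proof. by move=> k; exact: Ck_cst. Qed.

Lemma smooth_coord U j : smooth U (fun y : V => y 0 j).
Proof. by move=> k; exact: Ck_coord. Qed.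

Lemma smoothD U f g : open U -> smooth U f -> smooth U g ->
  smooth U (fun y => f y + g y).
Proof. by move=> oU Sf Sg k; exact: CkD. Qed.

Lemma smoothM U f g : open U -> smooth U f -> smooth U g ->
  smooth U (fun y => f y * g y).
Proof. by move=> oU Sf Sg k; exact: CkM. Qed.

Lemma smoothN U f : open U -> smooth U f -> smooth U (fun y => - f y).
Proof.
move=> oU Sf; apply: (smooth_ext oU _ (smoothM oU (smooth_cst U (-1)) Sf)).
by move=> x _ /=; rewrite mulN1r.
Qed.

Lemma smoothB U f g : open U -> smooth U f -> smooth U g ->
  smooth U (fun y => f y - g y).
Proof. by move=> oU Sf Sg; apply: smoothD => //; exact: smoothN. Qed.

Lemma smoothX U f m : open U -> smooth U f -> smooth U (fun y => f y ^+ m).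
Proof.
move=> oU Sf; elim: m => [|m IH]; first by under eq_fun do rewrite expr0; exact: smooth_cst.
by under eq_fun do rewrite exprS; exact: smoothM.
Qed.

Lemma smoothV U f : open U -> (forall x, U x -> f x != 0) -> smooth U f ->
  smooth U (fun y => (f y)^-1).
Proof. by move=> oU f0 Sf k; exact: CkV. Qed.

Lemma smooth_sum (T : Type) (r : seq T) (P : pred T) U (F : T -> V -> R) :
  open U -> (forall t, P t -> smooth U (F t)) ->
  smooth U (fun y => \sum_(t <- r | P t) F t y).
Proof.
move=> oU SF; elim: r => [|t r IH].
  by under eq_fun do rewrite big_nil; exact: smooth_cst.
under eq_fun do rewrite big_cons; case Pt: (P t) => //.
by apply: smoothD => //; exact: SF.
Qed.

Lemma smooth_prod (T : Type) (r : seq T) (P : pred T) U (F : T -> V -> R) :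
  open U -> (forall t, P t -> smooth U (F t)) ->
  smooth U (fun y => \prod_(t <- r | P t) F t y).
Proof.
move=> oU SF; elim: r => [|t r IH].
  by under eq_fun do rewrite big_nil; exact: smooth_cst.
under eq_fun do rewrite big_cons; case Pt: (P t) => //.
by apply: smoothM => //; exact: SF.
Qed.

Lemma partial_sum (T : Type) (r : seq T) U (F : T -> V -> R) x i :
  open U -> U x -> (forall t, smooth U (F t)) ->
  partial i (fun y => \sum_(t <- r) F t y) x = \sum_(t <- r) partial i (F t) x.
Proof.
move=> oU Ux SF; elim: r => [|t r IH].
  rewrite big_nil -[RHS](partial_cst 0 i x); congr (partial i _ x).
  by apply/funext => y; rewrite big_nil.
rewrite big_cons -IH -partialD.
- by congr (partial i _ x); apply/funext => y; rewrite big_cons.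
- exact: smooth_derivable (SF t) Ux.
- have S := smooth_sum r (P := xpredT) oU (fun t _ => SF t).
  exact: smooth_derivable S Ux.
Qed.

(** A differentiable positive function is the square of its root, so
    d (sqrt f) = df / (2 sqrt f); by induction sqrt f is as smooth as f. *)
Lemma smooth_sqrt_partial U f x i : open U -> (forall y, U y -> 0 < f y) ->
  smooth U f -> U x ->
  derivable (fun y => Num.sqrt (f y)) x (delta_mx 0 i) /\
  partial i (fun y => Num.sqrt (f y)) x = 2^-1 * (Num.sqrt (f x))^-1 * partial i f x.
Proof.
move=> oU f0 Sf Ux.
have /derivable1P/derivable1_diffP dl := smooth_derivable (i := i) Sf Ux.
have df0 : differentiable (@Num.sqrt R) (f (0 *: delta_mx 0 i + x)).
  rewrite scale0r add0r; apply/derivable1_diffP.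
  by have [] := is_derive1_sqrt (f0 _ Ux).
have L : derivable (fun y => Num.sqrt (f y)) x (delta_mx 0 i).
  apply/derivable1P/derivable1_diffP.
  exact: (differentiable_comp dl df0).
split=> //.
have sx : Num.sqrt (f x) != 0 by rewrite gt_eqF// sqrtr_gt0 f0.
have -> : partial i f x =
    2 * Num.sqrt (f x) * partial i (fun y => Num.sqrt (f y)) x.
  rewrite (@partial_ext U f (fun y => Num.sqrt (f y) * Num.sqrt (f y)))//.
    by rewrite partialM//; ring.
  by move=> y Uy; rewrite -expr2 sqr_sqrtr// ltW// f0.
by field.
Qed.

Lemma smooth_sqrt U f : open U -> (forall y, U y -> 0 < f y) ->
  smooth U f -> smooth U (fun y => Num.sqrt (f y)).
Proof.
move=> oU f0 Sf; elim=> [|k IH].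
  split=> // x Ux; apply: continuous_comp; first exact: smooth_continuous Ux.
  exact: sqrt_continuous.
split=> [x Ux|i].
  apply: continuous_comp; first exact: smooth_continuous Ux.
  exact: sqrt_continuous.
split=> [x Ux|]; first by have [] := smooth_sqrt_partial i oU f0 Sf Ux.
have s0 y : U y -> Num.sqrt (f y) != 0.
  by move=> Uy; rewrite gt_eqF// sqrtr_gt0 f0.
apply: (Ck_ext oU _ (CkM oU (CkM oU (Ck_cst k U 2^-1) (CkV oU s0 IH))
  (smooth_partial i Sf k))) => x Ux /=.
by have [_ ->] := smooth_sqrt_partial i oU f0 Sf Ux.
Qed.

(** ** Restriction to lines, and symmetry of second derivatives *)

Lemma is_derive_line f x (v : V) (s : R) : derivable f (x + s *: v) v ->
  is_derive s 1 (fun r => f (x + r *: v)) ('D_v f (x + s *: v)).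
Proof.
have E : (fun h : R => h^-1 *: (((fun r => f (x + r *: v)) \o shift s) (h *: 1)
            - f (x + s *: v)))
    = (fun h : R => h^-1 *: ((f \o shift (x + s *: v)) (h *: v) - f (x + s *: v))).
  apply/funext => h /=; congr (_ *: (f _ - _)).
  by rewrite [h *: 1]mulr1 scalerDl addrCA addrA addrAC addrC addrA.
move=> df; apply: DeriveDef; first by rewrite /derivable E.
by rewrite /derive E.
Qed.

Lemma MVT_line U f x i (h : R) : smooth U f -> 0 < h ->
  (forall s, 0 <= s <= h -> U (x + s *: delta_mx 0 i)) ->
  exists2 s, 0 <= s <= h &
    f (x + h *: delta_mx 0 i) - f x = h * partial i f (x + s *: delta_mx 0 i).
Proof.
move=> Sf h0 Ul.
have dl s : 0 <= s <= h -> is_derive s 1 (fun r => f (x + r *: delta_mx 0 i))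
    (partial i f (x + s *: delta_mx 0 i)).
  by move=> /Ul Us; apply: is_derive_line; exact: smooth_derivable Sf Us.
have [||s sI E] := @MVT R (fun r => f (x + r *: delta_mx 0 i))
  (fun s => partial i f (x + s *: delta_mx 0 i)) 0 h h0.
- by move=> s; rewrite in_itv/= => /andP[s0 sh]; apply: dl; rewrite !ltW.
- apply: derivable_within_continuous => s; rewrite in_itv/= => sI.
  by have [] := dl s sI.
exists s; first by move: sI; rewrite in_itv/= => /andP[s0 sh]; rewrite !ltW.
by move: E; rewrite scale0r addr0 subr0 mulrC.
Qed.

Lemma mixed_difference U f x i j (h : R) : open U -> smooth U f -> 0 < h ->
  (forall s t, 0 <= s <= h -> 0 <= t <= h ->
    U (x + s *: delta_mx 0 i + t *: delta_mx 0 j)) ->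
  exists s t, [/\ 0 <= s <= h, 0 <= t <= h &
    f (x + h *: delta_mx 0 i + h *: delta_mx 0 j) - f (x + h *: delta_mx 0 i)
      - f (x + h *: delta_mx 0 j) + f x
    = h * (h * partial j (partial i f)
        (x + s *: delta_mx 0 i + t *: delta_mx 0 j))].
Proof.
move=> oU Sf h0 Ubox.
have h0h : 0 <= h <= h by rewrite lexx ltW.
have h00 : 0 <= (0 : R) <= h by rewrite lexx ltW.
have dl s : 0 <= s <= h ->
    is_derive s 1 (fun r => f (x + h *: delta_mx 0 j + r *: delta_mx 0 i)
                           - f (x + r *: delta_mx 0 i))
    (partial i f (x + h *: delta_mx 0 j + s *: delta_mx 0 i)
     - partial i f (x + s *: delta_mx 0 i)).
  move=> sh; apply: is_deriveB.
    apply: is_derive_line; apply: smooth_derivable Sf _.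
    by rewrite addrAC; exact: Ubox.
  apply: is_derive_line; apply: smooth_derivable Sf _.
  by have := Ubox s 0 sh h00; rewrite scale0r addr0.
have [||s sI] := @MVT R (fun r => f (x + h *: delta_mx 0 j + r *: delta_mx 0 i)
                           - f (x + r *: delta_mx 0 i))
  (fun s => partial i f (x + h *: delta_mx 0 j + s *: delta_mx 0 i)
     - partial i f (x + s *: delta_mx 0 i)) 0 h h0.
- by move=> s; rewrite in_itv/= => /andP[s0 sh]; apply: dl; rewrite !ltW.
- apply: derivable_within_continuous => s; rewrite in_itv/= => sI.
  by have [] := dl s sI.
have sh : 0 <= s <= h.
  by move: sI; rewrite in_itv/= => /andP[s0 sh]; rewrite !ltW.
have [t th E2] := @MVT_line U (partial i f) (x + s *: delta_mx 0 i) j h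
  (smooth_partial i Sf) h0 (fun t => Ubox s t sh).
move=> E1; exists s, t; split=> //.
rewrite -E2 [x + s *: _ + _]addrAC mulrC subr0 in E1 *.
by rewrite -E1 !scale0r !addr0 [x + h *: _ + _ in LHS]addrAC; ring.
Qed.

Lemma normr_delta_mx i : `|delta_mx 0 i : V| <= 1.
Proof.
rewrite /Num.norm/= mx_normrE; apply/bigmax_leP; split=> // -[a b] _.
by rewrite mxE; case: (_ && _); rewrite ?normr1 ?normr0.
Qed.

(** Schwarz: the second difference of f along a small square equals h^2 times either
    mixed derivative, taken at points of the square (mean value theorem);
    by continuity the two mixed derivatives agree. *)
Lemma partial_comm U f x i j : open U -> smooth U f -> U x ->
  partial i (partial j f) x = partial j (partial i f) x.
Proof.
move=> oU Sf Ux; apply/eqP; rewrite eq_sym -subr_eq0 -normr_le0.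
apply/ler_addgt0Pl => e e0; rewrite addr0.
have e2 : 0 < e / 2 by rewrite divr_gt0.
have cP := smooth_continuous (smooth_partial i (smooth_partial j Sf)) Ux.
have cQ := smooth_continuous (smooth_partial j (smooth_partial i Sf)) Ux.
have nU := open_nbhs_nbhs (conj oU Ux).
have /nbhs_ballP[d /= d0 near_x] : \forall y \near x,
    [/\ U y, `|partial i (partial j f) x - partial i (partial j f) y| < e / 2 &
        `|partial j (partial i f) x - partial j (partial i f) y| < e / 2].
  have nP := (@cvgr_dist_lt _ _ _ _ _ _ _ cP _ e2).
  have nQ := (@cvgr_dist_lt _ _ _ _ _ _ _ cQ _ e2).
  have F := nbhs_filter x.
  apply: filterS (filterI nU (filterI (nP F) (nQ F))) => y.
  by case=> u [p q]; exact: And3 u p q.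
have h0 : 0 < d / 3 by rewrite divr_gt0.
have box i' j' s t : 0 <= s <= d / 3 -> 0 <= t <= d / 3 ->
    ball x d (x + s *: delta_mx 0 i' + t *: delta_mx 0 j').
  move=> /andP[s0 sh] /andP[t0 th]; rewrite -ball_normE /ball_/= -addrA opprD addNKr.
  rewrite normrN (le_lt_trans (ler_normD _ _))// !normrZ !ger0_norm//.
  have n1 := normr_delta_mx i'; have n2 := normr_delta_mx j'.
  have := ler_pM s0 (normr_ge0 _) sh n1; have := ler_pM t0 (normr_ge0 _) th n2.
  by lra.
have [s [t [sh th E]]] := mixed_difference oU Sf h0
  (fun s t sh th => (let: And3 u _ _ := near_x _ (box i j s t sh th) in u)).
have [s' [t' [sh' th' E']]] := mixed_difference oU Sf h0
  (fun s t sh th => (let: And3 u _ _ := near_x _ (box j i s t sh th) in u)).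
have [_ _ Q1] := near_x _ (box i j s t sh th).
have [_ P1 _] := near_x _ (box j i s' t' sh' th').
set q := partial j (partial i f) _ in E Q1.
set p := partial i (partial j f) _ in E' P1.
clearbody p q.
have pq : p = q.
  apply: (mulfI (lt0r_neq0 h0)); apply: (mulfI (lt0r_neq0 h0)).
  move: E E'; set u := _ *: delta_mx 0 i; set v := _ *: delta_mx 0 j.
  rewrite (addrAC x v u); move: (f (x + u + v)) (f (x + u)) (f (x + v)) (f x).
  by move=> a1 a2 a3 a4 E E'; rewrite -E -E'; congr (_ + _); exact: addrAC.
rewrite pq in P1.
move: (partial j (partial i f) x) (partial i (partial j f) x) P1 Q1 => A C P1 Q1.
rewrite (le_trans (ler_distD q A C))// (splitr e) lerD ?ltW//.
by rewrite distrC.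
Qed.

Lemma smooth_det m U (A : V -> 'M[R]_m) : open U -> smooth_mx U A ->
  smooth U (fun x => \det (A x)).
Proof.
move=> oU SA; apply: smooth_sum => // s _; apply: smoothM => //.
  exact: smooth_cst.
by apply: smooth_prod => // i _; exact: SA.
Qed.

Lemma smooth_invmx m U (A : V -> 'M[R]_m) : open U -> smooth_mx U A ->
  (forall x, U x -> A x \in unitmx) -> smooth_mx U (fun x => invmx (A x)).
Proof.
move=> oU SA uA i j.
apply: (@smooth_ext U (fun x => (\det (A x))^-1 *
   ((-1) ^+ (j + i) * \det (row' j (col' i (A x)))))) => //.
  by move=> x Ux; rewrite /invmx uA// !mxE.
apply: smoothM => //; first (apply: smoothV => //; last exact: smooth_det).
  by move=> x /uA; rewrite unitmxE unitfE.
apply: smoothM => //; first exact: smooth_cst.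
by apply: smooth_det => // a b; under eq_fun do rewrite !mxE; exact: SA.
Qed.

Lemma smooth_mulmx m p q U (A : V -> 'M[R]_(m, p)) (C : V -> 'M[R]_(p, q)) :
  open U -> (forall a b, smooth U (fun x => A x a b)) ->
  (forall a b, smooth U (fun x => C x a b)) ->
  forall a b, smooth U (fun x => (A x *m C x) a b).
Proof.
move=> oU SA SC a b; under eq_fun do rewrite mxE.
by apply: smooth_sum => // k _; exact: smoothM.
Qed.

End SmoothFunctions.

(** * The projection to the base and its sections *)

Section Projection.
Variable R : realType.
Local Notation B3 := 'rV[R]_3.
Local Notation M4 := 'rV[R]_4.
Implicit Types (B : set B3) (M N : set M4) (b : B3) (x : M4).

Lemma prE x j : pr x 0 j = x 0 (lift ord_max j).
Proof.
rewrite /pr mxE (bigD1 (lift ord_max j))//= mxE eqxx mulr1 big1 ?addr0//.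
by move=> i /negbTE ni; rewrite mxE ni mulr0.
Qed.

Lemma lift_dpr b j : (b *m (@dpr R)^T) 0 (lift ord_max j) = b 0 j.
Proof.
rewrite mxE (bigD1 j)//= !mxE eqxx mulr1 big1 ?addr0// => i /negbTE ni.
by rewrite !mxE (inj_eq (@lift_inj _ _)) eq_sym ni mulr0.
Qed.

Lemma max_dpr b : (b *m (@dpr R)^T) 0 ord_max = 0.
Proof.
by rewrite mxE big1// => i _; rewrite !mxE (negbTE (neq_lift _ _)) mulr0.
Qed.

Lemma dprK : (@dpr R)^T *m @dpr R = 1%:M.
Proof.
apply/matrixP => i j; have := prE (delta_mx 0 i *m (@dpr R)^T) j.
rewrite /pr lift_dpr !mxE eqxx /= eq_sym => <-.
by apply: eq_bigr => k _; rewrite -rowE !mxE.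
Qed.

Lemma fib_dpr : @fib R *m @dpr R = 0.
Proof.
apply/rowP => j; rewrite -[_ *m _]/(pr (fib R)) prE !mxE/=.
by rewrite eq_sym (negbTE (neq_lift _ _)).
Qed.

Lemma prD x y : pr (x + y) = pr x + pr y. Proof. exact: mulmxDl. Qed.

Lemma prZ (c : R) x : pr (c *: x) = c *: pr x.
Proof. by rewrite /pr scalemxAl. Qed.

Lemma pr_fib : pr (fib R) = 0. Proof. exact: fib_dpr. Qed.

Lemma ptK b s : pr (pt b s) = b.
Proof. by rewrite /pt prD prZ pr_fib scaler0 addr0 /pr -mulmxA dprK mulmx1. Qed.

Lemma pt_max b s : (pt b s) 0 ord_max = s.
Proof. by rewrite mxE max_dpr !mxE !eqxx mulr1 add0r. Qed.

Lemma row4P (x y : M4) : pr x = pr y -> x 0 ord_max = y 0 ord_max -> x = y.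
Proof.
move=> e1 e2; apply/rowP => i; case: (unliftP ord_max i) => [j ->|->//].
by rewrite -!prE e1.
Qed.

Lemma pt_pr x : pt (pr x) (x 0 ord_max) = x.
Proof. by apply: row4P; rewrite ?ptK ?pt_max. Qed.

Lemma ptDl c b s : pt (c + b) s = c *m (@dpr R)^T + pt b s.
Proof. by rewrite /pt mulmxDl addrA. Qed.

Lemma pr_delta_lift j : pr (delta_mx 0 (lift ord_max j) : M4) = delta_mx 0 j.
Proof. by apply/rowP => k; rewrite prE !mxE (inj_eq (@lift_inj _ _)). Qed.

Lemma delta_dpr j : (delta_mx 0 j : B3) *m (@dpr R)^T = delta_mx 0 (lift ord_max j).
Proof.
apply: row4P; first by rewrite pr_delta_lift /pr -mulmxA dprK mulmx1.
by rewrite max_dpr mxE /= (negbTE (neq_lift _ _)).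
Qed.

Lemma pr_continuous : continuous (@pr R).
Proof.
move=> x A /nbhs_ballP[e /= e0 eA]; apply/nbhs_ballP; exists e => // y xy.
case: xy => _ xy; apply: eA; split=> // i j; rewrite !ord1 !prE; exact: xy.
Qed.

Lemma pt_continuous s : continuous (fun b => pt b s).
Proof.
move=> b A /nbhs_ballP[e /= e0 eA]; apply/nbhs_ballP; exists e => // y xy.
case: xy => _ xy; apply: eA; split=> // i j; rewrite !ord1; case: (unliftP ord_max j) => [k ->|->].
  by rewrite -!prE !ptK; exact: xy.
by rewrite !pt_max; exact: ballxx.
Qed.

Lemma fib_continuous b : continuous (fun s => pt b s).
Proof.
move=> s A /nbhs_ballP[e /= e0 eA]; apply/nbhs_ballP; exists e => // y xy.
apply: eA; split=> // i j; rewrite !ord1; case: (unliftP ord_max j) => [k ->|->].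
  by rewrite -!prE !ptK; exact: ballxx.
by rewrite !pt_max.
Qed.

Lemma open_slice M s : open M -> open [set b | M (pt b s)].
Proof. by move=> oM; apply: open_comp => // x _; exact: pt_continuous. Qed.

Lemma open_fibre M b : open M -> open (fibre M b).
Proof. by move=> oM; apply: open_comp => // x _; exact: fib_continuous. Qed.

Lemma open_pr_image M : open M -> open (@pr R @` M).
Proof.
move=> oM; rewrite openE => _ [x Mx <-].
have := open_slice (s := x 0 ord_max) oM.
rewrite openE => /(_ (pr x)); rewrite /= pt_pr => /(_ Mx).
by apply: filterS => b Mb; exists (pt b (x 0 ord_max)) => //; exact: ptK.
Qed.

Lemma derive_pr (f : B3 -> R) x v :
  'D_v (fun y => f (pr y)) x = 'D_(pr v) f (pr x).
Proof.
rewrite /derive; set F := (X in lim (X @ _)); set G := (X in _ = lim (X @ _)).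
by have -> : F = G by apply/funext => h; rewrite /F /G /= prD prZ.
Qed.

Lemma derivable_pr (f : B3 -> R) x v :
  derivable f (pr x) (pr v) -> derivable (fun y => f (pr y)) x v.
Proof.
rewrite /derivable; set F := (X in cvg (X @ _) -> _); set G := (X in _ -> cvg (X @ _)).
suff -> : F = G by [].
by apply/funext => h; rewrite /F /G /= prD prZ.
Qed.

Lemma partial_pr_lift (f : B3 -> R) x j :
  partial (lift ord_max j) (fun y => f (pr y)) x = partial j f (pr x).
Proof. by rewrite /partial derive_pr pr_delta_lift. Qed.

Lemma partial_pr_max (f : B3 -> R) x : partial ord_max (fun y => f (pr y)) x = 0.
Proof. by rewrite /partial derive_pr pr_fib derive0. Qed.

Lemma smooth_pr B (f : B3 -> R) : open B -> smooth B f ->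
  smooth [set x | B (pr x)] (fun x => f (pr x)).
Proof.
move=> oB Sf k; elim: k f Sf => [|k IH] f Sf.
  split=> // x Bx; apply: continuous_comp; first exact: pr_continuous.
  exact: (smooth_continuous Sf Bx).
split=> [x Bx|i].
  apply: continuous_comp; first exact: pr_continuous.
  exact: (smooth_continuous Sf Bx).
case: (unliftP ord_max i) => [j ->|->].
  split=> [x Bx|]; first by apply: derivable_pr; rewrite pr_delta_lift; exact: smooth_derivable Sf Bx.
  rewrite (_ : partial _ _ = fun x => partial j f (pr x)).
    by apply: IH; exact: smooth_partial.
  by apply/funext => x; rewrite partial_pr_lift.
split=> [x Bx|]; first by apply: derivable_pr; rewrite pr_fib; exact: derivable0.
rewrite (_ : partial _ _ = fun=> 0); first exact: Ck_cst.
by apply/funext => x; rewrite partial_pr_max.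
Qed.

Lemma derive_slice (F : M4 -> R) s b v :
  'D_v (fun c => F (pt c s)) b = 'D_(v *m (@dpr R)^T) F (pt b s).
Proof.
rewrite /derive; set G := (X in lim (X @ _)); set H := (X in _ = lim (X @ _)).
by have -> : G = H by apply/funext => h; rewrite /G /H /= ptDl scalemxAl.
Qed.

Lemma derivable_slice (F : M4 -> R) s b v :
  derivable F (pt b s) (v *m (@dpr R)^T) -> derivable (fun c => F (pt c s)) b v.
Proof.
rewrite /derivable; set G := (X in cvg (X @ _) -> _); set H := (X in _ -> cvg (X @ _)).
suff -> : G = H by [].
by apply/funext => h; rewrite /H /G /= ptDl scalemxAl.
Qed.

Lemma partial_slice (F : M4 -> R) s b j :
  partial j (fun c => F (pt c s)) b = partial (lift ord_max j) F (pt b s).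
Proof. by rewrite /partial derive_slice delta_dpr. Qed.

Lemma smooth_slice M (F : M4 -> R) s : open M -> smooth M F ->
  smooth [set b | M (pt b s)] (fun b => F (pt b s)).
Proof.
move=> oM SF k; elim: k F SF => [|k IH] F SF.
  split=> // b Mb; apply: (@continuous_comp _ _ _ (fun c => pt c s) F).
    exact: pt_continuous.
  exact: (smooth_continuous SF Mb).
split=> [b Mb|j].
  apply: (@continuous_comp _ _ _ (fun c => pt c s) F); first exact: pt_continuous.
  exact: (smooth_continuous SF Mb).
split=> [b Mb|].
  by apply: derivable_slice; rewrite delta_dpr; exact: smooth_derivable SF Mb.
rewrite (_ : partial _ _ = fun b => partial (lift ord_max j) F (pt b s)).
  by apply: IH; exact: smooth_partial.
by apply/funext => b; rewrite partial_slice.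
Qed.

(** A smooth function on N that only depends on the base point is the pullback
    of a smooth function, since it can be evaluated along local sections. *)
Lemma smooth_descend N (F : M4 -> R) (c : B3 -> R) : open N -> smooth N F ->
  (forall x, N x -> F x = c (pr x)) -> smooth (@pr R @` N) c.
Proof.
move=> oN SF Fc; apply: smooth_local => _ [x Nx <-].
exists [set b | N (pt b (x 0 ord_max))]; split; first by rewrite /= pt_pr.
apply: (smooth_ext _ _ (@smooth_slice N F (x 0 ord_max) oN SF)).
  exact: open_slice.
by move=> b /Fc; rewrite ptK.
Qed.

Lemma is_derive_fibre N (F : M4 -> R) b s : smooth N F -> N (pt b s) ->
  is_derive s 1 (fun r => F (pt b r)) (partial ord_max F (pt b s)).
Proof.
move=> SF Ns; have df := smooth_derivable (i := ord_max) SF Ns.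
have := @is_derive_line _ _ F (b *m (@dpr R)^T) (fib R) s df.
exact.
Qed.

End Projection.

(** * Indices, determinants and star operators in small dimensions *)

Definition b0 : 'I_3 := @Ordinal 3 0 isT.
Definition b1 : 'I_3 := @Ordinal 3 1 isT.
Definition b2 : 'I_3 := @Ordinal 3 2 isT.
Definition m0 : 'I_4 := @Ordinal 4 0 isT.
Definition m1 : 'I_4 := @Ordinal 4 1 isT.
Definition m2 : 'I_4 := @Ordinal 4 2 isT.
Definition m3 : 'I_4 := @Ordinal 4 3 isT.

Lemma ord3P (P : 'I_3 -> Prop) : P b0 -> P b1 -> P b2 -> forall i, P i.
Proof.
move=> p0 p1 p2 [[|[|[|//]]] lt_i].
- by rewrite (_ : Ordinal lt_i = b0)//; exact: val_inj.
- by rewrite (_ : Ordinal lt_i = b1)//; exact: val_inj.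
- by rewrite (_ : Ordinal lt_i = b2)//; exact: val_inj.
Qed.

Lemma ord4P (P : 'I_4 -> Prop) : P m0 -> P m1 -> P m2 -> P m3 -> forall i, P i.
Proof.
move=> p0 p1 p2 p3 [[|[|[|[|//]]]] lt_i].
- by rewrite (_ : Ordinal lt_i = m0)//; exact: val_inj.
- by rewrite (_ : Ordinal lt_i = m1)//; exact: val_inj.
- by rewrite (_ : Ordinal lt_i = m2)//; exact: val_inj.
- by rewrite (_ : Ordinal lt_i = m3)//; exact: val_inj.
Qed.

Lemma sum3 (V : nmodType) (F : 'I_3 -> V) : \sum_i F i = F b0 + F b1 + F b2.
Proof.
rewrite !big_ord_recl big_ord0 addr0 addrA; congr (F _ + F _ + F _); exact: val_inj.
Qed.

Lemma sum4 (V : nmodType) (F : 'I_4 -> V) :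
  \sum_i F i = F m0 + F m1 + F m2 + F m3.
Proof.
rewrite !big_ord_recl big_ord0 addr0 !addrA.
congr (F _ + F _ + F _ + F _); exact: val_inj.
Qed.

Lemma lift_max0 : lift ord_max b0 = m0. Proof. exact: val_inj. Qed.
Lemma lift_max1 : lift ord_max b1 = m1. Proof. exact: val_inj. Qed.
Lemma lift_max2 : lift ord_max b2 = m2. Proof. exact: val_inj. Qed.
Lemma ord_max3 : ord_max = m3. Proof. exact: val_inj. Qed.
Definition lift_maxE := (lift_max0, lift_max1, lift_max2, ord_max3).

Section Determinants.
Variable R : comNzRingType.

Definition d3 (u v y : 'I_3 -> R) : R :=
    u b0 * (v b1 * y b2 - v b2 * y b1)
  - u b1 * (v b0 * y b2 - v b2 * y b0)
  + u b2 * (v b0 * y b1 - v b1 * y b0).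

Definition d4 (u v y z : 'I_4 -> R) : R :=
  let d i j k := v i * (y j * z k - y k * z j)
               - v j * (y i * z k - y k * z i)
               + v k * (y i * z j - y j * z i) in
  u m0 * d m1 m2 m3 - u m1 * d m0 m2 m3 + u m2 * d m0 m1 m3 - u m3 * d m0 m1 m2.

Lemma det3 (A : 'M[R]_3) : \det A = d3 (A b0) (A b1) (A b2).
Proof.
rewrite (expand_det_row _ b0) sum3 /cofactor.
rewrite !(expand_det_row _ ord0) !big_ord_recl !big_ord0 /cofactor !det_mx11 !mxE.
have -> : lift b0 0 = b1 by exact: val_inj.
have -> : lift b1 0 = b0 by exact: val_inj.
have -> : lift b2 0 = b0 by exact: val_inj.
have -> : lift b0 (lift 0 0) = b2 by exact: val_inj.
have -> : lift b1 (lift 0 0) = b2 by exact: val_inj.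
have -> : lift b2 (lift 0 0) = b1 by exact: val_inj.
have -> : lift (lift ord0 ord0) 0 = 0 :> 'I_2 by exact: val_inj.
have -> : lift b0 0 = b1 by exact: val_inj.
have -> : lift b1 0 = b0 by exact: val_inj.
have -> : lift b2 0 = b0 by exact: val_inj.
by rewrite /d3 /=; ring.
Qed.

Lemma det4 (A : 'M[R]_4) : \det A = d4 (A m0) (A m1) (A m2) (A m3).
Proof.
rewrite (expand_det_row _ m0) sum4 /cofactor !det3 /d3 !mxE.
have -> : lift m0 b0 = m1 by exact: val_inj.
have -> : lift m0 b1 = m2 by exact: val_inj.
have -> : lift m0 b2 = m3 by exact: val_inj.
have -> : lift m1 b0 = m0 by exact: val_inj.
have -> : lift m1 b1 = m2 by exact: val_inj.
have -> : lift m1 b2 = m3 by exact: val_inj.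
have -> : lift m2 b0 = m0 by exact: val_inj.
have -> : lift m2 b1 = m1 by exact: val_inj.
have -> : lift m2 b2 = m3 by exact: val_inj.
have -> : lift m3 b0 = m0 by exact: val_inj.
have -> : lift m3 b1 = m1 by exact: val_inj.
have -> : lift m3 b2 = m2 by exact: val_inj.
by rewrite /d4 /=; ring.
Qed.

Definition unit_vec n (i j : 'I_n) : R := (j == i)%:R.

Lemma d3_linear u v y :
  d3 u v y = \sum_a \sum_b \sum_c u a * v b * y c *
    d3 (unit_vec a) (unit_vec b) (unit_vec c).
Proof. by rewrite !sum3 /d3 /unit_vec /=; ring. Qed.

Lemma d4_linear12 u v y z :
  d4 u v y z = \sum_a \sum_b u a * v b * d4 (unit_vec a) (unit_vec b) y z.
Proof. by rewrite !sum4 /d4 /unit_vec /=; ring. Qed.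

Lemma d4_linear34 u v y z :
  d4 u v y z = \sum_a \sum_b y a * z b * d4 u v (unit_vec a) (unit_vec b).
Proof. by rewrite !sum4 /d4 /unit_vec /=; ring. Qed.

End Determinants.

Lemma trmxZ (R : pzRingType) m n (k : R) (A : 'M[R]_(m, n)) : (k *: A)^T = k *: A^T.
Proof. by apply/matrixP => i j; rewrite !mxE. Qed.

Lemma trmxD (R : nmodType) m n (A C : 'M[R]_(m, n)) : (A + C)^T = A^T + C^T.
Proof. by apply/matrixP => i j; rewrite !mxE. Qed.

Section Stars.
Variable R : realType.

(** The square root in the volume form disappears for the metric of an oriented
    coframe, since det (E^T E) = (det E)^2. *)
Lemma vol_frame n (E : 'M[R]_n.+1) (s : n.+1.-tuple 'I_n.+1) : 0 < \det E ->
  vol (E^T *m E) s = \det (\matrix_(i, j) E j (tnth s i)).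
Proof.
move=> dE; rewrite /vol det_mulmx det_tr -expr2 sqrtr_sqr gtr0_norm// mulrC.
rewrite -[\det E]det_tr -det_mulmx; congr (\det _).
by apply/row_matrixP => i; rewrite row_mul rowK -rowE; apply/rowP => j; rewrite !mxE.
Qed.

Lemma vol_frame3 (E : 'M[R]_3) i j k : 0 < \det E ->
  vol (E^T *m E) [tuple i; j; k] = d3 (E^~ i) (E^~ j) (E^~ k).
Proof. by move=> dE; rewrite vol_frame// det3 /d3 !mxE. Qed.

Lemma vol_frame4 (E : 'M[R]_4) i j k l : 0 < \det E ->
  vol (E^T *m E) [tuple i; j; k; l] = d4 (E^~ i) (E^~ j) (E^~ k) (E^~ l).
Proof. by move=> dE; rewrite vol_frame// det4 /d4 !mxE. Qed.

Lemma rev_sum3 (V : nmodType) (I J K : finType) (F : I -> J -> K -> V) :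
  \sum_a \sum_b \sum_d F a b d = \sum_d \sum_b \sum_a F a b d.
Proof.
rewrite exchange_big/=; under eq_bigr do rewrite exchange_big/=.
by rewrite exchange_big.
Qed.

(** The stars in an orthonormal frame, as opposed to a coordinate frame. *)
Definition hodge3 (c : 'rV[R]_3) : 'M[R]_3 :=
  \matrix_(j, k) \sum_a c 0 a * d3 (unit_vec R a) (unit_vec R j) (unit_vec R k).

Definition hodge4 (X : 'M[R]_4) : 'M[R]_4 :=
  \matrix_(k, l) (2^-1 * \sum_a \sum_b X b a *
     d4 (unit_vec R a) (unit_vec R b) (unit_vec R k) (unit_vec R l)).

(** The stars are natural under changes of frame, because the inverse metric and
    the volume form are. *)
Lemma star1_frame (E : 'M[R]_3) c : 0 < \det E ->
  star1 (E^T *m E) (c *m E) = E^T *m hodge3 c *m E.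
Proof.
move=> dE; have uE : E \in unitmx by rewrite unitmxE unitfE gt_eqF.
have cE : (c *m E *m invmx (E^T *m E)) *m E^T = c.
  rewrite -!mulmxA.
  have -> : invmx (E^T *m E) *m E^T = invmx E.
    rewrite -[LHS]mulmx1 -(mulmxV uE) !mulmxA -[invmx _ *m E^T *m E]mulmxA.
    by rewrite mulVmx ?mul1mx// unitmx_mul unitmx_tr uE.
  by rewrite mulmxV// mulmx1.
set p := _ *m invmx _ in cE; apply/matrixP => j k; rewrite /star1 !mxE.
transitivity (\sum_i \sum_a \sum_b \sum_d p 0 i * (E a i * E b j * E d k *
    d3 (unit_vec R a) (unit_vec R b) (unit_vec R d))).
  apply: eq_bigr => i _; rewrite vol_frame3// d3_linear !mulr_sumr.
  by apply: eq_bigr => a _; rewrite mulr_sumr; apply: eq_bigr => b _; rewrite mulr_sumr.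
transitivity (\sum_a \sum_b \sum_d c 0 a * (E b j * E d k *
    d3 (unit_vec R a) (unit_vec R b) (unit_vec R d))).
  rewrite exchange_big; apply: eq_bigr => a _; rewrite exchange_big.
  apply: eq_bigr => b _; rewrite exchange_big; apply: eq_bigr => d _.
  rewrite -[c in RHS]cE [(p *m _) _ _]mxE mulr_suml.
  by apply: eq_bigr => i _; rewrite [E^T _ _]mxE; ring.
rewrite rev_sum3; apply: eq_bigr => d _; rewrite mxE mulr_suml.
apply: eq_bigr => b _; rewrite !mxE mulr_sumr mulr_suml.
by apply: eq_bigr => a _; ring.
Qed.

Lemma star2_frame (E : 'M[R]_4) X : 0 < \det E ->
  star2 (E^T *m E) (E^T *m X *m E) = E^T *m hodge4 X *m E.
Proof.
move=> dE; have uE : E \in unitmx by rewrite unitmxE unitfE gt_eqF.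
have uE2 : E^T *m E \in unitmx by rewrite unitmx_mul unitmx_tr uE.
have iE : invmx (E^T *m E) *m E^T = invmx E.
  rewrite -[LHS]mulmx1 -(mulmxV uE) !mulmxA -[invmx _ *m E^T *m E]mulmxA.
  by rewrite mulVmx ?mul1mx.
have upE : E *m (invmx (E^T *m E) *m (E^T *m X *m E) *m (invmx (E^T *m E))^T) *m E^T = X.
  have sE : (invmx (E^T *m E))^T = invmx (E^T *m E).
    by rewrite trmx_inv trmx_mul trmxK.
  rewrite sE !mulmxA -!mulmxA iE !mulmxA.
  rewrite -[E *m invmx _ *m E^T]mulmxA iE mulmxV// mul1mx.
  by rewrite -mulmxA mulmxV// mulmx1.
rewrite /star2; set up := invmx _ *m (_ *m X *m _) *m (invmx _)^T in upE *.
apply/matrixP => k l; rewrite !mxE.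
transitivity (2^-1 * \sum_a \sum_b X b a *
    d4 (unit_vec R a) (unit_vec R b) (E^~ k) (E^~ l)).
  congr (_ * _).
  transitivity (\sum_i \sum_j \sum_a \sum_b up i j * (E a j * E b i) *
      d4 (unit_vec R a) (unit_vec R b) (E^~ k) (E^~ l)).
    apply: eq_bigr => i _; apply: eq_bigr => j _.
    rewrite vol_frame4// d4_linear12 mulr_sumr; apply: eq_bigr => a _.
    by rewrite mulr_sumr; apply: eq_bigr => b _; ring.
  under eq_bigr do rewrite exchange_big/=.
  rewrite exchange_big/=; apply: eq_bigr => a _.
  under eq_bigr do rewrite exchange_big/=.
  rewrite exchange_big/=; apply: eq_bigr => b _.
  rewrite -upE mxE mulr_suml exchange_big/=; apply: eq_bigr => j _.
  rewrite !mxE !mulr_suml; apply: eq_bigr => i _; ring.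
transitivity (2^-1 * \sum_a \sum_b \sum_c \sum_d E c k * E d l * (X b a *
    d4 (unit_vec R a) (unit_vec R b) (unit_vec R c) (unit_vec R d))).
  congr (_ * _); apply: eq_bigr => a _; apply: eq_bigr => b _.
  rewrite d4_linear34 mulr_sumr; apply: eq_bigr => c _.
  by rewrite mulr_sumr; apply: eq_bigr => d _; ring.
under eq_bigr do rewrite exchange_big/=.
rewrite exchange_big/=.
under eq_bigr do under eq_bigr do rewrite exchange_big/=.
under eq_bigr do rewrite exchange_big/=.
rewrite exchange_big/= mulr_sumr; apply: eq_bigr => d _.
rewrite mxE mulr_sumr mulr_suml; apply: eq_bigr => c _.
rewrite !mxE mulr_sumr [RHS]mulrAC.
rewrite -mulrA [_ * \sum_a _]mulr_sumr [in RHS]mulr_sumr.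
rewrite mulr_sumr; apply: eq_bigr => a _.
by rewrite !mulr_sumr; apply: eq_bigr => b _; ring.
Qed.

(** On antisymmetric matrices, with the convention *(X /\ Y) = i_X i_Y vol, the
    star exchanges the six planes in pairs, with the signs of the complementary
    planes reversed. *)
Lemma hodge4E (X : 'M[R]_4) : X^T = - X ->
  [/\ hodge4 X m0 m1 = - X m2 m3, hodge4 X m0 m2 = X m1 m3,
      hodge4 X m0 m3 = - X m1 m2, hodge4 X m1 m2 = - X m0 m3 &
      hodge4 X m1 m3 = X m0 m2 /\ hodge4 X m2 m3 = - X m0 m1].
Proof.
move=> aX; have aE i j : X j i = - X i j.
  by have := congr1 (fun Y : 'M[R]_4 => Y i j) aX; rewrite !mxE.
have E2 : 2 != 0 :> R by rewrite pnatr_eq0.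
rewrite !mxE !sum4 /d4 /unit_vec /=.
rewrite (aE m0 m1) (aE m0 m2) (aE m0 m3) (aE m1 m2) (aE m1 m3) (aE m2 m3).
by split; [field|field|field|field|split; field].
Qed.

Lemma hodge4_fix (X : 'M[R]_4) : X^T = - X -> X m0 m1 + X m2 m3 = 0 ->
  X m0 m2 - X m1 m3 = 0 -> X m0 m3 + X m1 m2 = 0 -> hodge4 X = X.
Proof.
move=> aX /eqP; rewrite addr_eq0 => /eqP E1 /eqP; rewrite subr_eq0 => /eqP E2.
move=> /eqP; rewrite addr_eq0 => /eqP E3.
have [H1 H2 H3 H4 [H5 H6]] := hodge4E aX.
have aE i j : X j i = - X i j.
  by have := congr1 (fun Y : 'M[R]_4 => Y i j) aX; rewrite !mxE.
have aH i j : hodge4 X j i = - hodge4 X i j.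
  rewrite !mxE -mulrN; congr (_ * _); rewrite -sumrN; apply: eq_bigr => u _.
  by rewrite -sumrN; apply: eq_bigr => v _; rewrite /d4; ring.
have dE (Y : 'M[R]_4) i : (forall i j, Y j i = - Y i j) -> Y i i = 0.
  by move=> aY; have /eqP := aY i i; rewrite -subr_eq0 opprK -mulr2n mulrn_eq0/= => /eqP.
have L : forall i j : 'I_4, (i < j)%N -> hodge4 X i j = X i j.
  by elim/ord4P; elim/ord4P => // _; rewrite ?H1 ?H2 ?H3 ?H4 ?H5 ?H6 ?E1 ?E2 ?E3 ?opprK.
apply/matrixP => i j; case: (ltngtP i j) => [/L//|ji|/val_inj ->].
  by rewrite aH aE L.
by rewrite (dE _ _ aH) (dE _ _ aE).
Qed.

Lemma hodge3E (c : 'rV[R]_3) :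
  hodge3 c = \matrix_(j, k) d3 (c 0) (unit_vec R j) (unit_vec R k).
Proof.
apply/matrixP => j k; rewrite !mxE sum3 /d3 /unit_vec.
by elim/ord3P: j; elim/ord3P: k => /=; ring.
Qed.

Lemma hodge4Z k (X : 'M[R]_4) : hodge4 (k *: X) = k *: hodge4 X.
Proof.
apply/matrixP => i j; rewrite !mxE [RHS]mulrCA [in RHS]mulr_sumr; congr (_ * _).
apply: eq_bigr => a _; rewrite mulr_sumr; apply: eq_bigr => b _.
by rewrite mxE mulrA.
Qed.

(** Conformal invariance: for the coframe sqrt lam F the components of the 2-form
    are divided by lam, and going back to F multiplies those of the star by lam. *)
Lemma star2_conformal (F : 'M[R]_4) (lam : R) X : 0 < \det F -> 0 < lam ->
  star2 (lam *: (F^T *m F)) (F^T *m X *m F) = F^T *m hodge4 X *m F.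
Proof.
move=> dF l0; pose s := Num.sqrt lam.
have s0 : 0 < s by rewrite sqrtr_gt0.
have ss : s * s = lam by rewrite -expr2 sqr_sqrtr// ltW.
have sc (Y : 'M[R]_4) : F^T *m Y *m F = (s *: F)^T *m ((s * s)^-1 *: Y) *m (s *: F).
  rewrite trmxZ -!scalemxAl -!scalemxAr -!scalemxAl !scalerA [s * _]mulrC -mulrA.
  by rewrite mulrCA mulVf ?scale1r// mulf_neq0// gt_eqF.
have -> : lam *: (F^T *m F) = (s *: F)^T *m (s *: F).
  by rewrite trmxZ -scalemxAl -scalemxAr scalerA ss.
rewrite sc star2_frame; first by rewrite hodge4Z -sc.
by rewrite detZ mulr_gt0// exprn_gt0.
Qed.

Lemma wedgeE n (p q : 'rV[R]_n.+1) : wedge p q = p^T *m q - q^T *m p.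
Proof.
by apply/matrixP => i j; rewrite !mxE !big_ord1 !mxE; ring.
Qed.

Lemma wedge_mul n m (p q : 'rV[R]_n.+1) (F : 'M[R]_(n.+1, m.+1)) :
  wedge (p *m F) (q *m F) = F^T *m wedge p q *m F.
Proof. by rewrite !wedgeE !trmx_mul mulmxBr mulmxBl !mulmxA. Qed.

End Stars.

Section Frames.
Variable R : realType.
Local Notation dpr := (@dpr R).
Local Notation fib := (@fib R).

Lemma dprT_fib : dpr^T *m fib^T = 0.
Proof. by rewrite -trmx_mul fib_dpr trmx0. Qed.

Lemma fib_fib : fib *m fib^T = 1%:M.
Proof.
apply/matrixP => i j; rewrite !ord1 /Defs.fib -rowE !mxE.
by rewrite !eqxx.
Qed.

Lemma row_dprE i j : (row i dpr) 0 j = (i == lift ord_max j)%:R.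
Proof. by rewrite !mxE. Qed.

Lemma pullE (H : 'M[R]_3) (a b : 'I_4) : (dpr *m H *m dpr^T) a b =
  match unlift ord_max a, unlift ord_max b with
  | Some i, Some j => H i j | _, _ => 0 end.
Proof.
have rE i : row (lift ord_max i) dpr = delta_mx 0 i :> 'rV[R]_3.
  by apply/rowP => j; rewrite row_dprE !mxE (inj_eq (@lift_inj _ _)) eq_sym.
have rM : row ord_max dpr = 0 :> 'rV[R]_3.
  by apply/rowP => j; rewrite row_dprE !mxE (negbTE (neq_lift _ _)).
have -> : (dpr *m H *m dpr^T) a b = (row a dpr *m H *m (row b dpr)^T) 0 0.
  rewrite -row_mul -[row a _ *m _]trmxK; rewrite !mxE; apply: eq_bigr => i _.
  by rewrite !mxE.
case: unliftP => [i ->|->]; last by rewrite rM !mul0mx mxE.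
case: unliftP => [j ->|->]; last by rewrite rM trmx0 mulmx0 mxE.
rewrite !rE -rowE mxE (bigD1 j)//= big1 ?addr0.
  by rewrite !mxE !eqxx mulr1.
by move=> k /negbTE nk; rewrite !mxE eqxx nk mulr0.
Qed.

(** The coframe of the metric pi^* h + u^2: the pullback of the coframe E of h,
    completed by the 1-form u. *)
Definition coframe (E : 'M[R]_3) (u : 'rV[R]_4) : 'M[R]_4 :=
  dpr *m E *m dpr^T + fib^T *m u.

Lemma coframe_metric E u : (coframe E u)^T *m coframe E u =
  dpr *m (E^T *m E) *m dpr^T + u^T *m u.
Proof.
rewrite /coframe trmxD !trmx_mul !trmxK mulmxDl !mulmxDr.
have -> : dpr *m (E^T *m dpr^T) *m (fib^T *m u) = 0.
  by rewrite -!mulmxA [dpr^T *m _]mulmxA dprT_fib mul0mx !mulmx0.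
have -> : u^T *m fib *m (dpr *m E *m dpr^T) = 0.
  by rewrite -!mulmxA [fib *m _]mulmxA fib_dpr mul0mx mulmx0.
rewrite addr0 add0r; congr (_ + _).
  by rewrite !mulmxA -[dpr *m E^T *m _ *m dpr]mulmxA dprK mulmx1.
by rewrite !mulmxA -[_ *m fib *m _]mulmxA fib_fib mulmx1.
Qed.

Lemma fib_coframe E u : fib *m coframe E u = u.
Proof. by rewrite /coframe mulmxDr !mulmxA fib_dpr !mul0mx add0r fib_fib mul1mx. Qed.

Lemma pull_coframe m E u (c : 'M[R]_(m, 3)) :
  (c *m dpr^T) *m coframe E u = c *m E *m dpr^T.
Proof.
rewrite /coframe mulmxDr !mulmxA -[c *m dpr^T *m dpr]mulmxA dprK mulmx1.
by rewrite -[c *m _ *m fib^T]mulmxA dprT_fib mulmx0 mul0mx addr0.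
Qed.

Lemma pull2_coframe E u (H : 'M[R]_3) :
  (coframe E u)^T *m (dpr *m H *m dpr^T) *m coframe E u
  = dpr *m (E^T *m H *m E) *m dpr^T.
Proof.
have L : dpr^T *m coframe E u = E *m dpr^T.
  by have := pull_coframe E u (1%:M : 'M[R]_3); rewrite !mul1mx.
by rewrite -!mulmxA L !mulmxA -[_ *m dpr *m H *m E]mulmxA -[(_)^T *m dpr]trmxK
  trmx_mul trmxK L trmx_mul trmxK !mulmxA.
Qed.

Lemma coframe_fib E u : coframe E u *m fib^T = (u 0 ord_max) *: fib^T.
Proof.
rewrite /coframe mulmxDl -!mulmxA dprT_fib !mulmx0 add0r.
suff -> : u *m fib^T = (u 0 ord_max)%:M by rewrite mul_mx_scalar.
apply/matrixP => i j; rewrite !ord1 -[LHS]/((u *m fib^T) 0 0) mxE (bigD1 ord_max)//= big1.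
  by rewrite !mxE !eqxx mulr1 addr0.
by move=> k /negbTE nk; rewrite !mxE nk mulr0.
Qed.

Lemma det_coframe E u : \det (coframe E u) = \det E * u 0 ord_max.
Proof.
have cE a b : coframe E u a b = match unlift ord_max a with
    | Some i => if unlift ord_max b is Some j then E i j else 0
    | None => u 0 b end.
  rewrite mxE pullE [X in _ + X]mxE big_ord1 !mxE.
  case: unliftP => [i ->|->]; last by rewrite !eqxx mul1r add0r.
  rewrite [lift _ _ == _]eq_sym (negbTE (neq_lift _ _)) andbF mul0r addr0.
  by case: unliftP.
rewrite det4 det3 /d4 /d3 !cE -!lift_maxE !liftK unlift_none.
by ring.
Qed.

Lemma wedge_tr n (p q : 'rV[R]_n.+1) : (wedge p q)^T = - wedge p q.
Proof. by apply/matrixP => i j; rewrite !mxE opprB. Qed.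

Lemma hodge3_tr (c : 'rV[R]_3) : (hodge3 c)^T = - hodge3 c.
Proof.
by rewrite hodge3E; apply/matrixP => i j; rewrite !mxE /d3; ring.
Qed.

(** Components of theta /\ eta + pi^* ( *_B beta) in the orthonormal coframe with
    last element theta / k, for q and c the components of eta and beta. *)
Definition split_form (k : R) (q : 'rV[R]_4) (c : 'rV[R]_3) : 'M[R]_4 :=
  wedge (k *: fib) q + dpr *m hodge3 c *m dpr^T.

Lemma split_form_tr k q c : (split_form k q c)^T = - split_form k q c.
Proof.
rewrite /split_form trmxD wedge_tr !trmx_mul trmxK hodge3_tr opprD.
by rewrite mulmxA mulmxN mulNmx.
Qed.

Lemma split_formE k q c :
  [/\ split_form k q c m0 m1 = c 0 b2, split_form k q c m0 m2 = - c 0 b1,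
      split_form k q c m1 m2 = c 0 b0, split_form k q c m0 m3 = - (k * q 0 m0) &
      split_form k q c m1 m3 = - (k * q 0 m1) /\
      split_form k q c m2 m3 = - (k * q 0 m2)].
Proof.
have fE i : fib 0 i = (i == m3)%:R by rewrite !mxE /= -ord_max3.
have E a b : split_form k q c a b = k * fib 0 a * q 0 b - k * fib 0 b * q 0 a
    + match unlift ord_max a, unlift ord_max b with
      | Some i, Some j => hodge3 c i j | _, _ => 0 end.
  by rewrite mxE pullE; congr (_ + _); rewrite !mxE.
rewrite !E !fE hodge3E -!lift_maxE !liftK unlift_none !lift_maxE !mxE /d3 /unit_vec /=.
by do !split; ring.
Qed.

Section Splitting.
Variables (E : 'M[R]_3) (w : R) (th : 'rV[R]_4).
Hypotheses (dE : 0 < \det E) (w0 : 0 < w) (th1 : th 0 ord_max = 1).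
Let h := E^T *m E.
Let F := coframe E (w^-1 *: th).

Lemma coframeE : F^T *m F = dpr *m h *m dpr^T + w ^- 2 *: (th^T *m th).
Proof.
rewrite coframe_metric; congr (_ + _).
by rewrite trmxZ -scalemxAl -scalemxAr scalerA -invfM expr2.
Qed.

Lemma det_coframe_gt0 : 0 < \det F.
Proof. by rewrite det_coframe !mxE th1 mulr1 mulr_gt0// invr_gt0. Qed.

Let uF : F \in unitmx.
Proof. by rewrite unitmxE unitfE gt_eqF// det_coframe_gt0. Qed.

Let uE : E \in unitmx.
Proof. by rewrite unitmxE unitfE gt_eqF. Qed.

Lemma split_form_coframe (eta : 'rV[R]_4) (beta : 'rV[R]_3) :
  wedge th eta + dpr *m star1 h beta *m dpr^T
  = F^T *m split_form w (eta *m invmx F) (beta *m invmx E) *m F.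
Proof.
rewrite /split_form [F^T *m (_ + _)]mulmxDr [(_ + _) *m F]mulmxDl -wedge_mul mulmxKV// -scalemxAl fib_coframe.
rewrite scalerA mulfV ?gt_eqF// scale1r pull2_coframe; congr (_ + _).
by rewrite -star1_frame// mulmxKV.
Qed.

Lemma star2_split lam eta beta : 0 < lam ->
  star2 (lam *: (dpr *m h *m dpr^T + w ^- 2 *: (th^T *m th)))
    (wedge th eta + dpr *m star1 h beta *m dpr^T)
  = F^T *m hodge4 (split_form w (eta *m invmx F) (beta *m invmx E)) *m F.
Proof.
by move=> l0; rewrite -coframeE split_form_coframe star2_conformal// det_coframe_gt0.
Qed.

(** Only the horizontal part of a 2-form contributes to the contraction of its
    star with the vertical direction; this is how omega is computed. *)
Lemma vertical_star lam eta beta : 0 < lam ->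
  fib *m star2 (lam *: (dpr *m h *m dpr^T + w ^- 2 *: (th^T *m th)))
    (wedge th eta + dpr *m star1 h beta *m dpr^T) = w^-1 *: (beta *m dpr^T).
Proof.
move=> l0; rewrite star2_split// !mulmxA -[fib *m F^T]trmxK trmx_mul !trmxK.
rewrite coframe_fib !mxE th1 mulr1 trmxZ trmxK -!scalemxAl; congr (_ *: _).
set c := beta *m invmx E; set X := split_form _ _ _.
have -> : fib *m hodge4 X = c *m dpr^T; last first.
  by rewrite pull_coframe mulmxKV.
have [H1 H2 H3 H4 [H5 H6]] := hodge4E (split_form_tr w (eta *m invmx F) c).
have aX i j : hodge4 X j i = - hodge4 X i j.
  rewrite !mxE -mulrN; congr (_ * _); rewrite -sumrN; apply: eq_bigr => a _.
  by rewrite -sumrN; apply: eq_bigr => b _; rewrite /d4; ring.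
have [C1 C2 C3 _ _] := split_formE w (eta *m invmx F) c.
apply/rowP => i; rewrite /Defs.fib -rowE mxE.
elim/ord4P: i; rewrite ord_max3 -/X.
- by rewrite (aX m0 m3) H3 C3 opprK -lift_max0 lift_dpr.
- by rewrite (aX m1 m3) H5 C2 opprK -lift_max1 lift_dpr.
- by rewrite (aX m2 m3) H6 C1 opprK -lift_max2 lift_dpr.
- have /eqP := aX m3 m3; rewrite -subr_eq0 opprK -mulr2n mulrn_eq0/= => /eqP->.
  by rewrite -ord_max3 max_dpr.
Qed.

(** A selfdual 2-form is determined by its vertical part: the horizontal part is
    the star of the same 1-form on the base, up to the length scale. *)
Lemma selfdual_split eta :
  let a := wedge th (eta *m dpr^T) + dpr *m star1 h (w *: eta) *m dpr^T in
  star2 (dpr *m h *m dpr^T + w ^- 2 *: (th^T *m th)) a = a.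
Proof.
move=> a; rewrite -[X in star2 X]scale1r star2_split// /a split_form_coframe.
set c := w *: eta *m invmx E; set q := eta *m _ *m _; set X := split_form _ _ _.
suff -> : hodge4 X = X by [].
have qE i : w * q 0 (lift ord_max i) = c 0 i.
  have -> : q = (eta *m invmx E) *m dpr^T.
    by rewrite /q -[eta in LHS](mulmxKV uE) -(pull_coframe E (w^-1 *: th)) mulmxK.
  by rewrite lift_dpr /c -scalemxAl [RHS]mxE.
have [C1 C2 C3 C4 [C5 C6]] := split_formE w q c.
have Q0 := qE b0; have Q1 := qE b1; have Q2 := qE b2.
rewrite lift_max0 in Q0; rewrite lift_max1 in Q1; rewrite lift_max2 in Q2.
rewrite Q0 Q1 Q2 in C4 C5 C6.
by apply: (hodge4_fix (split_form_tr w q c)); rewrite -/X ?C1 ?C2 ?C3 ?C4 ?C5 ?C6; ring.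
Qed.

End Splitting.

(** In an orthonormal frame the star is the bijection between the components of a
    1-form and the three independent entries of an antisymmetric matrix. *)
Lemma star1_surj (E H : 'M[R]_3) : 0 < \det E -> H^T = - H ->
  exists beta, star1 (E^T *m E) beta = H.
Proof.
move=> dE aH; have uE : E \in unitmx by rewrite unitmxE unitfE gt_eqF.
pose K := (invmx E)^T *m H *m invmx E.
have aK i j : K j i = - K i j.
  have : K^T = - K by rewrite /K !trmx_mul trmxK aH mulNmx mulmxN mulmxA.
  by move=> /(congr1 (fun Y : 'M[R]_3 => Y i j)); rewrite !mxE.
have KE : K = (invmx E)^T *m H *m invmx E by [].
clearbody K.
pose c : 'rV[R]_3 := \row_i (if i == b0 then K b1 b2 else if i == b1 then K b2 b0
                             else K b0 b1).
exists (c *m E); rewrite star1_frame//.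
have -> : hodge3 c = K.
  have dK i : K i i = 0.
    by have /eqP := aK i i; rewrite -subr_eq0 opprK -mulr2n mulrn_eq0/= => /eqP.
  rewrite hodge3E; apply/matrixP => i j; rewrite mxE /d3 /unit_vec /c !mxE /=.
  have A1 := aK b0 b1; have A2 := aK b2 b0; have A3 := aK b1 b2.
  by elim/ord3P: i; elim/ord3P: j; rewrite /= ?dK ?A1 ?A2 ?A3; ring.
by rewrite KE !mulmxA -trmx_mul mulVmx// trmx1 mul1mx -mulmxA mulVmx// mulmx1.
Qed.

(** Gram-Schmidt: an upper triangular coframe, smooth because it is obtained
    from the metric by field operations and square roots of positive functions. *)
Lemma orthonormal_coframe (B : set 'rV[R]_3) h : open B -> is_metric B h ->
  exists E : 'rV[R]_3 -> 'M[R]_3, smooth_mx B E /\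
    forall b, B b -> h b = (E b)^T *m E b /\ 0 < \det (E b).
Proof.
move=> oB [Sh hh].
pose e00 b := Num.sqrt (h b b0 b0).
pose e01 b := h b b0 b1 * (e00 b)^-1.
pose e02 b := h b b0 b2 * (e00 b)^-1.
pose d1 b := h b b1 b1 - e01 b * e01 b.
pose e11 b := Num.sqrt (d1 b).
pose e12 b := (h b b1 b2 - e01 b * e02 b) * (e11 b)^-1.
pose d2 b := h b b2 b2 - e02 b * e02 b - e12 b * e12 b.
pose e22 b := Num.sqrt (d2 b).
have ipE b (x y z : R) : B b -> let X := \row_i (if i == b0 then x else
      if i == b1 then y else z) in
    X != 0 -> 0 < x * x * h b b0 b0 + y * y * h b b1 b1 + z * z * h b b2 b2
      + 2 * x * y * h b b0 b1 + 2 * x * z * h b b0 b2 + 2 * y * z * h b b1 b2.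
  move=> Bb X X0; have [hT hp] := hh b Bb.
  have sy i j : h b j i = h b i j.
    by have := congr1 (fun Y : 'M[R]_3 => Y i j) hT; rewrite !mxE.
  have := hp X X0; rewrite /ip mxE sum3 !mxE !sum3 !mxE /=.
  by rewrite (sy b0 b1) (sy b0 b2) (sy b1 b2); congr (_ < _); ring.
have p0 b : B b -> 0 < h b b0 b0.
  move=> Bb; have := ipE b 1 0 0 Bb.
  have X0 : \row_i (if i == b0 then 1 else if i == b1 then 0 else 0) != 0 :> 'rV[R]_3.
    by apply/eqP => /rowP/(_ b0); rewrite !mxE /= => /eqP; rewrite oner_eq0.
  by move=> /(_ X0); congr (_ < _); ring.
have n0 b : B b -> e00 b != 0 by move=> Bb; rewrite gt_eqF// sqrtr_gt0 p0.
have s0 b : B b -> e00 b * e00 b = h b b0 b0.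
  by move=> Bb; rewrite -expr2 sqr_sqrtr// ltW// p0.
have p1 b : B b -> 0 < d1 b.
  move=> Bb; have := ipE b (- (e01 b / e00 b)) 1 0 Bb.
  have X0 : \row_i (if i == b0 then - (e01 b / e00 b) else if i == b1 then 1 else 0)
      != 0 :> 'rV[R]_3.
    by apply/eqP => /rowP/(_ b1); rewrite !mxE /= => /eqP; rewrite oner_eq0.
  move=> /(_ X0); congr (_ < _); rewrite /d1 -(s0 b Bb).
  have -> : h b b0 b1 = e01 b * e00 b by rewrite /e01 mulfVK// n0.
  by field; exact: n0.
have n1 b : B b -> e11 b != 0 by move=> Bb; rewrite gt_eqF// sqrtr_gt0 p1.
have s1 b : B b -> e11 b * e11 b = d1 b.
  by move=> Bb; rewrite -expr2 sqr_sqrtr// ltW// p1.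
have h01 b : B b -> h b b0 b1 = e01 b * e00 b by move=> Bb; rewrite /e01 mulfVK// n0.
have h02 b : B b -> h b b0 b2 = e02 b * e00 b by move=> Bb; rewrite /e02 mulfVK// n0.
have h12 b : B b -> h b b1 b2 = e12 b * e11 b + e01 b * e02 b.
  by move=> Bb; rewrite /e12 mulfVK ?n1// subrK.
have h11 b : B b -> h b b1 b1 = e11 b * e11 b + e01 b * e01 b.
  by move=> Bb; rewrite s1// /d1 subrK.
have p2 b : B b -> 0 < d2 b.
  move=> Bb; pose y := - (e12 b / e11 b); pose x := - ((e01 b * y + e02 b) / e00 b).
  have := ipE b x y 1 Bb.
  have X0 : \row_i (if i == b0 then x else if i == b1 then y else 1)
      != 0 :> 'rV[R]_3.
    by apply/eqP => /rowP/(_ b2); rewrite !mxE /= => /eqP; rewrite oner_eq0.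
  move=> /(_ X0); congr (_ < _).
  rewrite h01// h02// h12// h11// -s0// /d2 /x /y.
  by field; rewrite n0 ?n1.
have n2 b : B b -> e22 b != 0 by move=> Bb; rewrite gt_eqF// sqrtr_gt0 p2.
have s2 b : B b -> e22 b * e22 b = d2 b.
  by move=> Bb; rewrite -expr2 sqr_sqrtr// ltW// p2.
have S00 : smooth B e00 by apply: smooth_sqrt.
have S01 : smooth B e01 by apply: smoothM => //; exact: smoothV.
have S02 : smooth B e02 by apply: smoothM => //; exact: smoothV.
have S11 : smooth B e11.
  by apply: smooth_sqrt => //; apply: smoothB => //; exact: smoothM.
have S12 : smooth B e12.
  apply: smoothM => //; last exact: smoothV.
  by apply: smoothB => //; exact: smoothM.
have S22 : smooth B e22.
  apply: smooth_sqrt => //; apply: smoothB => //; last exact: smoothM.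
  by apply: smoothB => //; exact: smoothM.
pose E b : 'M[R]_3 := \matrix_(i, j)
  (if i == b0 then (if j == b0 then e00 b else if j == b1 then e01 b else e02 b)
   else if i == b1 then (if j == b0 then 0 else if j == b1 then e11 b else e12 b)
   else if j == b2 then e22 b else 0).
exists E; split.
  move=> i j; under eq_fun do rewrite mxE.
  have S0 := smooth_cst B (0 : R).
  by elim/ord3P: i; elim/ord3P: j.
move=> b Bb; split; last first.
  have -> : \det (E b) = e00 b * (e11 b * e22 b).
    by rewrite det3 /d3 /E !mxE /=; ring.
  by rewrite !mulr_gt0// sqrtr_gt0 ?p0 ?p1 ?p2.
have [hT _] := hh b Bb.
have sy i j : h b j i = h b i j.
  by have := congr1 (fun Y : 'M[R]_3 => Y i j) hT; rewrite !mxE.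
have h22 : h b b2 b2 = e22 b * e22 b + e12 b * e12 b + e02 b * e02 b.
  by rewrite s2// /d2; ring.
apply/matrixP => i j; rewrite !mxE sum3 !mxE /=.
have S1 := sy b0 b1; have S2 := sy b0 b2; have S3 := sy b1 b2.
elim/ord3P: i; elim/ord3P: j; rewrite /= ?S1 ?S2 ?S3 -?s0// ?h01// ?h02// ?h12// ?h11// ?h22; ring.
Qed.

End Frames.

(** * Connections, coframes and curvature *)

Section Connections.
Variables (R : realType) (n : nat).
Local Notation V := 'rV[R]_n.+1.
Local Notation I := 'I_n.+1.
Implicit Types (x : V) (U : set V) (i j k l : I).

Definition dmx m p i (A : V -> 'M[R]_(m, p)) x : 'M[R]_(m, p) :=
  \matrix_(k, l) partial i (fun y => A y k l) x.

Lemma dmx_mul m p q i U (A : V -> 'M[R]_(m, p)) (C : V -> 'M[R]_(p, q)) x :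
  open U -> U x -> (forall a b, smooth U (fun y => A y a b)) ->
  (forall a b, smooth U (fun y => C y a b)) ->
  dmx i (fun y => A y *m C y) x = dmx i A x *m C x + A x *m dmx i C x.
Proof.
move=> oU Ux SA SC; apply/matrixP => a b; rewrite !mxE -big_split/=.
rewrite (_ : (fun y => _) = fun y => \sum_c A y a c * C y c b); last first.
  by apply/funext => y; rewrite mxE.
rewrite (partial_sum _ _ oU Ux); last by move=> c; exact: smoothM.
apply: eq_bigr => c _; rewrite !mxE partialM; last 2 first.
- exact: smooth_derivable (SA _ _) Ux.
- exact: smooth_derivable (SC _ _) Ux.
by rewrite addrC [C x c b * _]mulrC.
Qed.

Lemma dmxD m p i U (A C : V -> 'M[R]_(m, p)) x :
  open U -> U x -> (forall a b, smooth U (fun y => A y a b)) ->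
  (forall a b, smooth U (fun y => C y a b)) ->
  dmx i (fun y => A y + C y) x = dmx i A x + dmx i C x.
Proof.
move=> oU Ux SA SC; apply/matrixP => a b; rewrite !mxE.
rewrite (_ : (fun y => _) = fun y => A y a b + C y a b); last first.
  by apply/funext => y; rewrite mxE.
rewrite partialD//; first exact: smooth_derivable (SA _ _) Ux.
exact: smooth_derivable (SC _ _) Ux.
Qed.

Lemma dmx_ext m p i U (A C : V -> 'M[R]_(m, p)) x : open U -> U x ->
  (forall y, U y -> A y = C y) -> dmx i A x = dmx i C x.
Proof.
move=> oU Ux AC; apply/matrixP => a b; rewrite !mxE.
by apply: (partial_ext _ oU Ux) => y /AC ->.
Qed.

Lemma dmx_tr m p i (A : V -> 'M[R]_(m, p)) x :
  dmx i (fun y => (A y)^T) x = (dmx i A x)^T.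
Proof.
apply/matrixP => a b; rewrite !mxE; congr (partial i _ x).
by apply/funext => y; rewrite mxE.
Qed.

Lemma dmx_comm m p i j U (A : V -> 'M[R]_(m, p)) x : open U -> U x ->
  (forall a b, smooth U (fun y => A y a b)) ->
  dmx i (dmx j A) x = dmx j (dmx i A) x.
Proof.
move=> oU Ux SA; apply/matrixP => a b.
have E i' : (fun y => dmx i' A y a b) = partial i' (fun y => A y a b).
  by apply/funext => y; rewrite mxE.
rewrite [LHS]mxE [RHS]mxE !E; exact: (partial_comm _ _ oU (SA a b) Ux).
Qed.

Lemma smooth_dmx m p i U (A : V -> 'M[R]_(m, p)) a b :
  (forall a b, smooth U (fun y => A y a b)) -> smooth U (fun y => dmx i A y a b).
Proof. by move=> SA; under eq_fun do rewrite mxE; exact: smooth_partial. Qed.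

Definition conn_mx (Gam : V -> I -> I -> I -> R) i x : 'M[R]_n.+1 :=
  \matrix_(k, j) Gam x k i j.

Definition curv_mx (W : I -> V -> 'M[R]_n.+1) i j x : 'M[R]_n.+1 :=
  dmx i (W j) x - dmx j (W i) x + (W i x *m W j x - W j x *m W i x).

Lemma curvature_mx Gam x i j :
  \matrix_(k, l) curvature Gam x k l i j = curv_mx (conn_mx Gam) i j x.
Proof.
apply/matrixP => k l; rewrite !mxE /curvature; congr (_ - _ + _).
- by congr (partial i _ x); apply/funext => y; rewrite mxE.
- by congr (partial j _ x); apply/funext => y; rewrite mxE.
by rewrite -sumrB; apply: eq_bigr => m _; rewrite !mxE.
Qed.

Section Metric.
Variables (U : set V) (g : V -> 'M[R]_n.+1) (a : V -> V).
Hypotheses (oU : open U) (Sg : smooth_mx U g) (Sa : smooth_row U a)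
  (gT : forall x, U x -> (g x)^T = g x) (gV : forall x, U x -> g x \in unitmx).

Let dg x i j l := partial i (fun y => g y j l) x + 2 * a x 0 i * g x j l.

Let g_sym x i j : U x -> g x i j = g x j i.
Proof. by move=> Ux; have := congr1 (fun A : 'M[R]_n.+1 => A j i) (gT Ux); rewrite mxE. Qed.

Let dg_sym x i j l : U x -> dg x i j l = dg x i l j.
Proof.
move=> Ux; rewrite /dg (g_sym j l Ux); congr (_ + _).
by apply: (partial_ext _ oU Ux) => y; exact: g_sym.
Qed.

Lemma christoffel_sym x k i j : U x ->
  christoffel g a x k i j = christoffel g a x k j i.
Proof.
move=> Ux; rewrite /christoffel; congr (_ * _); apply: eq_bigr => l _.
by rewrite -!/(dg _ _ _ _) [dg x i j l + _]addrC (dg_sym l i j Ux).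
Qed.

Lemma christoffel_lower x m i j : U x ->
  (g x *m conn_mx (christoffel g a) i x) m j
  = 2^-1 * (dg x i j m + dg x j i m - dg x m i j).
Proof.
move=> Ux; have -> : conn_mx (christoffel g a) i x = invmx (g x) *m
    \matrix_(l, j) (2^-1 * (dg x i j l + dg x j i l - dg x l i j)).
  apply/matrixP => k l; rewrite !mxE /christoffel mulr_sumr; apply: eq_bigr => p _.
  by rewrite !mxE mulrCA.
by rewrite mulmxA mulmxV ?gV// mul1mx mxE.
Qed.

Lemma christoffel_metric x i : U x ->
  g x *m conn_mx (christoffel g a) i x + (g x *m conn_mx (christoffel g a) i x)^T
  = dmx i g x + (2 * a x 0 i) *: g x.
Proof.
move=> Ux; apply/matrixP => l j; rewrite mxE [X in _ + X]mxE !christoffel_lower//.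
rewrite mxE [X in _ = X + _]mxE [X in _ = _ + X]mxE -/(dg x i l j).
rewrite (dg_sym j i l Ux) (dg_sym l i j Ux) (dg_sym i j l Ux).
by field.
Qed.

(** Koszul's formula: the torsion and the metric conditions determine g T by cyclic
    permutation of the three indices. *)
Lemma christoffel_unique x (T : I -> 'M[R]_n.+1) : U x ->
  (forall i j k, T i k j = T j k i) ->
  (forall i, g x *m T i + (g x *m T i)^T = dmx i g x + (2 * a x 0 i) *: g x) ->
  forall i, conn_mx (christoffel g a) i x = T i.
Proof.
move=> Ux symT metT i; apply: (can_inj (mulKmx (gV Ux))).
apply/matrixP => m j; rewrite christoffel_lower//.
have low p q r : (g x *m T p) q r = (g x *m T r) q p.
  by rewrite !mxE; apply: eq_bigr => k _; rewrite symT.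
have met p q r : dg x p q r = (g x *m T p) q r + (g x *m T p) r q.
  have := congr1 (fun A : 'M[R]_n.+1 => A q r) (metT p).
  by rewrite mxE [X in _ + X]mxE => ->; rewrite !mxE.
rewrite !met (low i j m) (low j i m) (low m i j) (low i m j) (low m j i).
by rewrite (low j m i); field.
Qed.

Lemma smooth_christoffel k i j : smooth U (fun x => christoffel g a x k i j).
Proof.
have Si := smooth_invmx oU Sg gV.
have Sd i' j' l' : smooth U (fun x => dg x i' j' l').
  apply: smoothD => //; first exact: smooth_partial.
  by apply: smoothM => //; apply: smoothM => //; exact: smooth_cst.
apply: smoothM => //; first exact: smooth_cst.
apply: smooth_sum => // l _; apply: smoothM => //.
exact: (smoothB oU (smoothD oU (Sd i j l) (Sd j i l)) (Sd l i j)).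
Qed.

End Metric.

(** ** Passing to a coframe *)

Section Coframe.
Variables (U : set V) (E : V -> 'M[R]_n.+1).
Hypotheses (oU : open U) (SE : smooth_mx U E)
  (EV : forall x, U x -> E x \in unitmx).

(* The covariant derivative of the a-th element of the coframe is minus the sum
   of the W_ab times the b-th one. *)
Definition coframe_connection (Gam : V -> I -> I -> I -> R) (W : I -> V -> 'M[R]_n.+1) :=
  forall x, U x -> forall i,
    E x *m conn_mx Gam i x = dmx i E x + W i x *m E x.

Definition torsion_free (W : I -> V -> 'M[R]_n.+1) :=
  forall x, U x -> forall i j, forall k,
    (dmx i E x + W i x *m E x) k j = (dmx j E x + W j x *m E x) k i.

(** Change of frame is conjugation for the curvature. *)
Lemma curvature_coframe Gam W x i j : coframe_connection Gam W ->
  (forall k i j, smooth U (fun x => Gam x k i j)) -> (forall i, smooth_mx U (W i)) ->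
  U x -> E x *m curv_mx (conn_mx Gam) i j x = curv_mx W i j x *m E x.
Proof.
move=> GW SG SW Ux; pose G := conn_mx Gam.
have SGm i' : forall a b, smooth U (fun y => G i' y a b).
  by move=> a b; under eq_fun do rewrite mxE; exact: SG.
have dE i' j' : dmx i' E x *m G j' x + E x *m dmx i' (G j') x
    = dmx i' (dmx j' E) x + (dmx i' (W j') x *m E x + W j' x *m dmx i' E x).
  rewrite -(dmx_mul i' oU Ux SE (SGm j')) -(dmx_mul i' oU Ux (SW j') SE).
  rewrite -(dmxD i' oU Ux); last 2 first.
  - by move=> a b; exact: smooth_dmx.
  - exact: (smooth_mulmx oU (SW j') SE).
  by apply: (dmx_ext _ oU Ux) => y Uy; exact: GW.
have eE i' : dmx i' E x = E x *m G i' x - W i' x *m E x by rewrite GW// addrK.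
have D1 := dE i j; have D2 := dE j i.
have cE := dmx_comm i j oU Ux SE.
move/(congr1 (fun z => z - dmx i E x *m G j x)): D1; rewrite addrAC subrr add0r => D1.
move/(congr1 (fun z => z - dmx j E x *m G i x)): D2; rewrite addrAC subrr add0r => D2.
rewrite /curv_mx mulmxDr !mulmxBr -/G D1 D2 cE !mulmxDl !mulNmx (eE i) (eE j).
rewrite !mulmxBr !mulmxBl !mulmxA.
move: (dmx j (dmx i E) x) (dmx i (W j) x *m E x) (dmx j (W i) x *m E x)
  (E x *m G i x *m G j x) (E x *m G j x *m G i x)
  (W i x *m E x *m G j x) (W j x *m E x *m G i x)
  (W i x *m W j x *m E x) (W j x *m W i x *m E x) => A B C D F G' H J K.
by apply/matrixP => p q; rewrite !mxE; ring.
Qed.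

Section Orthonormal.
Variables (g : V -> 'M[R]_n.+1) (a : V -> V).
Hypotheses (Sa : smooth_row U a) (gE : forall x, U x -> g x = (E x)^T *m E x).

Let Sg : smooth_mx U g.
Proof.
move=> i j; apply: (smooth_ext oU (f := fun x => ((E x)^T *m E x) i j)).
  by move=> x /gE ->.
apply: (smooth_mulmx oU) => // p q; under eq_fun do rewrite mxE; exact: SE.
Qed.

Let gT x : U x -> (g x)^T = g x.
Proof. by move=> /gE ->; rewrite trmx_mul trmxK. Qed.

Let gV x : U x -> g x \in unitmx.
Proof. by move=> Ux; rewrite gE// unitmx_mul unitmx_tr EV. Qed.

Let dmx_g x i : U x -> dmx i g x = (dmx i E x)^T *m E x + (E x)^T *m dmx i E x.
Proof.
move=> Ux; rewrite (dmx_ext i oU Ux gE) -dmx_tr; apply: (dmx_mul i oU Ux) => // p q.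
by under eq_fun do rewrite mxE; exact: SE.
Qed.

(** An antisymmetric torsion-free connection of an orthonormal coframe is the
    Levi-Civita connection; for Weyl connections the symmetric part is a. *)
Lemma orthonormal_connection W : torsion_free W ->
  (forall x, U x -> forall i, W i x + (W i x)^T = (2 * a x 0 i)%:M) ->
  coframe_connection (christoffel g a) W.
Proof.
move=> tW aW x Ux i.
pose T i := invmx (E x) *m (dmx i E x + W i x *m E x).
rewrite (@christoffel_unique U g a gV x T Ux).
- by rewrite mulmxA mulmxV ?EV// mul1mx.
- by move=> p q k; rewrite !mxE; apply: eq_bigr => l _; rewrite tW.
move=> p; have -> : g x *m T p = (E x)^T *m (dmx p E x + W p x *m E x).
  by rewrite gE// /T -mulmxA [E x *m _]mulmxA mulmxV ?EV// mul1mx.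
rewrite dmx_g// trmx_mul trmxK trmxD trmx_mul mulmxDl mulmxDr.
have -> : (2 * a x 0 p) *: g x = (E x)^T *m (W p x + (W p x)^T) *m E x.
  by rewrite aW// mul_mx_scalar -scalemxAl gE.
rewrite mulmxDr mulmxDl !mulmxA; apply/matrixP => k l; rewrite !mxE; ring.
Qed.

Definition frame_connection i x :=
  (E x *m conn_mx (christoffel g a) i x - dmx i E x) *m invmx (E x).

Lemma frame_connectionP : coframe_connection (christoffel g a) frame_connection.
Proof. by move=> x Ux i; rewrite mulmxKV ?EV// addrC subrK. Qed.

Lemma frame_connection_torsion : torsion_free frame_connection.
Proof.
move=> x Ux i j k; rewrite -!frame_connectionP// !mxE; apply: eq_bigr => l _.
by rewrite !mxE (christoffel_sym a oU gT).
Qed.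

Lemma frame_connection_skew x i : U x ->
  frame_connection i x + (frame_connection i x)^T = (2 * a x 0 i)%:M.
Proof.
move=> Ux; have uE := EV Ux.
have H := christoffel_metric a oU gT gV i Ux.
have W1 : frame_connection i x *m E x = E x *m conn_mx (christoffel g a) i x - dmx i E x.
  by rewrite frame_connectionP// addrC addKr.
have H2 : (E x)^T *m (frame_connection i x + (frame_connection i x)^T) *m E x
    = (E x)^T *m (2 * a x 0 i)%:M *m E x.
  rewrite mul_mx_scalar -scalemxAl -gE// mulmxDr mulmxDl -mulmxA W1.
  rewrite -trmx_mul W1 trmxD linearN/= mulmxBr mulmxBl trmx_mul.
  have -> : (2 * a x 0 i) *: g x = g x *m conn_mx (christoffel g a) i x
      + (g x *m conn_mx (christoffel g a) i x)^T - dmx i g x by rewrite H addrC addKr.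
  rewrite dmx_g// gE// ![((_ *m _) *m _)^T]trmx_mul [(_^T *m _)^T]trmx_mul trmxK !mulmxA.
  move: (_ *m conn_mx _ _ _) (conn_mx _ _ _)^T => A C.
  move: ((E x)^T *m dmx i E x) (C *m _ *m _) ((dmx i E x)^T *m E x) => P Q S.
  by apply/matrixP => k l; rewrite !mxE; ring.
have K (A : 'M[R]_n.+1) : (invmx (E x))^T *m ((E x)^T *m A *m E x) *m invmx (E x) = A.
  by rewrite -!mulmxA mulmxV// mulmx1 mulmxA -trmx_mul mulmxV// trmx1 mul1mx.
by rewrite -[LHS]K H2 K.
Qed.

Lemma smooth_frame_connection i : smooth_mx U (frame_connection i).
Proof.
have SG := smooth_christoffel oU Sg Sa gV.
apply: (smooth_mulmx oU); last exact: smooth_invmx.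
move=> p q; under eq_fun do rewrite !mxE; apply: smoothB => //.
  apply: smooth_sum => // k _; apply: smoothM => //.
  by under eq_fun do rewrite mxE; exact: SG.
exact: smooth_partial.
Qed.

End Orthonormal.
End Coframe.
End Connections.

(** * The Weyl curvature in an orthonormal coframe *)

Section WeylAlgebra.
Variable R : realType.

Definition frame_ricci (O : 'I_4 -> 'I_4 -> 'I_4 -> 'I_4 -> R) : 'M[R]_4 :=
  \matrix_(b, d) \sum_a O a b a d.

(** The Weyl component of the curvature O, contracted with the rows f and f' in
    its first two arguments. *)
Definition frame_weyl (O : 'I_4 -> 'I_4 -> 'I_4 -> 'I_4 -> R) (f f' : 'rV[R]_4) : 'M[R]_4 :=
  \matrix_(c, d) (\sum_a \sum_b f 0 a * f' 0 b * O a b c d)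
  - 2^-1 *: (wedge f (f' *m frame_ricci O) - wedge f' (f *m frame_ricci O))
  + (\tr (frame_ricci O) / 6) *: wedge f f'.

(* The block of the curvature on the half of the 2-forms spanned by
   e_j /\ e_k + e_i /\ e_3, for (i, j, k) cyclic. *)
Definition half_block (O : 'I_4 -> 'I_4 -> 'I_4 -> 'I_4 -> R) (a b c d : 'I_4)
    (a' b' c' d' : 'I_4) : R :=
  O a b a' b' + O a b c' d' + (O c d a' b' + O c d c' d').

(** For an algebraic curvature tensor, the Weyl component vanishes on one half of
    the 2-forms as soon as the 3 by 3 block of the curvature on that half is a
    multiple of the identity plus an antisymmetric matrix: the block off the
    diagonal is the tracefree Ricci tensor, and the trace is the scalar curvature.
    With the convention for the star, this half is the antiselfdual one. *)
Lemma frame_weyl_selfdual O :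
  (forall a b c d, O b a c d = - O a b c d) ->
  (forall a b c d, O a b d c = - O a b c d) ->
  (forall a b c d, O a b c d + O a c d b + O a d b c = 0) ->
  let S0 := half_block O m1 m2 m0 m3 in
  let S1 := half_block O m2 m0 m1 m3 in
  let S2 := half_block O m0 m1 m2 m3 in
  S0 m2 m0 m1 m3 + S1 m1 m2 m0 m3 = 0 ->
  S1 m0 m1 m2 m3 + S2 m2 m0 m1 m3 = 0 ->
  S2 m1 m2 m0 m3 + S0 m0 m1 m2 m3 = 0 ->
  S0 m1 m2 m0 m3 = S1 m2 m0 m1 m3 ->
  S1 m2 m0 m1 m3 = S2 m0 m1 m2 m3 ->
  forall f f', hodge4 (frame_weyl O f f') = frame_weyl O f f'.
Proof.
move=> aab acd bia S0 S1 S2; rewrite /S0 /S1 /S2 /half_block => {S0 S1 S2}.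
have D1 a c d : O a a c d = 0.
  by have /eqP := aab a a c d; rewrite -subr_eq0 opprK -mulr2n mulrn_eq0/= => /eqP.
have D2 a b c : O a b c c = 0.
  by have /eqP := acd a b c c; rewrite -subr_eq0 opprK -mulr2n mulrn_eq0/= => /eqP.
have pair a b c d : O a b c d = O c d a b.
  have := bia a b c d; have := bia b c d a; have := bia c d a b; have := bia d a b c.
  rewrite !(aab a b) !(aab a c) !(aab a d) !(aab b c) !(aab b d) !(aab c d).
  rewrite ?(acd _ _ a b) ?(acd _ _ a c) ?(acd _ _ a d) ?(acd _ _ b c) ?(acd _ _ b d) ?(acd _ _ c d).
  by lra.
have B := bia m0 m1 m2 m3.
pose n := (aab m0 m1, aab m0 m2, aab m0 m3, aab m1 m2, aab m1 m3, aab m2 m3,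
  (fun a b => acd a b m0 m1, fun a b => acd a b m0 m2, fun a b => acd a b m0 m3,
   fun a b => acd a b m1 m2, fun a b => acd a b m1 m3, fun a b => acd a b m2 m3)).
pose q := (pair m0 m2 m0 m1, pair m0 m3 m0 m1, pair m1 m2 m0 m1, pair m1 m3 m0 m1,
  pair m2 m3 m0 m1, (pair m0 m3 m0 m2, pair m1 m2 m0 m2, pair m1 m3 m0 m2, pair m2 m3 m0 m2),
  (pair m1 m2 m0 m3, pair m1 m3 m0 m3, pair m2 m3 m0 m3), (pair m1 m3 m1 m2, pair m2 m3 m1 m2),
  pair m2 m3 m1 m3).
rewrite !n !q in B *.
move=> E1 E2 E3 E4 E5.
have e1 : O m0 m3 m1 m3 = - (- O m0 m2 m1 m2 + O m1 m2 m1 m3 - O m0 m2 m0 m3) by lra.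
have e2 : O m1 m3 m2 m3 = - (- O m0 m1 m0 m2 - O m0 m2 m2 m3 + O m0 m1 m1 m3) by lra.
have e3 : O m0 m3 m2 m3 = - (O m0 m1 m1 m2 + O m1 m2 m2 m3 + O m0 m1 m0 m3) by lra.
have e4 : O m0 m3 m0 m3 = O m0 m2 m0 m2 - 2 * O m0 m2 m1 m3 + O m1 m3 m1 m3
   - O m1 m2 m1 m2 - 2 * O m0 m3 m1 m2 by lra.
have e5 : O m2 m3 m2 m3 = O m0 m2 m0 m2 - 2 * O m0 m2 m1 m3 + O m1 m3 m1 m3
   - O m0 m1 m0 m1 - 2 * O m0 m1 m2 m3 by lra.
have e6 : O m0 m3 m1 m2 = O m0 m2 m1 m3 - O m0 m1 m2 m3 by lra.
move=> f f'; apply: hodge4_fix.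
- apply/matrixP => i j; rewrite !mxE; rewrite (eq_bigr (fun a => - \sum_b f 0 a * f' 0 b * O a b i j)).
    by rewrite sumrN; ring.
  by move=> a _; rewrite -sumrN; apply: eq_bigr => b _; rewrite acd mulrN.
- rewrite !mxE !sum4 !mxE !sum4 /mxtrace !sum4 !mxE !sum4 !D1 !D2 !n !q !(e1, e2, e3, e4, e5) !e6.
  by field.
- rewrite !mxE !sum4 !mxE !sum4 /mxtrace !sum4 !mxE !sum4 !D1 !D2 !n !q !(e1, e2, e3, e4, e5) !e6.
  by field.
- rewrite !mxE !sum4 !mxE !sum4 /mxtrace !sum4 !mxE !sum4 !D1 !D2 !n !q !(e1, e2, e3, e4, e5) !e6.
  by field.
Qed.

End WeylAlgebra.

Section FrameCurvature.
Variables (R : realType) (n : nat) (F : 'M[R]_n.+1).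
Local Notation I := 'I_n.+1.
Variables (C Rm : I -> I -> 'M[R]_n.+1).

(* Components in the coframe F of the matrix of 2-forms C. *)
Definition frame_components (a b : I) : 'M[R]_n.+1 :=
  (invmx F)^T *m (\matrix_(k, l) C k l a b) *m invmx F.

Hypotheses (uF : F \in unitmx) (FR : forall k l, F *m Rm k l = C k l *m F).

Lemma frame_componentsK k l a b :
  C k l a b = (F^T *m frame_components a b *m F) k l.
Proof.
rewrite /frame_components -!mulmxA mulVmx// mulmx1 mulmxA -trmx_mul.
by rewrite mulVmx// trmx1 mul1mx [RHS]mxE.
Qed.

Lemma ricci_components :
  \matrix_(l, j) \sum_k Rm k j k l
  = F^T *m (\matrix_(b, d) \sum_a frame_components a b a d) *m F.
Proof.
pose P := invmx F; pose O a b c d := frame_components a b c d.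
have PF c a : \sum_k P k a * F c k = (c == a)%:R.
  have := congr1 (fun A : 'M[R]_n.+1 => A c a) (mulmxV uF); rewrite !mxE => <-.
  by apply: eq_bigr => k _; rewrite mulrC.
have Rm_frame k l : Rm k l = P *m C k l *m F.
  by rewrite -mulmxA -FR mulmxA mulVmx// mul1mx.
apply/matrixP => l j; rewrite mxE.
transitivity (\sum_k \sum_b \sum_a \sum_d \sum_c
   (P k a * F c k) * (F b l * O a b c d * F d j)).
  apply: eq_bigr => k _.
  rewrite Rm_frame mxE; apply: eq_bigr => b _; rewrite mxE mulr_suml.
  apply: eq_bigr => a _; rewrite frame_componentsK mxE mulr_sumr mulr_suml.
  apply: eq_bigr => d _; rewrite mxE !mulr_suml !mulr_sumr mulr_suml.
  by apply: eq_bigr => c _; rewrite [_^T _ _]mxE /O; ring.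
rewrite exchange_big/= mxE.
under eq_bigr do rewrite exchange_big/=.
under eq_bigr do under eq_bigr do rewrite exchange_big/=.
under eq_bigr do under eq_bigr do under eq_bigr do rewrite exchange_big/=.
under eq_bigr do under eq_bigr do under eq_bigr do under eq_bigr do rewrite -mulr_suml PF.
transitivity (\sum_b \sum_d \sum_a F b l * O a b a d * F d j).
  apply: eq_bigr => b _; rewrite exchange_big/=; apply: eq_bigr => d _.
  apply: eq_bigr => a _; rewrite (bigD1 a)//= eqxx mul1r big1 ?addr0// => c /negbTE nc.
  by rewrite nc mul0r.
rewrite exchange_big/=; apply: eq_bigr => d _; rewrite mxE mulr_suml.
apply: eq_bigr => b _; rewrite !mxE mulr_sumr mulr_suml.
by apply: eq_bigr => a _.
Qed.

End FrameCurvature.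

Section WeylCurvature.
Variable R : realType.
Local Notation M4 := 'rV[R]_4.

Lemma curvature_bianchi n U (Gam : 'rV[R]_n.+1 -> 'I_n.+1 -> 'I_n.+1 -> 'I_n.+1 -> R)
    x k l i j : open U -> U x ->
  (forall y k i j, U y -> Gam y k i j = Gam y k j i) ->
  curvature Gam x k l i j + curvature Gam x k i j l + curvature Gam x k j l i = 0.
Proof.
move=> oU Ux sG; rewrite /curvature !sumrB.
have P a b c : partial a (fun y => Gam y k b c) x = partial a (fun y => Gam y k c b) x.
  by apply: (partial_ext _ oU Ux) => y Uy; exact: sG.
have Q a b c : \sum_m Gam x k a m * Gam x m b c = \sum_m Gam x k a m * Gam x m c b.
  by apply: eq_bigr => m _; rewrite (sG x m b c Ux).
rewrite (P i j l) (P j i l) (P l j i) (Q i j l) (Q j i l) (Q l j i).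
by ring.
Qed.

Variables (U : set M4) (g F : M4 -> 'M[R]_4) (W : 'I_4 -> M4 -> 'M[R]_4).

Definition frame_curvature x (a b : 'I_4) : 'M[R]_4 :=
  frame_components (F x) (fun k l => curv_mx W k l x) a b.

Hypotheses (oU : open U) (SF : smooth_mx U F) (dF : forall x, U x -> 0 < \det (F x))
  (SW : forall i, smooth_mx U (W i)) (tW : torsion_free U F W)
  (aW : forall x, U x -> forall i, (W i x)^T = - W i x)
  (gE : forall x, U x -> g x = (F x)^T *m F x).

Let uF x : U x -> F x \in unitmx.
Proof. by move=> Ux; rewrite unitmxE unitfE gt_eqF// dF. Qed.

Let Gam := christoffel g (fun=> 0).

Let S0 : smooth_row U (fun=> 0 : M4).
Proof. by move=> i; under eq_fun do rewrite mxE; exact: smooth_cst. Qed.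

Let Sg : smooth_mx U g.
Proof.
move=> i j; apply: (smooth_ext oU (f := fun x => ((F x)^T *m F x) i j)).
  by move=> x /gE ->.
by apply: (smooth_mulmx oU) => // p q; under eq_fun do rewrite mxE; exact: SF.
Qed.

Let gT x : U x -> (g x)^T = g x. Proof. by move=> /gE ->; rewrite trmx_mul trmxK. Qed.

Let gV x : U x -> g x \in unitmx.
Proof. by move=> Ux; rewrite gE// unitmx_mul unitmx_tr uF. Qed.

Let GW : coframe_connection U F Gam W.
Proof.
apply: (orthonormal_connection oU SF uF) => // x Ux i.
by rewrite aW// subrr mxE mulr0; apply/matrixP => a b; rewrite !mxE mul0rn.
Qed.

Let Rm x k l : 'M[R]_4 := \matrix_(m, j) curvature Gam x m j k l.

Let FR x k l : U x -> F x *m Rm x k l = curv_mx W k l x *m F x.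
Proof.
move=> Ux; rewrite /Rm curvature_mx; apply: (curvature_coframe oU SF k l GW) => //.
exact: (smooth_christoffel oU Sg S0 gV).
Qed.

Let curv_skew x k l : U x -> (curv_mx W k l x)^T = - curv_mx W k l x.
Proof.
move=> Ux; have dW a b : (dmx a (W b) x)^T = - dmx a (W b) x.
  rewrite -dmx_tr (dmx_ext a oU Ux (C := fun y => - W b y)); last by move=> y /aW.
  apply/matrixP => i j; rewrite !mxE -[RHS]partialN.
    by congr (partial _ _ _); apply/funext => y; rewrite mxE.
  exact: smooth_derivable (SW _ _ _) Ux.
rewrite /curv_mx !trmxD !dW !linearN/= !dW !trmx_mul !aW// !mulmxN !mulNmx !opprK.
move: (dmx k (W l) x) (dmx l (W k) x) (W l x *m W k x) (W k x *m W l x) => A B C D.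
by apply/matrixP => i j; rewrite !mxE; ring.
Qed.

Let curv_anti x k l : curv_mx W l k x = - curv_mx W k l x.
Proof.
rewrite /curv_mx; move: (dmx k (W l) x) (dmx l (W k) x) (_ *m _) (_ *m _) => A B C D.
by apply/matrixP => i j; rewrite !mxE; ring.
Qed.

Lemma frame_curvatureE x a b c d : frame_curvature x a b c d =
  \sum_l \sum_k invmx (F x) k c * curv_mx W k l x a b * invmx (F x) l d.
Proof.
rewrite mxE; apply: eq_bigr => l _; rewrite mxE mulr_suml; apply: eq_bigr => k _.
by rewrite !mxE.
Qed.

Lemma frame_curvature_skew12 x a b c d : U x ->
  frame_curvature x b a c d = - frame_curvature x a b c d.
Proof.
move=> Ux; rewrite !frame_curvatureE -sumrN; apply: eq_bigr => l _.
rewrite -sumrN; apply: eq_bigr => k _.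
have := congr1 (fun A : 'M[R]_4 => A a b) (curv_skew k l Ux); rewrite !mxE => ->.
by rewrite mulrN mulNr.
Qed.

Lemma frame_curvature_skew34 x a b c d :
  frame_curvature x a b d c = - frame_curvature x a b c d.
Proof.
rewrite !frame_curvatureE exchange_big/= -sumrN; apply: eq_bigr => l _.
rewrite -sumrN; apply: eq_bigr => k _; rewrite (curv_anti x k l) mxE; ring.
Qed.

Lemma frame_curvature_bianchi x a b c d : U x ->
  frame_curvature x a b c d + frame_curvature x a c d b + frame_curvature x a d b c = 0.
Proof.
move=> Ux; pose P := invmx (F x).
pose T (l i j : 'I_4) := (F x *m Rm x i j) a l.
have cyc l i j : T l i j + T i j l + T j l i = 0.
  rewrite /T !mxE -!big_split/= big1// => k _; rewrite !mxE -!mulrDr.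
  rewrite (curvature_bianchi k l i j oU Ux) ?mulr0// => y k' i' j' Uy.
  exact: (christoffel_sym (fun=> 0) oU gT).
have E b' c' d' : frame_curvature x a b' c' d'
    = \sum_j \sum_i \sum_l P i c' * P j d' * P l b' * T l i j.
  rewrite frame_curvatureE; apply: eq_bigr => j _; apply: eq_bigr => i _.
  have -> : curv_mx W i j x a b' = \sum_l T l i j * P l b'.
    by rewrite /T FR//; have := congr1 (fun A : 'M[R]_4 => A a b') (mulmxK (uF Ux) (curv_mx W i j x)); rewrite mxE => ->.
  rewrite mulr_sumr mulr_suml; apply: eq_bigr => l _; rewrite -/P; ring.
rewrite !E.
have -> : \sum_j \sum_i \sum_l P i d * P j b * P l c * T l i j
    = \sum_j \sum_i \sum_l P i c * P j d * P l b * T i j l.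
  under [RHS]eq_bigr do rewrite exchange_big/=.
  rewrite [RHS]exchange_big/=; apply: eq_bigr => l _.
  by apply: eq_bigr => j _; apply: eq_bigr => i _; ring.
have -> : \sum_j \sum_i \sum_l P i b * P j c * P l d * T l i j
    = \sum_j \sum_i \sum_l P i c * P j d * P l b * T j l i.
  rewrite [RHS]exchange_big/=; apply: eq_bigr => i _.
  rewrite exchange_big/=; apply: eq_bigr => j _.
  by apply: eq_bigr => l _; ring.
rewrite -!big_split/= big1// => j _; rewrite -!big_split/= big1// => i _.
by rewrite -!big_split/= big1// => l _; rewrite -!mulrDr cyc mulr0.
Qed.

Let O x a b c d := frame_curvature x a b c d.

Let curvK x k l a b : U x -> curv_mx W k l x a b
  = ((F x)^T *m frame_curvature x a b *m F x) k l.
Proof.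
by move=> Ux; rewrite (@frame_componentsK _ _ (F x) (fun k l => curv_mx W k l x) (uF Ux)).
Qed.

Let ricci_frame x : U x -> ricci Gam x = (F x)^T *m frame_ricci (O x) *m F x.
Proof.
move=> Ux; rewrite /frame_ricci /O.
rewrite -(@ricci_components _ _ (F x) (fun k l => curv_mx W k l x) (Rm x) (uF Ux)).
  by apply/matrixP => l j; rewrite !mxE; apply: eq_bigr => k _; rewrite mxE.
by move=> k l; exact: FR.
Qed.

(** The Weyl tensor with two indices fixed is the matrix of its components in the
    coframe, transformed back. *)
Lemma weyl_frame x i j : U x -> \matrix_(k, l) weyl_tensor g x i j k l
  = (F x)^T *m frame_weyl (O x) (row i (F x)^T) (row j (F x)^T) *m F x.
Proof.
move=> Ux; pose f i := row i (F x)^T.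
have gxE k l : g x k l = (f k *m F x) 0 l by rewrite /f -row_mul [RHS]mxE gE.
have rE k l : ricci Gam x k l = (f k *m frame_ricci (O x) *m F x) 0 l.
  by rewrite ricci_frame// /f -!row_mul [RHS]mxE.
have sE : \tr (invmx (g x) *m ricci Gam x) = \tr (frame_ricci (O x)).
  rewrite ricci_frame// mxtrace_mulC.
  have -> : (F x)^T *m frame_ricci (O x) *m F x *m invmx (g x)
     = (F x)^T *m (frame_ricci (O x) *m (F x *m invmx (g x))).
    by rewrite !mulmxA.
  rewrite mxtrace_mulC -!mulmxA.
  have uFT : (F x)^T \in unitmx by rewrite unitmx_tr uF.
  have -> : F x *m (invmx (g x) *m (F x)^T) = 1%:M; last by rewrite mulmx1.
  rewrite -[LHS]mul1mx -(mulVmx uFT) -!mulmxA.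
  by rewrite [(F x)^T *m (F x *m _)]mulmxA [(_ *m F x) *m _]mulmxA -gE// mulmxV ?gV// mul1mx mulVmx.
have lowE k l : \sum_m g x i m * curvature Gam x m j k l =
    ((F x)^T *m (\matrix_(c, d) (\sum_a \sum_b f i 0 a * f j 0 b * O x a b c d)) *m F x) k l.
  transitivity ((g x *m Rm x k l) i j).
    by rewrite [RHS]mxE; apply: eq_bigr => m _; rewrite [Rm x k l m j]mxE.
  rewrite gE// -mulmxA FR// mulmxA mxE.
  transitivity (\sum_b \sum_a \sum_d \sum_c (F x c k * (f i 0 a * f j 0 b * O x a b c d)) * F x d l).
    apply: eq_bigr => b _; rewrite mxE mulr_suml; apply: eq_bigr => a _.
    rewrite curvK// [((F x)^T *m _ *m _) k l]mxE mulr_sumr mulr_suml; apply: eq_bigr => d _.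
    rewrite [((F x)^T *m _) k d]mxE mulr_suml mulr_sumr mulr_suml; apply: eq_bigr => c _.
    by rewrite /f /O !mxE; ring.
  rewrite exchange_big/=.
  under eq_bigr do rewrite exchange_big/=.
  rewrite exchange_big/= [RHS]mxE; apply: eq_bigr => d _.
  under eq_bigr do rewrite exchange_big/=.
  rewrite exchange_big/= mxE mulr_suml; apply: eq_bigr => c _.
  rewrite !mxE mulr_sumr mulr_suml; apply: eq_bigr => a _.
  by rewrite mulr_sumr mulr_suml; apply: eq_bigr => b _.
apply/matrixP => k l; rewrite mxE /weyl_tensor -/Gam lowE sE !gxE !rE /frame_weyl.
rewrite mulmxDr mulmxDl mulmxBr mulmxBl -!scalemxAr -!scalemxAl mulmxBr mulmxBl.
rewrite -!wedge_mul -/(f i) -/(f j).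
move: (_ *m _ *m F x) (f i *m F x) (f j *m F x) (f i *m _ *m _) (f j *m _ *m _) => A u v p q.
rewrite !mxE; ring.
Qed.

(** The star commutes with the passage to components in the oriented orthonormal
    coframe, so that selfduality can be checked there. *)
Theorem selfdual_coframe :
  (forall x, U x -> forall f f', hodge4 (frame_weyl (O x) f f') = frame_weyl (O x) f f') ->
  selfdual U g.
Proof.
move=> hO x Ux i j; rewrite weyl_frame// /antiselfdual_part gE// star2_frame ?dF//.
by rewrite hO// subrr scaler0.
Qed.

End WeylCurvature.

(** * Exterior derivative *)

Section Forms.
Variables (R : realType) (n : nat).
Local Notation V := 'rV[R]_n.+1.
Implicit Types (U : set V) (p q : V -> V) (f : V -> R).

Lemma dform_ext U p q x : open U -> U x -> (forall y, U y -> p y = q y) ->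
  dform p x = dform q x.
Proof.
move=> oU Ux pq; apply/matrixP => i j; rewrite !mxE.
by congr (_ - _); apply: (partial_ext _ oU Ux) => y /pq ->.
Qed.

Section Rules.
Variables (U : set V) (x : V).
Hypotheses (oU : open U) (Ux : U x).

Lemma dformD p q : smooth_row U p -> smooth_row U q ->
  dform (fun y => p y + q y) x = dform p x + dform q x.
Proof.
move=> Sp Sq.
have E i k : partial i (fun y => (p y + q y) 0 k) x
    = partial i (fun y => p y 0 k) x + partial i (fun y => q y 0 k) x.
  rewrite -partialD; first by congr (partial i _ x); apply/funext => y; rewrite mxE.
    exact: smooth_derivable (Sp k) Ux.
  exact: smooth_derivable (Sq k) Ux.
apply/matrixP => i j; rewrite mxE [RHS]mxE [X in _ = X + _]mxE [X in _ = _ + X]mxE !E.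
move: (partial i (fun y => p y 0 j) x) (partial i (fun y => q y 0 j) x)
  (partial j (fun y => p y 0 i) x) (partial j (fun y => q y 0 i) x) => A C D G.
by ring.
Qed.

Lemma dformN p : smooth_row U p -> dform (fun y => - p y) x = - dform p x.
Proof.
move=> Sp.
have E i k : partial i (fun y => (- p y) 0 k) x = - partial i (fun y => p y 0 k) x.
  rewrite -partialN; first by congr (partial i _ x); apply/funext => y; rewrite mxE.
  exact: smooth_derivable (Sp k) Ux.
by apply/matrixP => i j; rewrite mxE [RHS]mxE mxE !E opprB opprK addrC.
Qed.

Lemma dformZ f p : smooth U f -> smooth_row U p ->
  dform (fun y => f y *: p y) x = wedge (dfun f x) (p x) + f x *: dform p x.
Proof.
move=> Sf Sp.
have E i k : partial i (fun y => (f y *: p y) 0 k) x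
    = f x * partial i (fun y => p y 0 k) x + p x 0 k * partial i f x.
  rewrite -partialM; first by congr (partial i _ x); apply/funext => y; rewrite mxE.
    exact: smooth_derivable Sf Ux.
  exact: smooth_derivable (Sp k) Ux.
apply/matrixP => i j.
rewrite mxE [RHS]mxE [X in _ = X + _]mxE [X in _ = _ + X]mxE [dform _ _ _ _]mxE !E.
rewrite [dfun _ _ _ i]mxE [dfun _ _ _ j]mxE.
move: (partial i (fun y => p y 0 j) x) (partial j (fun y => p y 0 i) x)
  (partial i f x) (partial j f x) => A C D G.
by ring.
Qed.

End Rules.

Lemma smooth_rowD m U (p q : V -> 'rV[R]_m) : open U -> smooth_row U p ->
  smooth_row U q -> smooth_row U (fun y => p y + q y).
Proof. by move=> oU Sp Sq i; under eq_fun do rewrite mxE; exact: smoothD. Qed.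

Lemma smooth_rowN m U (p : V -> 'rV[R]_m) : open U -> smooth_row U p ->
  smooth_row U (fun y => - p y).
Proof. by move=> oU Sp i; under eq_fun do rewrite mxE; exact: smoothN. Qed.

Lemma smooth_rowZ m U f (p : V -> 'rV[R]_m) : open U -> smooth U f ->
  smooth_row U p -> smooth_row U (fun y => f y *: p y).
Proof. by move=> oU Sf Sp i; under eq_fun do rewrite mxE; exact: smoothM. Qed.

Lemma smooth_dfun U f : smooth U f -> smooth_row U (dfun f).
Proof. by move=> Sf i; under eq_fun do rewrite mxE; exact: smooth_partial. Qed.

Lemma dform_tr p x : (dform p x)^T = - dform p x.
Proof. by apply/matrixP => i j; rewrite mxE [RHS]mxE !mxE opprB. Qed.

Definition entry_form (W : 'I_n.+1 -> V -> 'M[R]_n.+1) a b x : V :=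
  \row_i W i x a b.

(** Cartan's second structure equation. *)
Lemma curv_mx_form W a b x : \matrix_(k, l) curv_mx W k l x a b
  = dform (entry_form W a b) x
    + \sum_c wedge (entry_form W a c x) (entry_form W c b x).
Proof.
apply/matrixP => k l; rewrite mxE [RHS]mxE summxE /curv_mx mxE.
congr (_ + _).
  rewrite mxE [X in _ + X]mxE [RHS]mxE [X in _ - X]mxE; congr (_ - _).
  - by rewrite mxE; congr (partial k _ x); apply/funext => y; rewrite mxE.
  - by congr (partial l _ x); apply/funext => y; rewrite mxE.
rewrite mxE [X in X + _]mxE [X in _ + X]mxE mxE -sumrB.
by apply: eq_bigr => c _; rewrite !mxE.
Qed.

(** Cartan's first structure equation. *)
Lemma torsion_free_form U (E : V -> 'M[R]_n.+1) W :
  (forall x, U x -> forall k, dform (fun y => row k (E y)) x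
     + \sum_b wedge (entry_form W k b x) (row b (E x)) = 0) <->
  torsion_free U E W.
Proof.
have F x k i j : (dform (fun y => row k (E y)) x
     + \sum_b wedge (entry_form W k b x) (row b (E x))) i j
   = (dmx i E x + W i x *m E x) k j - (dmx j E x + W j x *m E x) k i.
  rewrite mxE summxE [X in X + _]mxE.
  have P a b : partial a (fun y => (row k (E y)) 0 b) x = dmx a E x k b.
    by rewrite mxE; congr (partial a _ x); apply/funext => y; rewrite mxE.
  rewrite !P [in RHS]mxE [X in _ = _ - X]mxE.
  rewrite [(W i x *m _) _ _]mxE [(W j x *m _) _ _]mxE.
  under eq_bigr do rewrite !mxE; rewrite sumrB.
  move: (\sum_c _) (\sum_c _) (dmx i E x k j) (dmx j E x k i) => S T A C.
  by ring.
split=> [H x Ux i j k|H x Ux k].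
  apply/eqP; rewrite -subr_eq0 -F H//; apply/eqP; exact: mxE.
by apply/matrixP => i j; rewrite F (H x Ux i j k) subrr mxE.
Qed.

End Forms.

Section PulledBackForms.
Variable R : realType.
Local Notation B3 := 'rV[R]_3.
Local Notation M4 := 'rV[R]_4.

Lemma smooth_pull1 (B : set B3) (p : B3 -> B3) : open B -> smooth_row B p ->
  smooth_row [set x | B (pr x)] (pull1 p).
Proof.
move=> oB Sp i; case: (unliftP ord_max i) => [j ->|->].
  rewrite (_ : (fun x => _) = fun x => p (pr x) 0 j); first exact: (smooth_pr oB (Sp j)).
  by apply/funext => x; rewrite /pull1 lift_dpr.
rewrite (_ : (fun x => _) = fun=> 0); first exact: smooth_cst.
by apply/funext => x; rewrite /pull1 max_dpr.
Qed.

Lemma partial_pull1_lift (p : B3 -> B3) i j (x : M4) :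
  partial (lift ord_max i) (fun y => pull1 p y 0 (lift ord_max j)) x
  = partial i (fun b => p b 0 j) (pr x).
Proof.
rewrite -partial_pr_lift; congr (partial _ _ x).
by apply/funext => y; rewrite /pull1 lift_dpr.
Qed.

Lemma partial_pull1_max (p : B3 -> B3) i (x : M4) :
  partial ord_max (fun y => pull1 p y 0 i) x = 0.
Proof.
case: (unliftP ord_max i) => [j ->|->].
  rewrite -[RHS](partial_pr_max (fun b => p b 0 j) x); congr (partial _ _ x).
  by apply/funext => y; rewrite /pull1 lift_dpr.
rewrite -[RHS](partial_cst (0 : R) ord_max x); congr (partial _ _ x).
by apply/funext => y; rewrite /pull1 max_dpr.
Qed.

Lemma partial_pull1_0 (p : B3 -> B3) i (x : M4) :
  partial i (fun y => pull1 p y 0 ord_max) x = 0.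
Proof.
rewrite -[RHS](partial_cst (0 : R) i x); congr (partial _ _ x).
by apply/funext => y; rewrite /pull1 max_dpr.
Qed.

Lemma dform_pull1 (p : B3 -> B3) x :
  dform (pull1 p) x = dpr R *m dform p (pr x) *m (dpr R)^T.
Proof.
apply/matrixP => i j; rewrite pullE mxE.
case: unliftP => [i' ->|->].
  case: unliftP => [j' ->|->]; first by rewrite !partial_pull1_lift mxE.
  by rewrite partial_pull1_0 partial_pull1_max subrr.
by rewrite partial_pull1_0 partial_pull1_max subrr.
Qed.

Lemma wedge_pull (p q : B3) :
  wedge (p *m (dpr R)^T) (q *m (dpr R)^T) = dpr R *m wedge p q *m (dpr R)^T.
Proof. by rewrite wedge_mul trmxK. Qed.

End PulledBackForms.

Section EinsteinWeyl.
Variable R : realType.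
Local Notation B3 := 'rV[R]_3.
Variables (B : set B3) (h E : B3 -> 'M[R]_3) (a : B3 -> B3).
Hypotheses (oB : open B) (SE : smooth_mx B E) (Sa : smooth_row B a)
  (hE : forall b, B b -> h b = (E b)^T *m E b) (dE : forall b, B b -> 0 < \det (E b)).

(** ** The connection forms of the Weyl derivative on the base *)

(* For (i, j, k) cyclic, the form giving the covariant derivative of the j-th
   element of the coframe along the k-th one. *)
Definition base_form (i : 'I_3) : B3 -> B3 :=
  let W := frame_connection E h a in
  if i == b0 then entry_form W b1 b2 else if i == b1 then entry_form W b2 b0
  else entry_form W b0 b1.

Definition base_curvature (i : 'I_3) (b : B3) : 'M[R]_3 :=
  dform (base_form i) b -
    (if i == b0 then wedge (base_form b1 b) (base_form b2 b)
     else if i == b1 then wedge (base_form b2 b) (base_form b0 b)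
     else wedge (base_form b0 b) (base_form b1 b)).

Let W := frame_connection E h a.

Let uE b : B b -> E b \in unitmx.
Proof. by move=> Bb; rewrite unitmxE unitfE gt_eqF// dE. Qed.

Let SW i : smooth_mx B (W i).
Proof. exact: (smooth_frame_connection oB SE uE Sa hE). Qed.

Let Sf i j : smooth_row B (entry_form W i j).
Proof. by move=> k; under eq_fun do rewrite mxE; exact: SW. Qed.

Lemma smooth_base_form i : smooth_row B (base_form i).
Proof. by rewrite /base_form; case: ifP => _; [|case: ifP => _]; exact: Sf. Qed.

Lemma base_form_skew b : B b ->
  [/\ [/\ entry_form W b2 b1 b = - base_form b0 b,
          entry_form W b0 b2 b = - base_form b1 b &
          entry_form W b1 b0 b = - base_form b2 b] &
      [/\ entry_form W b0 b0 b = a b, entry_form W b1 b1 b = a b &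
          entry_form W b2 b2 b = a b]].
Proof.
move=> Bb.
have sk i p q : W i b p q + W i b q p = if p == q then 2 * a b 0 i else 0.
  have := congr1 (fun A : 'M[R]_3 => A p q) (frame_connection_skew oB SE uE a hE i Bb).
  by rewrite mxE [X in _ + X]mxE => ->; rewrite mxE; case: (p == q).
have eE p q i : entry_form W p q b 0 i = W i b p q by exact: mxE.
have off p q : p != q -> entry_form W p q b = - entry_form W q p b.
  move=> /negbTE pq; apply/rowP => i; rewrite [RHS]mxE !eE; apply/eqP.
  by rewrite -addr_eq0 sk pq.
have dia p : entry_form W p p b = a b.
  apply/rowP => i; rewrite eE; have := sk i p p; rewrite eqxx.
  by rewrite -mulr2n -[_ *+ 2]mulr_natl => /mulfI; apply; rewrite pnatr_eq0.
by split; split; [exact: off | exact: off | exact: off | exact: dia | exact: dia | exact: dia].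
Qed.

(** The first structure equation of the base; the symmetric part of the connection
    of a Weyl derivative is its 1-form a on the diagonal. *)
Lemma base_torsion b : B b ->
  let e i := row i (E b) in
  [/\ dform (fun y => row b0 (E y)) b = wedge (base_form b1 b) (e b2)
        - wedge (base_form b2 b) (e b1) - wedge (a b) (e b0),
      dform (fun y => row b1 (E y)) b = wedge (base_form b2 b) (e b0)
        - wedge (base_form b0 b) (e b2) - wedge (a b) (e b1) &
      dform (fun y => row b2 (E y)) b = wedge (base_form b0 b) (e b1)
        - wedge (base_form b1 b) (e b0) - wedge (a b) (e b2)].
Proof.
move=> Bb e; have tW : torsion_free B E W := frame_connection_torsion oB uE a hE.
have T k := (torsion_free_form B E W).2 tW b Bb k.
have [[S0 S1 S2] [D0 D1 D2]] := base_form_skew Bb.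
have wN (p q : B3) : wedge (- p) q = - wedge p q.
  by apply/matrixP => i j; rewrite !mxE; ring.
have P k : dform (fun y => row k (E y)) b = - \sum_c wedge (entry_form W k c b) (e c).
  by apply/eqP; rewrite -addr_eq0; apply/eqP; exact: T.
have f0 : entry_form W b1 b2 = base_form b0 by [].
have f1 : entry_form W b2 b0 = base_form b1 by [].
have f2 : entry_form W b0 b1 = base_form b2 by [].
rewrite !P !sum3 S0 S1 S2 D0 D1 D2 f0 f1 f2 !wN.
move: (base_form b0 b) (base_form b1 b) (base_form b2 b) (e b0) (e b1) (e b2) (a b).
move=> p0 p1 p2 e0 e1 e2 p.
by split; apply/matrixP => i j; rewrite !mxE; ring.
Qed.

Lemma base_curv b : B b ->
  let C p q := \matrix_(k, l) curv_mx W k l b p q in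
  [/\ [/\ C b1 b2 = base_curvature b0 b, C b2 b0 = base_curvature b1 b &
          C b0 b1 = base_curvature b2 b],
      [/\ C b2 b1 = - base_curvature b0 b, C b0 b2 = - base_curvature b1 b &
          C b1 b0 = - base_curvature b2 b] &
      [/\ C b0 b0 = dform a b, C b1 b1 = dform a b & C b2 b2 = dform a b]].
Proof.
move=> Bb C.
have [[S0 S1 S2] [D0 D1 D2]] := base_form_skew Bb.
have f0 : entry_form W b1 b2 = base_form b0 by [].
have f1 : entry_form W b2 b0 = base_form b1 by [].
have f2 : entry_form W b0 b1 = base_form b2 by [].
have dN p q i : (forall y, B y -> entry_form W p q y = - base_form i y) ->
    dform (entry_form W p q) b = - dform (base_form i) b.
  by move=> H; rewrite (dform_ext oB Bb H) (dformN (U := B))//; exact: smooth_base_form.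
have dA p : (forall y, B y -> entry_form W p p y = a y) ->
    dform (entry_form W p p) b = dform a b.
  by move=> H; exact: dform_ext oB Bb H.
rewrite /C !curv_mx_form !sum3 (dN b2 b1 b0) ?(dN b0 b2 b1) ?(dN b1 b0 b2) ?dA;
  try by move=> y By; have [[? ? ?] [? ? ?]] := base_form_skew By.
rewrite S0 S1 S2 D0 D1 D2 f0 f1 f2 /base_curvature /=.
move: (dform (base_form b0) b) (dform (base_form b1) b) (dform (base_form b2) b)
  (dform a b) (base_form b0 b) (base_form b1 b) (base_form b2 b) (a b).
move=> A0 A1 A2 A p0 p1 p2 p.
by do !split; apply/matrixP => i j; rewrite !mxE; ring.
Qed.

Definition base_block (i : 'I_3) (b : B3) : 'M[R]_3 :=
  (invmx (E b))^T *m base_curvature i b *m invmx (E b).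

Lemma base_block_skew i b : (base_block i b)^T = - base_block i b.
Proof.
have S : (base_curvature i b)^T = - base_curvature i b.
  rewrite /base_curvature linearB/= dform_tr; case: ifP => _; [|case: ifP => _];
  by rewrite wedge_tr opprB opprK addrC.
by rewrite /base_block !trmx_mul trmxK S mulNmx mulmxN mulmxA.
Qed.

(** In an orthonormal coframe of a 3-manifold, the Einstein-Weyl equation says that
    the curvature, as a map from 2-forms to antisymmetric endomorphisms, is a
    multiple of the identity plus an antisymmetric map. *)
Lemma einstein_weyl_block b : B b -> einstein_weyl B h a ->
  [/\ base_block b0 b b2 b0 + base_block b1 b b1 b2 = 0,
      base_block b1 b b0 b1 + base_block b2 b b2 b0 = 0,
      base_block b2 b b1 b2 + base_block b0 b b0 b1 = 0,
      base_block b0 b b1 b2 = base_block b1 b b2 b0 &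
      base_block b1 b b2 b0 = base_block b2 b b0 b1].
Proof.
move=> Bb /(_ b Bb) /=.
set Ric := ricci _ _; set tau := \tr _ / 3 => EW.
pose Gam := christoffel h a.
have GW : coframe_connection B E Gam W := frame_connectionP uE h a.
pose Rm k l : 'M[R]_3 := \matrix_(m, j) curvature Gam b m j k l.
have gV y : B y -> h y \in unitmx.
  by move=> By; rewrite hE// unitmx_mul unitmx_tr uE.
have Sh : smooth_mx B h.
  move=> i j; apply: (smooth_ext oB (f := fun x => ((E x)^T *m E x) i j)).
    by move=> x /hE ->.
  by apply: (smooth_mulmx oB) => // p q; under eq_fun do rewrite mxE; exact: SE.
have FR k l : E b *m Rm k l = curv_mx W k l b *m E b.
  rewrite /Rm curvature_mx; apply: (curvature_coframe oB SE k l GW) => //.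
  exact: (smooth_christoffel oB Sh Sa gV).
pose Rh : 'M[R]_3 := \matrix_(p, q) \sum_c
  frame_components (E b) (fun k l => curv_mx W k l b) c p c q.
have RicE : Ric = (E b)^T *m Rh *m E b.
  rewrite /Rh -(ricci_components (uE Bb) FR).
  by apply/matrixP => l j; rewrite !mxE; apply: eq_bigr => k _; rewrite mxE.
have [[C0 C1 C2] [C3 C4 C5] [A0 A1 A2]] := base_curv Bb.
pose D := (invmx (E b))^T *m dform a b *m invmx (E b).
have Dsk i j : D j i = - D i j.
  have : D^T = - D by rewrite /D !trmx_mul trmxK dform_tr mulNmx mulmxN mulmxA.
  by move=> /(congr1 (fun X : 'M[R]_3 => X i j)); rewrite !mxE.
have Nsk c i j : base_block c b j i = - base_block c b i j.
  by have := congr1 (fun X : 'M[R]_3 => X i j) (base_block_skew c b); rewrite !mxE.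
have RhE p q : Rh p q = \sum_c frame_components (E b) (fun k l => curv_mx W k l b) c p c q.
  by rewrite mxE.
have fcE p q : frame_components (E b) (fun k l => curv_mx W k l b) p q =
   (invmx (E b))^T *m (\matrix_(k, l) curv_mx W k l b p q) *m invmx (E b) by [].
have ent (X : 'M[R]_3) t p q : 2^-1 *: (X + X^T) = t *: 1%:M ->
    X p q + X q p = (p == q)%:R * (2 * t).
  move=> /(congr1 (fun Y : 'M[R]_3 => 2 * Y p q)).
  by rewrite !mxE; case: (p == q); rewrite ?mulr1n ?mulr0n /= => H; lra.
have sym p q : Rh p q + Rh q p = (p == q)%:R * (2 * tau).
  have K (A : 'M[R]_3) : (invmx (E b))^T *m ((E b)^T *m A *m E b) *m invmx (E b) = A.
    by rewrite -!mulmxA mulmxV ?uE// mulmx1 mulmxA -trmx_mul mulmxV ?uE// trmx1 mul1mx.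
  have : 2^-1 *: (Rh + Rh^T) = tau *: 1%:M.
    move/eqP: EW; rewrite subr_eq0 => /eqP EW.
    rewrite -[LHS]K -[RHS]K -!scalemxAr -!scalemxAl.
    rewrite [(E b)^T *m 1%:M]mulmx1 -hE// -EW.
    rewrite RicE !trmx_mul trmxK mulmxDr mulmxDl !mulmxA.
    by rewrite -!scalemxAr -!scalemxAl.
  exact: ent.
have := sym b0 b1; have := sym b1 b2; have := sym b2 b0.
have := sym b0 b0; have := sym b1 b1; have := sym b2 b2.
rewrite !RhE !sum3 !fcE C0 C1 C2 C3 C4 C5 A0 A1 A2 -/D !mulmxN !mulNmx.
rewrite -!/(base_block _ _).
have oE (X : 'M[R]_3) i j : (- X) i j = - X i j by rewrite mxE.
rewrite !oE.
rewrite !(Nsk _ b0 b1) !(Nsk _ b1 b2) !(Nsk _ b2 b0) !(Dsk b0 b1) !(Dsk b1 b2) !(Dsk b2 b0).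
have D0 i : D i i = 0.
  by have /eqP := Dsk i i; rewrite -subr_eq0 opprK -mulr2n mulrn_eq0/= => /eqP.
have N0 c i : base_block c b i i = 0.
  by have /eqP := Nsk c i i; rewrite -subr_eq0 opprK -mulr2n mulrn_eq0/= => /eqP.
rewrite !D0 ?N0 /=.
move: (base_block b0 b) (base_block b1 b) (base_block b2 b) => N N' N''.
by move=> H1 H2 H3 H4 H5 H6; split; lra.
Qed.

End EinsteinWeyl.

(** * The Levi-Civita connection of a monopole metric *)

Section TotalAlgebra.
Variable R : realType.
Local Notation "'dl' a" := (delta_mx 0 a : 'rV[R]_4) (at level 9).

(* Components in the coframe (e_0, e_1, e_2, e_3) of the connection forms, given
   the components p of the connection forms of the base, a of the Weyl 1-form and
   v of the 1-form beta / w.  For (i, j, k) cyclic, hor i and ver i are the forms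
   with indices (j, k) and (i, 3). *)
Section Forms.
Variables (p : 'I_3 -> 'rV[R]_3) (a v : 'rV[R]_3).

Definition hor (i j k : 'I_3) : 'rV[R]_4 :=
  p i *m (dpr R)^T - a 0 k *: dl (lift ord_max j) + a 0 j *: dl (lift ord_max k)
  - (2^-1 * v 0 i) *: dl m3.

Definition ver (i j k : 'I_3) : 'rV[R]_4 :=
  (a 0 i + v 0 i) *: dl m3
  + (2^-1 * v 0 j) *: dl (lift ord_max k) - (2^-1 * v 0 k) *: dl (lift ord_max j).

Definition conn4 (c d : 'I_4) : 'rV[R]_4 :=
  match nat_of_ord c, nat_of_ord d with
  | 1%N, 2%N => hor b0 b1 b2 | 2%N, 1%N => - hor b0 b1 b2
  | 2%N, 0%N => hor b1 b2 b0 | 0%N, 2%N => - hor b1 b2 b0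
  | 0%N, 1%N => hor b2 b0 b1 | 1%N, 0%N => - hor b2 b0 b1
  | 0%N, 3%N => ver b0 b1 b2 | 3%N, 0%N => - ver b0 b1 b2
  | 1%N, 3%N => ver b1 b2 b0 | 3%N, 1%N => - ver b1 b2 b0
  | 2%N, 3%N => ver b2 b0 b1 | 3%N, 2%N => - ver b2 b0 b1
  | _, _ => 0
  end.

Lemma conn4_skew c d : conn4 d c = - conn4 c d.
Proof. by elim/ord4P: c; elim/ord4P: d; rewrite /conn4 /= ?opprK ?oppr0. Qed.

(* Components of the exterior derivatives of the coframe. *)
Definition torsion4 (c : 'I_4) : 'M[R]_4 :=
  let P i := p i *m (dpr R)^T in let A := a *m (dpr R)^T in
  match nat_of_ord c with
  | 0%N => wedge (P b1) (dl m2) - wedge (P b2) (dl m1) - wedge A (dl m0)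
  | 1%N => wedge (P b2) (dl m0) - wedge (P b0) (dl m2) - wedge A (dl m1)
  | 2%N => wedge (P b0) (dl m1) - wedge (P b1) (dl m0) - wedge A (dl m2)
  | _ => dpr R *m hodge3 v *m (dpr R)^T + wedge (dl m3) ((a + v) *m (dpr R)^T)
  end.

Lemma row4_eq (q : 'rV[R]_3) c : (q *m (dpr R)^T) 0 c =
  if unlift ord_max c is Some i then q 0 i else 0.
Proof. by case: unliftP => [i ->|->]; rewrite ?lift_dpr ?max_dpr. Qed.

Lemma unlift4 : (unlift ord_max m0 = Some b0) * (unlift ord_max m1 = Some b1) *
  (unlift ord_max m2 = Some b2) * (unlift ord_max m3 = None :> option 'I_3).
Proof. by rewrite -!lift_maxE !liftK unlift_none. Qed.

Lemma pull_hodgeE i j : (dpr R *m hodge3 v *m (dpr R)^T) i j =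
  match unlift ord_max i, unlift ord_max j with
  | Some i', Some j' => d3 (v 0) (unit_vec R i') (unit_vec R j') | _, _ => 0 end.
Proof.
by rewrite pullE; case: unlift => // i'; case: unlift => // j'; rewrite hodge3E mxE.
Qed.

(* Replace the pulled back rows and matrices by variables with known entries. *)
Ltac gen_rows :=
  let H0 := fresh "H" in let H1 := fresh "H" in let H2 := fresh "H" in
  let HA := fresh "H" in let HV := fresh "H" in let HH := fresh "H" in
  have H0 := row4_eq (p b0); have H1 := row4_eq (p b1); have H2 := row4_eq (p b2);
  have HA := row4_eq a; have HV := row4_eq (a + v); have HH := pull_hodgeE;
  move: (p b0 *m (dpr R)^T) (p b1 *m (dpr R)^T) (p b2 *m (dpr R)^T)
    (a *m (dpr R)^T) ((a + v) *m (dpr R)^T) (dpr R *m hodge3 v *m (dpr R)^T)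
    H0 H1 H2 HA HV HH => q0 q1 q2 qa qv hv H0 H1 H2 HA HV HH.

(** The first structure equation: conn4 is its antisymmetric solution for the
    exterior derivatives torsion4 of the coframe. *)
Lemma conn4_torsion c :
  torsion4 c + \sum_d wedge (conn4 c d) (dl d) = 0.
Proof.
rewrite sum4; apply/matrixP => i j.
elim/ord4P: c; rewrite /conn4 /torsion4 /= /hor /ver !lift_maxE.
- gen_rows; rewrite !mxE ?H ?H0 ?H1 ?H2 ?H3 ?H4.
  by elim/ord4P: i; elim/ord4P: j; rewrite ?unlift4 ?mxE /d3 /unit_vec /=; field.
- gen_rows; rewrite !mxE ?H ?H0 ?H1 ?H2 ?H3 ?H4.
  by elim/ord4P: i; elim/ord4P: j; rewrite ?unlift4 ?mxE /d3 /unit_vec /=; field.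
- gen_rows; rewrite !mxE ?H ?H0 ?H1 ?H2 ?H3 ?H4.
  by elim/ord4P: i; elim/ord4P: j; rewrite ?unlift4 ?mxE /d3 /unit_vec /=; field.
- gen_rows; rewrite !mxE ?H ?H0 ?H1 ?H2 ?H3 ?H4.
  by elim/ord4P: i; elim/ord4P: j; rewrite ?unlift4 ?mxE /d3 /unit_vec /=; field.
Qed.

(* The 1-form by which half of the connection differs from that of the base. *)
Let alpha := a + 2^-1 *: v.

(** The part of the connection acting on the half of the 2-forms spanned by
    e_j /\ e_k + e_i /\ e_3: the pullback of the connection of the base, up to terms
    in alpha. *)
Definition half_form (i j k : 'I_3) : 'rV[R]_4 :=
  p i *m (dpr R)^T + alpha 0 j *: dl (lift ord_max k)
  - alpha 0 k *: dl (lift ord_max j) + alpha 0 i *: dl m3.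

Lemma hor_ver i j k : hor i j k + ver i j k = half_form i j k.
Proof.
rewrite /hor /ver /half_form /alpha; move: (p i *m (dpr R)^T) => q.
by apply/rowP => c; rewrite !mxE; field.
Qed.

(* Components of the exterior derivative of half_form, for N and A those of the
   curvature of the base and of the differential of alpha. *)
Definition d_half_form (N : 'I_3 -> 'M[R]_3) (A : 'I_3 -> 'rV[R]_4) (i j k : 'I_3) : 'M[R]_4 :=
  dpr R *m (N i + wedge (p j) (p k)) *m (dpr R)^T
  + (wedge (A j) (dl (lift ord_max k)) + alpha 0 j *: torsion4 (lift ord_max k))
  - (wedge (A k) (dl (lift ord_max j)) + alpha 0 k *: torsion4 (lift ord_max j))
  + (wedge (A i) (dl m3) + alpha 0 i *: torsion4 m3).

Definition half_curvature N A (i j k : 'I_3) : 'M[R]_4 :=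
  d_half_form N A i j k - wedge (half_form j k i) (half_form k i j).

(** The two halves of the 2-forms commute as Lie algebras, so the quadratic part of
    the curvature on one half only involves the connection on that half. *)
Lemma conn4_curvature :
  [/\ \sum_c wedge (conn4 m1 c) (conn4 c m2) + \sum_c wedge (conn4 m0 c) (conn4 c m3)
        = - wedge (half_form b1 b2 b0) (half_form b2 b0 b1),
      \sum_c wedge (conn4 m2 c) (conn4 c m0) + \sum_c wedge (conn4 m1 c) (conn4 c m3)
        = - wedge (half_form b2 b0 b1) (half_form b0 b1 b2) &
      \sum_c wedge (conn4 m0 c) (conn4 c m1) + \sum_c wedge (conn4 m2 c) (conn4 c m3)
        = - wedge (half_form b0 b1 b2) (half_form b1 b2 b0)].
Proof.
rewrite -!hor_ver !sum4 /conn4 /=.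
move: (hor b0 b1 b2) (hor b1 b2 b0) (hor b2 b0 b1) (ver b0 b1 b2) (ver b1 b2 b0) (ver b2 b0 b1).
move=> h0 h1 h2 v0 v1 v2.
by split; apply/matrixP => i j; rewrite !mxE; ring.
Qed.

(* The entries of the matrices above, as functions that reduce on given indices. *)
Section Entries.
Variables (N : 'I_3 -> 'M[R]_3) (A : 'I_3 -> 'rV[R]_4).

Definition ext (q : 'rV[R]_3) (c : 'I_4) : R :=
  match nat_of_ord c with
  | 0%N => q 0 b0 | 1%N => q 0 b1 | 2%N => q 0 b2 | _ => 0 end.

Definition ext2 (f : 'I_3 -> 'I_3 -> R) (c d : 'I_4) : R :=
  match nat_of_ord c, nat_of_ord d with
  | 0%N, 0%N => f b0 b0 | 0%N, 1%N => f b0 b1 | 0%N, 2%N => f b0 b2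
  | 1%N, 0%N => f b1 b0 | 1%N, 1%N => f b1 b1 | 1%N, 2%N => f b1 b2
  | 2%N, 0%N => f b2 b0 | 2%N, 1%N => f b2 b1 | 2%N, 2%N => f b2 b2
  | _, _ => 0 end.

Definition up (i : 'I_3) : 'I_4 :=
  match nat_of_ord i with 0%N => m0 | 1%N => m1 | _ => m2 end.

Definition dd (c e : 'I_4) : R := if nat_of_ord c == nat_of_ord e then 1 else 0.

Definition wd (f g : 'I_4 -> R) (c d : 'I_4) : R := f c * g d - f d * g c.

Definition hf i j k c : R := ext (p i) c + alpha 0 j * dd c (up k)
  - alpha 0 k * dd c (up j) + alpha 0 i * dd c m3.

Definition tor (e c d : 'I_4) : R :=
  let q i := ext (p i) in let t := ext a in
  match nat_of_ord e with
  | 0%N => wd (q b1) (dd^~ m2) c d - wd (q b2) (dd^~ m1) c d - wd t (dd^~ m0) c d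
  | 1%N => wd (q b2) (dd^~ m0) c d - wd (q b0) (dd^~ m2) c d - wd t (dd^~ m1) c d
  | 2%N => wd (q b0) (dd^~ m1) c d - wd (q b1) (dd^~ m0) c d - wd t (dd^~ m2) c d
  | _ => ext2 (fun i j => d3 (v 0) (unit_vec R i) (unit_vec R j)) c d
         + wd (dd^~ m3) (fun c => ext a c + ext v c) c d
  end.

Definition hc i j k (c d : 'I_4) : R :=
  ext2 (fun i' j' => N i i' j' + (p j 0 i' * p k 0 j' - p j 0 j' * p k 0 i')) c d
  + (wd (A j 0) (dd^~ (up k)) c d + alpha 0 j * tor (up k) c d)
  - (wd (A k 0) (dd^~ (up j)) c d + alpha 0 k * tor (up j) c d)
  + (wd (A i 0) (dd^~ m3) c d + alpha 0 i * tor m3 c d)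
  - wd (hf j k i) (hf k i j) c d.

Lemma extE q c : (q *m (dpr R)^T) 0 c = ext q c.
Proof. by rewrite row4_eq; elim/ord4P: c; rewrite unlift4. Qed.

Lemma ext2E (X : 'M[R]_3) c d : (dpr R *m X *m (dpr R)^T) c d = ext2 X c d.
Proof. by rewrite pullE; elim/ord4P: c; elim/ord4P: d; rewrite !unlift4. Qed.

Lemma upE i : lift ord_max i = up i.
Proof. by elim/ord3P: i; rewrite lift_maxE. Qed.

Lemma ddE e c : (dl e) 0 c = dd c e.
Proof. by rewrite mxE eqxx /dd -val_eqE /=; case: (_ == _). Qed.

Lemma wdE (x y : 'rV[R]_4) c d : wedge x y c d = wd (x 0) (y 0) c d.
Proof. exact: mxE. Qed.

Lemma wd_ext f g f' g' c d : f =1 f' -> g =1 g' -> wd f g c d = wd f' g' c d.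
Proof. by move=> H H'; rewrite /wd !H !H'. Qed.

Lemma hfE i j k c : half_form i j k 0 c = hf i j k c.
Proof.
rewrite /hf -extE /half_form; move: (p i *m _) => q.
have rD (x y : 'rV[R]_4) : (x + y) 0 c = x 0 c + y 0 c by rewrite mxE.
have rB (x y : 'rV[R]_4) : (x - y) 0 c = x 0 c - y 0 c by rewrite !mxE.
have rZ t (x : 'rV[R]_4) : (t *: x) 0 c = t * x 0 c by rewrite mxE.
by rewrite rD rB rD !rZ !ddE !upE.
Qed.

Lemma torE e c d : torsion4 e c d = tor e c d.
Proof.
have w x y : wedge (x *m (dpr R)^T) (dl y) c d = wd (ext x) (dd^~ y) c d.
  by rewrite wdE; apply: wd_ext => z; [rewrite extE|rewrite ddE].
have mD (X Y : 'M[R]_4) : (X + Y) c d = X c d + Y c d by rewrite mxE.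
have mB (X Y : 'M[R]_4) : (X - Y) c d = X c d - Y c d by rewrite !mxE.
elim/ord4P: e; rewrite /torsion4 /tor /=; rewrite ?mB ?w//.
rewrite mD ext2E; congr (_ + _).
  by rewrite /ext2 hodge3E !mxE.
by rewrite wdE; apply: wd_ext => z; [rewrite ddE|rewrite mulmxDl mxE !extE].
Qed.

Lemma hcE i j k c d : half_curvature N A i j k c d = hc i j k c d.
Proof.
have mD (X Y : 'M[R]_4) : (X + Y) c d = X c d + Y c d by rewrite mxE.
have mB (X Y : 'M[R]_4) : (X - Y) c d = X c d - Y c d by rewrite !mxE.
have mZ t (X : 'M[R]_4) : (t *: X) c d = t * X c d by rewrite mxE.
have w (x : 'rV[R]_4) y : wedge x (dl y) c d = wd (x 0) (dd^~ y) c d.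
  by rewrite wdE; apply: wd_ext => z //; rewrite ddE.
have T1 := torE (up k) c d; have T2 := torE (up j) c d; have T3 := torE m3 c d.
rewrite /half_curvature /d_half_form !upE /hc.
move: (torsion4 (up k)) (torsion4 (up j)) (torsion4 m3) T1 T2 T3 => t1 t2 t3 T1 T2 T3.
rewrite mB mD mB mD !mD !mZ !w ext2E T1 T2 T3.
congr (_ + _ - _ + _ - _); last by rewrite wdE; apply: wd_ext => z; rewrite hfE.
have e i' j' : (N i + wedge (p j) (p k)) i' j'
    = N i i' j' + (p j 0 i' * p k 0 j' - p j 0 j' * p k 0 i').
  by rewrite mxE [X in _ + X]mxE.
by rewrite /ext2 !e.
Qed.

End Entries.

(** The hypotheses say that the curvature N of the base is a multiple of the
    identity plus an antisymmetric map, the conclusions that the block of the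
    curvature on the same half of the 2-forms is: the terms in a, v and A only
    contribute to these two parts. *)
Lemma half_curvature_block N A : (forall i, (N i)^T = - N i) ->
  N b0 b2 b0 + N b1 b1 b2 = 0 -> N b1 b0 b1 + N b2 b2 b0 = 0 ->
  N b2 b1 b2 + N b0 b0 b1 = 0 -> N b0 b1 b2 = N b1 b2 b0 -> N b1 b2 b0 = N b2 b0 b1 ->
  let S0 := half_curvature N A b0 b1 b2 in
  let S1 := half_curvature N A b1 b2 b0 in
  let S2 := half_curvature N A b2 b0 b1 in
  [/\ S0 m2 m0 + S0 m1 m3 + (S1 m1 m2 + S1 m0 m3) = 0,
      S1 m0 m1 + S1 m2 m3 + (S2 m2 m0 + S2 m1 m3) = 0,
      S2 m1 m2 + S2 m0 m3 + (S0 m0 m1 + S0 m2 m3) = 0,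
      S0 m1 m2 + S0 m0 m3 = S1 m2 m0 + S1 m1 m3 &
      S1 m2 m0 + S1 m1 m3 = S2 m0 m1 + S2 m2 m3].
Proof.
move=> Nsk E1 E2 E3 E4 E5.
have nE i j k : N i k j = - N i j k.
  by have := congr1 (fun X : 'M[R]_3 => X j k) (Nsk i); rewrite !mxE.
have e1 : N b1 b1 b2 = - N b0 b2 b0 by lra.
have e2 : N b2 b2 b0 = - N b1 b0 b1 by lra.
have e3 : N b2 b1 b2 = - N b0 b0 b1 by lra.
have alE c : alpha 0 c = a 0 c + 2^-1 * v 0 c by rewrite /alpha !mxE.
rewrite /= !hcE /hc /tor /hf /wd /dd /ext /ext2 /up /d3 /unit_vec !alE /=.
rewrite ?e1 ?e2 ?e3 E4 E5.
by split; field.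
Qed.

End Forms.
End TotalAlgebra.

(** * Monopole metrics are selfdual *)

Section Splitting.
Variable R : realType.
Local Notation M4 := 'rV[R]_4.
Local Notation B3 := 'rV[R]_3.

(* Derivative along the fibres, and along the horizontal lifts of the coordinate
   vector fields with respect to the 1-form th. *)
Definition vdot n (q : M4 -> 'rV[R]_n) (x : M4) : 'rV[R]_n :=
  \row_i partial ord_max (fun y => q y 0 i) x.

Definition hder (th : M4 -> M4) (i : 'I_3) (f : M4 -> R) (x : M4) : R :=
  partial (lift ord_max i) f x - th x 0 (lift ord_max i) * partial ord_max f x.

(* Horizontal part of the exterior derivative. *)
Definition hor_d (th a : M4 -> M4) (x : M4) : 'M[R]_3 :=
  \matrix_(i, j) (hder th i (fun y => a y 0 (lift ord_max j)) x
                 - hder th j (fun y => a y 0 (lift ord_max i)) x).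

(* The fields d_4 and e_l = d_l - th_l d_4 are dual to th and the dx_l. *)
Lemma dform_split (th a : M4 -> M4) x : th x 0 ord_max = 1 ->
  (forall i, partial i (fun y => a y 0 ord_max) x = 0) ->
  dform a x = wedge (th x) (vdot a x) + dpr R *m hor_d th a x *m (dpr R)^T.
Proof.
move=> th1 a0; apply/matrixP => i j; rewrite mxE [RHS]mxE pullE.
rewrite [wedge _ _ _ _]mxE ![vdot _ _ _ _]mxE.
case: (unliftP ord_max i) => [i' ->|->]; case: (unliftP ord_max j) => [j' ->|->].
- rewrite mxE /hder; move: (th x 0 _) (th x 0 _) (partial (lift _ _) _ x) (partial (lift _ _) _ x).
  by move: (partial ord_max _ x) (partial ord_max _ x) => A C t t' D G; ring.
- by rewrite !a0 th1 mulr0 mul1r sub0r addr0.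
- by rewrite !a0 th1 mulr0 mul1r !subr0 addr0.
- by rewrite !a0 mulr0 subrr addr0.
Qed.

Lemma hor_d_tr th a x : (hor_d th a x)^T = - hor_d th a x.
Proof.
pose f k l := hder th k (fun y => a y 0 (lift ord_max l)) x.
have E k l : hor_d th a x k l = f k l - f l k by exact: mxE.
move: (hor_d th a x) f E => H f E.
by apply/matrixP => i j; rewrite [LHS]mxE [RHS]mxE !E opprB.
Qed.

(* Along the fibres only the values on the fibre matter. *)
Lemma partial_max_ext (f g : M4 -> R) x : (forall y, pr y = pr x -> f y = g y) ->
  partial ord_max f x = partial ord_max g x.
Proof.
move=> fg; rewrite /partial /derive; set F := (X in lim (X @ _)); set G := (X in _ = lim (X @ _)).
have -> : F = G; last by [].
have P h : pr (h *: delta_mx 0 ord_max + x) = pr x.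
  by rewrite prD prZ -[delta_mx 0 ord_max]/(fib R) pr_fib scaler0 add0r.
by apply/funext => h; rewrite /F /G /= !fg.
Qed.

Lemma smooth_vdot n U (q : M4 -> 'rV[R]_n) : smooth_row U q -> smooth_row U (vdot q).
Proof. by move=> Sq i; under eq_fun do rewrite mxE; exact: smooth_partial. Qed.

Lemma star1_linear (H : 'M[R]_3) (c : B3) j k :
  star1 H c j k = \sum_l c 0 l * (\sum_i invmx H l i * vol H [tuple i; j; k]).
Proof.
rewrite mxE; under eq_bigr do rewrite mxE mulr_suml.
rewrite exchange_big/=; apply: eq_bigr => l _; rewrite mulr_sumr.
by apply: eq_bigr => i _; rewrite -mulrA.
Qed.

Lemma star1D (H : 'M[R]_3) c d : star1 H (c + d) = star1 H c + star1 H d.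
Proof.
apply/matrixP => j k; rewrite [RHS]mxE !star1_linear -big_split/=.
by apply: eq_bigr => l _; rewrite mxE mulrDl.
Qed.

Lemma star1Z (H : 'M[R]_3) t c : star1 H (t *: c) = t *: star1 H c.
Proof.
apply/matrixP => j k; rewrite [RHS]mxE !star1_linear mulr_sumr.
by apply: eq_bigr => l _; rewrite mxE mulrA.
Qed.

(* The metric of the base is constant along the fibres. *)
Lemma partial_star1 U (h : B3 -> 'M[R]_3) (beta : M4 -> B3) x j k : open U -> U x ->
  smooth_row U beta ->
  partial ord_max (fun y => star1 (h (pr y)) (beta y) j k) x
  = star1 (h (pr x)) (vdot beta x) j k.
Proof.
move=> oU Ux Sb; pose c l := \sum_i invmx (h (pr x)) l i * vol (h (pr x)) [tuple i; j; k].
rewrite (@partial_max_ext _ (fun y => \sum_l beta y 0 l * c l)); last first.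
  by move=> y yx; rewrite star1_linear yx.
rewrite (partial_sum _ _ oU Ux); last first.
  by move=> l; apply: smoothM => //; exact: smooth_cst.
rewrite star1_linear; apply: eq_bigr => l _; rewrite partialM.
- by rewrite partial_cst mulr0 add0r mulrC mxE.
- exact: smooth_derivable (Sb l) Ux.
- exact: derivable_cst.
Qed.

End Splitting.

Lemma conj_sums (R : comPzRingType) n (G : 'M[R]_n) (I : finType) (f k : I -> 'M[R]_n) :
  G^T *m (\sum_c f c + \sum_c k c) *m G
  = \sum_c (G^T *m f c *m G) + \sum_c (G^T *m k c *m G).
Proof. by rewrite mulmxDr mulmxDl !mulmx_sumr !mulmx_suml. Qed.

Section MonopoleMetric.
Variable R : realType.
Local Notation M4 := 'rV[R]_4.
Local Notation B3 := 'rV[R]_3.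
Variables (M : set M4) (B : set B3) (h E : B3 -> 'M[R]_3) (aB : B3 -> B3)
  (w : M4 -> R) (th : M4 -> M4) (beta : M4 -> B3).
Hypotheses (oM : open M) (oB : open B) (MB : forall x, M x -> B (pr x))
  (SE : smooth_mx B E) (hE : forall b, B b -> h b = (E b)^T *m E b)
  (dE : forall b, B b -> 0 < \det (E b)) (SaB : smooth_row B aB)
  (Sw : smooth M w) (w0 : forall x, M x -> 0 < w x)
  (Sth : smooth_row M th) (th1 : forall x, M x -> th x 0 ord_max = 1)
  (Sbeta : smooth_row M beta)
  (* The monopole equation on M, for beta = w (a0 - aB) with a0 the 1-form of the
     minimal Weyl derivative. *)
  (monopole : forall x, M x -> star1 (h (pr x)) (beta x) = hor_d th th x)
  (betaE : forall x, M x -> beta x *m (dpr R)^T = w x *: vdot th x + dfun w x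
     - partial ord_max w x *: th x - w x *: pull1 aB x).

Lemma partial_th_max x i : M x -> partial i (fun y => th y 0 ord_max) x = 0.
Proof.
by move=> Mx; rewrite (partial_ext i oM Mx th1) partial_cst.
Qed.

Lemma dform_th x : M x -> dform th x = wedge (th x) (vdot th x)
  + dpr R *m star1 (h (pr x)) (beta x) *m (dpr R)^T.
Proof.
move=> Mx; rewrite monopole//; apply: dform_split; first exact: th1.
by move=> i; exact: partial_th_max.
Qed.

Let u x := (w x)^-1 *: th x.
Let F x := coframe (E (pr x)) (u x).

Let n0 x : M x -> w x != 0. Proof. by move=> /w0; exact: lt0r_neq0. Qed.

Let Siw : smooth M (fun x => (w x)^-1).
Proof. exact: smoothV. Qed.

Let Su : smooth_row M u.
Proof. exact: smooth_rowZ. Qed.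

Let sub_pr : M `<=` [set x | B (pr x)]. Proof. exact: MB. Qed.

Let Spull (q : B3 -> B3) : smooth_row B q -> smooth_row M (pull1 q).
Proof. by move=> Sq i; apply: smooth_sub sub_pr _; exact: (smooth_pull1 oB Sq). Qed.

Let Spr (f : B3 -> R) : smooth B f -> smooth M (fun x => f (pr x)).
Proof. by move=> Sf; apply: smooth_sub sub_pr _; exact: smooth_pr. Qed.

Lemma row_coframe_lift x k :
  row (lift ord_max k) (F x) = pull1 (fun b => row k (E b)) x.
Proof.
by rewrite rowE -delta_dpr /F pull_coframe -rowE.
Qed.

Lemma row_coframe_max x : row m3 (F x) = u x.
Proof. by rewrite rowE -ord_max3 -[delta_mx 0 ord_max]/(fib R) fib_coframe. Qed.

Let Srow k : smooth_row B (fun b => row k (E b)).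
Proof. by move=> i; under eq_fun do rewrite mxE; exact: SE. Qed.

Lemma smooth_row_coframe c : smooth_row M (fun x => row c (F x)).
Proof.
case: (unliftP ord_max c) => [k ->|->].
  by under eq_fun do rewrite row_coframe_lift; exact: Spull.
by rewrite ord_max3; under eq_fun do rewrite row_coframe_max.
Qed.

Lemma smooth_coframe : smooth_mx M F.
Proof.
move=> c i; have := smooth_row_coframe c i.
by congr (smooth M _); apply/funext => x; rewrite mxE.
Qed.

Let uE b : B b -> E b \in unitmx.
Proof. by move=> Bb; rewrite unitmxE unitfE gt_eqF// dE. Qed.

Let dF x : M x -> 0 < \det (F x).
Proof. by move=> Mx; exact: (det_coframe_gt0 (dE (MB Mx)) (w0 Mx) (th1 Mx)). Qed.

Let uF x : M x -> F x \in unitmx.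
Proof. by move=> Mx; rewrite unitmxE unitfE gt_eqF// dF. Qed.

Let Pb b := invmx (E b).
Let p x i := base_form h E aB i (pr x) *m Pb (pr x).
Let a x := aB (pr x) *m Pb (pr x).
Let v x := ((w x)^-1 *: beta x) *m Pb (pr x).

(** The first three elements come from the base; for the last one, th / w, the
    monopole equation replaces the horizontal part of d th by the star of beta. *)
Lemma dcoframe c x : M x -> dform (fun y => row c (F y)) x
  = (F x)^T *m torsion4 (p x) (a x) (v x) c *m F x.
Proof.
move=> Mx; have Bx := MB Mx; pose W (q : B3) := q *m Pb (pr x).
have WF (q : B3) : W q *m (dpr R)^T *m F x = q *m (dpr R)^T.
  by rewrite /F pull_coframe /W mulmxKV// uE.
have [T0 T1 T2] := base_torsion aB oB SE hE dE Bx.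
have pl k : dform (fun y => row (lift ord_max k) (F y)) x
    = dpr R *m dform (fun b => row k (E b)) (pr x) *m (dpr R)^T.
  by rewrite -dform_pull1; apply: (dform_ext oM Mx) => y _; exact: row_coframe_lift.
have wF (q : B3) k : (F x)^T *m wedge (W q *m (dpr R)^T) (delta_mx 0 (lift ord_max k)) *m F x
    = dpr R *m wedge q (row k (E (pr x))) *m (dpr R)^T.
  by rewrite -wedge_mul WF -rowE row_coframe_lift wedge_pull.
case: (unliftP ord_max c) => [k ->|->].
  rewrite pl; move: k; elim/ord3P; rewrite ?T0 ?T1 ?T2 !lift_maxE /torsion4 /=.
  - by rewrite -lift_max2 -lift_max1 -lift_max0 !mulmxBr !mulmxBl !wF.
  - by rewrite -lift_max2 -lift_max1 -lift_max0 !mulmxBr !mulmxBl !wF.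
  - by rewrite -lift_max2 -lift_max1 -lift_max0 !mulmxBr !mulmxBl !wF.
rewrite ord_max3 (_ : (fun y => _) = u); last by apply/funext => y; exact: row_coframe_max.
rewrite /u (dformZ Mx Siw Sth) dform_th// /torsion4 /=.
have dV : dfun (fun y => (w y)^-1) x = - ((w x)^-1 * (w x)^-1) *: dfun w x.
  apply/rowP => i; rewrite mxE partialV ?n0//; last exact: smooth_derivable Sw Mx.
  by rewrite [RHS]mxE [dfun _ _ _ _]mxE mulNr expr2 invfM.
have aE : (a x + v x) *m (dpr R)^T *m F x = vdot th x + (w x)^-1 *: dfun w x
    - ((w x)^-1 * partial ord_max w x) *: th x.
  have -> : a x + v x = W (aB (pr x) + (w x)^-1 *: beta x) by rewrite /W mulmxDl.
  rewrite WF mulmxDl -scalemxAl betaE// -[aB (pr x) *m _]/(pull1 aB x).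
  rewrite !scalerBr !scalerDr !scalerA mulVf ?n0// !scale1r.
  by move: (vdot th x) (dfun w x) (pull1 aB x) => X Y Z; apply/rowP => i; rewrite !mxE; ring.
rewrite mulmxDr mulmxDl -wedge_mul aE -rowE row_coframe_max /F pull2_coframe -star1_frame ?dE//.
rewrite -hE// /v mulmxKV ?uE// star1Z -scalemxAr -scalemxAl dV /u.
move: (dpr R *m _ *m _) (vdot th x) (dfun w x) (th x) (partial _ _ _) => S X Y t y.
by apply/matrixP => i j; rewrite !mxE; ring.
Qed.

(** ** The connection *)

Let W i x : 'M[R]_4 := \matrix_(c, d) (conn4 (p x) (a x) (v x) c d *m F x) 0 i.

Let entryW c d x : entry_form W c d x = conn4 (p x) (a x) (v x) c d *m F x.
Proof. by apply/rowP => i; rewrite !mxE. Qed.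

Let Sinv : forall i j, smooth M (fun x => (Pb (pr x)) i j).
Proof. by move=> i j; apply: (Spr (f := fun b => Pb b i j)); exact: smooth_invmx. Qed.

Let Srow3 (q : M4 -> B3) : smooth_row M q -> smooth_row M (fun x => q x *m Pb (pr x)).
Proof.
move=> Sq i; apply: (smooth_mulmx oM) => // c d.
by have := Sq d; congr (smooth M _); apply/funext => x; rewrite (ord1 c).
Qed.

Let Sp i : smooth_row M (fun x => p x i).
Proof.
apply: Srow3 => j; apply: (Spr (f := fun b => base_form h E aB i b 0 j)).
exact: (smooth_base_form oB SE SaB hE dE).
Qed.

Let Sa : smooth_row M a.
Proof. by apply: Srow3 => j; apply: (Spr (f := fun b => aB b 0 j)). Qed.

Let Sv : smooth_row M v.
Proof. by apply: Srow3; exact: smooth_rowZ. Qed.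

Let Sdpr (q : M4 -> B3) : smooth_row M q -> smooth_row M (fun x => q x *m (dpr R)^T).
Proof.
move=> Sq i; case: (unliftP ord_max i) => [j ->|->].
  by rewrite (_ : (fun x => _) = fun x => q x 0 j)//; apply/funext => x; rewrite lift_dpr.
rewrite (_ : (fun x => _) = fun=> 0); first exact: smooth_cst.
by apply/funext => x; rewrite max_dpr.
Qed.

Let Scst (q : M4) : smooth_row M (fun=> q).
Proof. by move=> i; exact: smooth_cst. Qed.

Let SB (q q' : M4 -> M4) : smooth_row M q -> smooth_row M q' -> smooth_row M (fun y => q y - q' y).
Proof. by move=> Sq Sq'; apply: smooth_rowD => //; exact: smooth_rowN. Qed.

Let Shor i j k : smooth_row M (fun x => hor (p x) (a x) (v x) i j k).
Proof.
apply: SB; first (apply: smooth_rowD => //; first apply: SB).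
- exact: Sdpr.
- by apply: smooth_rowZ => //; exact: Sa.
- by apply: smooth_rowZ => //; exact: Sa.
by apply: smooth_rowZ => //; apply: smoothM; [by []|exact: smooth_cst|exact: Sv].
Qed.

Let Sver i j k : smooth_row M (fun x => ver (a x) (v x) i j k).
Proof.
apply: SB; first apply: smooth_rowD => //.
- by apply: smooth_rowZ => //; apply: smoothD; [|exact: Sa|exact: Sv].
- by apply: smooth_rowZ => //; apply: smoothM; [by []|exact: smooth_cst|exact: Sv].
by apply: smooth_rowZ => //; apply: smoothM; [by []|exact: smooth_cst|exact: Sv].
Qed.

Let Sconn c d : smooth_row M (fun x => conn4 (p x) (a x) (v x) c d).
Proof.
have SN (q : M4 -> M4) : smooth_row M q -> smooth_row M (fun x => - q x).
  exact: smooth_rowN.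
elim/ord4P: c; elim/ord4P: d;
  [exact: Scst | exact: (Shor b2 b0 b1) | exact: SN (Shor b1 b2 b0) | exact: (Sver b0 b1 b2)
  |exact: SN (Shor b2 b0 b1) | exact: Scst | exact: (Shor b0 b1 b2) | exact: (Sver b1 b2 b0)
  |exact: (Shor b1 b2 b0) | exact: SN (Shor b0 b1 b2) | exact: Scst | exact: (Sver b2 b0 b1)
  |exact: SN (Sver b0 b1 b2) | exact: SN (Sver b1 b2 b0) | exact: SN (Sver b2 b0 b1)
  |exact: Scst].
Qed.

Let SconnF c d : smooth_row M (fun x => conn4 (p x) (a x) (v x) c d *m F x).
Proof.
move=> i; apply: (smooth_mulmx oM _ smooth_coframe) => c' d'.
by have := Sconn c d d'; congr (smooth M _); apply/funext => x; rewrite (ord1 c').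
Qed.

Let SW i : smooth_mx M (W i).
Proof. by move=> c d; under eq_fun do rewrite mxE; exact: SconnF. Qed.

Let tW : torsion_free M F W.
Proof.
apply/torsion_free_form => x Mx c; rewrite dcoframe//.
have -> : \sum_d wedge (entry_form W c d x) (row d (F x))
    = (F x)^T *m (\sum_d wedge (conn4 (p x) (a x) (v x) c d) (delta_mx 0 d)) *m F x.
  rewrite mulmx_sumr mulmx_suml; apply: eq_bigr => d _.
  by rewrite entryW rowE wedge_mul.
by rewrite -mulmxDl -mulmxDr conn4_torsion mulmx0 mul0mx.
Qed.

Let aW x : M x -> forall i, (W i x)^T = - W i x.
Proof.
move=> Mx i; apply/matrixP => c d; rewrite [RHS]mxE !mxE -sumrN; apply: eq_bigr => e _.
have -> : conn4 (p x) (a x) (v x) d c 0 e = - conn4 (p x) (a x) (v x) c d 0 e.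
  by rewrite (conn4_skew (p x) (a x) (v x) c d) [LHS]mxE.
by rewrite mulNr.
Qed.

(** ** Its curvature *)

Let alpha x := a x + 2^-1 *: v x.

Let Salpha : smooth_row M alpha.
Proof. by apply: smooth_rowD => //; apply: smooth_rowZ => //; exact: smooth_cst. Qed.

Let A x i : M4 := dfun (fun y => alpha y 0 i) x *m invmx (F x).

Let N x i := base_block h E aB i (pr x).

Let X x c d : 'M[R]_4 := frame_curvature F W x c d.

Let half_curv x i j k ci cj ck : M x -> ci = lift ord_max i -> cj = lift ord_max j ->
  ck = lift ord_max k ->
  (forall q, conn4 (p q) (a q) (v q) cj ck + conn4 (p q) (a q) (v q) ci m3
     = half_form (p q) (a q) (v q) i j k) ->
  \sum_c wedge (conn4 (p x) (a x) (v x) cj c) (conn4 (p x) (a x) (v x) c ck)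
    + \sum_c wedge (conn4 (p x) (a x) (v x) ci c) (conn4 (p x) (a x) (v x) c m3)
  = - wedge (half_form (p x) (a x) (v x) j k i) (half_form (p x) (a x) (v x) k i j) ->
  base_curvature h E aB i (pr x) = dform (base_form h E aB i) (pr x)
    - wedge (base_form h E aB j (pr x)) (base_form h E aB k (pr x)) ->
  X x cj ck + X x ci m3 = half_curvature (p x) (a x) (v x) (N x) (A x) i j k.
Proof.
move=> Mx ci_ cj_ ck_ HF HS BC; have Bx := MB Mx; rewrite /X /frame_curvature /frame_components.
rewrite -mulmxDl -mulmxDr !curv_mx_form.
set S1 := \sum_c _; set S2 := \sum_c _.
have SE' : S1 + S2 = (F x)^T *m (- wedge (half_form (p x) (a x) (v x) j k i)
    (half_form (p x) (a x) (v x) k i j)) *m F x.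
  rewrite -HS conj_sums; congr (_ + _); apply: eq_bigr => c _.
    by rewrite (entryW cj c) (entryW c ck) wedge_mul.
  by rewrite (entryW ci c) (entryW c m3) wedge_mul.
have DE : dform (entry_form W cj ck) x + dform (entry_form W ci m3) x
    = (F x)^T *m d_half_form (p x) (a x) (v x) (N x) (A x) i j k *m F x.
  have Sent c d : smooth_row M (entry_form W c d).
    by move=> e; under eq_fun do rewrite mxE; exact: SW.
  rewrite -(dformD Mx (Sent _ _) (Sent _ _)).
  pose r c y := row c (F y).
  have Sr c : smooth_row M (r c) by exact: smooth_row_coframe.
  have Sal l : smooth M (fun y => alpha y 0 l) by exact: Salpha.
  have Sbf : smooth_row M (pull1 (base_form h E aB i)).
    by apply: Spull; exact: (smooth_base_form oB SE SaB hE dE).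
  rewrite (dform_ext oM Mx (q := fun y => pull1 (base_form h E aB i) y
     + alpha y 0 j *: r (lift ord_max k) y - alpha y 0 k *: r (lift ord_max j) y
     + alpha y 0 i *: r m3 y)); last first.
    move=> y My; rewrite !entryW -mulmxDl HF /half_form !mulmxDl mulNmx -!scalemxAl -!rowE.
    have -> : p y i *m (dpr R)^T *m F y = pull1 (base_form h E aB i) y.
      by rewrite /F pull_coframe /p mulmxKV//; exact: uE (MB My).
    by [].
  rewrite (dformD Mx); last 2 first.
  - apply: SB; last exact: smooth_rowZ.
    by apply: smooth_rowD => //; exact: smooth_rowZ.
  - exact: smooth_rowZ.
  rewrite (dformD Mx); last 2 first.
  - by apply: smooth_rowD => //; exact: smooth_rowZ.
  - by apply: smooth_rowN => //; exact: smooth_rowZ.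
  rewrite (dformN Mx); last exact: smooth_rowZ.
  rewrite (dformD Mx Sbf); last exact: smooth_rowZ.
  rewrite !(dformZ Mx (Sal _) (Sr _)) !dcoframe// dform_pull1 /d_half_form.
  have AF l : dfun (fun y => alpha y 0 l) x = A x l *m F x by rewrite mulmxKV// uF.
  rewrite !AF /r !rowE !wedge_mul.
  have -> : dpr R *m dform (base_form h E aB i) (pr x) *m (dpr R)^T
    = (F x)^T *m (dpr R *m (N x i + wedge (p x j) (p x k)) *m (dpr R)^T) *m F x.
    rewrite /F pull2_coframe; congr (_ *m _ *m _).
    rewrite mulmxDr mulmxDl -wedge_mul /p !mulmxKV ?uE// /N /base_block BC.
    rewrite -[_ *m _ *m invmx _]mulmxA !mulmxA -trmx_mul mulVmx ?uE// trmx1 mul1mx.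
    by rewrite -mulmxA mulVmx ?uE// mulmx1 subrK.
  rewrite -[(Pb (pr x))^T *m _ *m _]wedge_mul -/(p x j) -/(p x k).
  move: (dpr R *m _ *m _) (wedge (A x i) _) (wedge (A x j) _) (wedge (A x k) _).
  rewrite -/(alpha x); move: (F x) (alpha x) (torsion4 _ _ _) => G al T Y Z1 Z2 Z3.
  by rewrite !mulmxDr !mulmxDl !mulmxN !mulNmx !mulmxDr !mulmxDl -!scalemxAr -!scalemxAl.
rewrite addrACA DE SE' -mulmxDl -mulmxDr /half_curvature.
rewrite !mulmxA -trmx_mul mulmxV ?uF// trmx1 mul1mx -mulmxA mulmxV ?uF// mulmx1.
by [].
Qed.

(** On the antiselfdual half of the 2-forms the curvature has the same symmetric
    tracefree part as that of the Weyl derivative of the base, which vanishes by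
    the Einstein-Weyl equation. *)
Theorem monopole_selfdual (g : M4 -> 'M[R]_4) : einstein_weyl B h aB ->
  (forall x, M x -> g x = pull2 h x + (w x) ^- 2 *: ((th x)^T *m th x)) ->
  selfdual M g.
Proof.
move=> EW gE.
have gF x : M x -> g x = (F x)^T *m F x.
  by move=> Mx; rewrite gE// /pull2 hE ?coframeE//; exact: MB.
apply: (selfdual_coframe oM smooth_coframe dF SW tW aW gF) => x Mx f f'.
have [c1 c2 c3] := conn4_curvature (p x) (a x) (v x).
have H0 := @half_curv x b0 b1 b2 m0 m1 m2 Mx (esym lift_max0) (esym lift_max1)
  (esym lift_max2) (fun q => hor_ver _ _ _ _ _ _) c1 erefl.
have H1 := @half_curv x b1 b2 b0 m1 m2 m0 Mx (esym lift_max1) (esym lift_max2)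
  (esym lift_max0) (fun q => hor_ver _ _ _ _ _ _) c2 erefl.
have H2 := @half_curv x b2 b0 b1 m2 m0 m1 Mx (esym lift_max2) (esym lift_max0)
  (esym lift_max1) (fun q => hor_ver _ _ _ _ _ _) c3 erefl.
have [E1 E2 E3 E4 E5] := einstein_weyl_block oB SE SaB hE dE (MB Mx) EW.
have [D1 D2 D3 D4 D5] := half_curvature_block (p x) (a x) (v x) (A x)
  (fun i => base_block_skew h E aB i (pr x)) E1 E2 E3 E4 E5.
have mE (Y Z : 'M[R]_4) i j : (Y + Z) i j = Y i j + Z i j by rewrite mxE.
rewrite -H0 -H1 -H2 !mE in D1 D2 D3 D4 D5.
apply: frame_weyl_selfdual.
- by move=> *; exact: (frame_curvature_skew12 _ oM SW aW).
- by move=> *; exact: frame_curvature_skew34.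
- by move=> *; exact: (frame_curvature_bianchi oM smooth_coframe dF SW tW aW gF).
- by rewrite -D1 /half_block; ring.
- by rewrite -D2 /half_block; ring.
- by rewrite -D3 /half_block; ring.
- by move: D4; rewrite /half_block => D4; lra.
- by move: D5; rewrite /half_block => D5; lra.
Qed.

End MonopoleMetric.

(** * The minimal Weyl derivative of a conformal submersion *)

Section Entries.
Variables (R : pzRingType) (m n : nat).
Implicit Types A C : 'M[R]_(m, n).

Lemma addmxE A C i j : (A + C) i j = A i j + C i j. Proof. by rewrite mxE. Qed.
Lemma oppmxE A i j : (- A) i j = - A i j. Proof. by rewrite mxE. Qed.
Lemma scalemxE k A i j : (k *: A) i j = k * A i j. Proof. by rewrite mxE. Qed.

End Entries.
Definition entryE := (addmxE, oppmxE, scalemxE).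

Lemma dfunE (R : realType) n (f : 'rV[R]_n.+1 -> R) x i : dfun f x 0 i = partial i f x.
Proof. exact: mxE. Qed.

Lemma vdotE (R : realType) n (q : 'rV[R]_4 -> 'rV[R]_n) x i :
  vdot q x 0 i = partial ord_max (fun y => q y 0 i) x.
Proof. exact: mxE. Qed.

Section HorizontalCalculus.
Variable R : realType.
Local Notation M4 := 'rV[R]_4.
Variables (M : set M4) (th : M4 -> M4).
Hypotheses (oM : open M) (Sth : smooth_row M th).

Lemma smooth_hder i f : smooth M f -> smooth M (hder th i f).
Proof.
move=> Sf; apply: smoothB => //; first exact: smooth_partial.
by apply: smoothM => //; exact: smooth_partial.
Qed.

Variable (x : M4).
Hypothesis Mx : M x.

Lemma hder_ext i (f g : M4 -> R) : (forall y, M y -> f y = g y) ->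
  hder th i f x = hder th i g x.
Proof. by move=> fg; rewrite /hder !(partial_ext _ oM Mx fg). Qed.

Lemma hderD i f g : smooth M f -> smooth M g ->
  hder th i (fun y => f y + g y) x = hder th i f x + hder th i g x.
Proof.
move=> Sf Sg; rewrite /hder !partialD; try exact: smooth_derivable Mx.
move: (partial _ f x) (partial _ g x) (partial ord_max f x) (partial ord_max g x) => a b c d.
by ring.
Qed.

Lemma hderM i f g : smooth M f -> smooth M g ->
  hder th i (fun y => f y * g y) x = f x * hder th i g x + g x * hder th i f x.
Proof.
move=> Sf Sg; rewrite /hder !partialM; try exact: smooth_derivable Mx.
move: (partial _ f x) (partial _ g x) (partial ord_max f x) (partial ord_max g x) => a b c d.
by ring.
Qed.

Lemma partial_hder i f : smooth M f ->
  partial ord_max (hder th i f) x = hder th i (partial ord_max f) x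
    - partial ord_max (fun y => th y 0 (lift ord_max i)) x * partial ord_max f x.
Proof.
move=> Sf; have Sf4 := smooth_partial ord_max Sf.
rewrite {1}/hder partialB; last 2 first.
- by apply: smooth_derivable Mx; exact: smooth_partial.
- by apply: smooth_derivable Mx; exact: smoothM.
rewrite partialM; try exact: smooth_derivable Mx.
rewrite (partial_comm ord_max (lift ord_max i) oM Sf Mx) /hder.
move: (partial _ (partial _ f) x) (partial _ (partial _ f) x) (partial _ f x).
by move: (partial _ _ x) => a b c d; ring.
Qed.

(* The bracket of two horizontal lifts of coordinate fields is vertical. *)
Lemma hder_comm i j f : smooth M f ->
  hder th i (hder th j f) x - hder th j (hder th i f) x
  = - hor_d th th x i j * partial ord_max f x.
Proof.
move=> Sf; have Sf4 := smooth_partial ord_max Sf.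
have E k l : hder th k (hder th l f) x
    = partial (lift ord_max k) (partial (lift ord_max l) f) x
      - th x 0 (lift ord_max l) * partial (lift ord_max k) (partial ord_max f) x
      - partial (lift ord_max k) (fun y => th y 0 (lift ord_max l)) x * partial ord_max f x
      - th x 0 (lift ord_max k) * partial ord_max (hder th l f) x.
  rewrite {1}/hder {1}/hder partialB; last 2 first.
  - by apply: smooth_derivable Mx; exact: smooth_partial.
  - by apply: smooth_derivable Mx; exact: smoothM.
  rewrite partialM; try exact: smooth_derivable Mx.
  move: (partial _ (partial _ f) x) (partial _ (partial _ f) x) (partial _ f x).
  by move: (partial _ _ x) (partial _ _ x) => a b c d e; ring.
have H : hor_d th th x i j = hder th i (fun y => th y 0 (lift ord_max j)) x
    - hder th j (fun y => th y 0 (lift ord_max i)) x by exact: mxE.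
rewrite !E !partial_hder// H (partial_comm (lift ord_max i) (lift ord_max j) oM Sf Mx).
rewrite /hder.
move: (partial (lift ord_max j) (partial (lift ord_max i) f) x) => fij.
move: (partial (lift ord_max i) (partial ord_max f) x) => fi4.
move: (partial (lift ord_max j) (partial ord_max f) x) => fj4.
move: (partial ord_max (partial ord_max f) x) (partial ord_max f x) => f44 f4.
move: (partial ord_max (fun y => th y 0 (lift ord_max j)) x) => a.
move: (partial ord_max (fun y => th y 0 (lift ord_max i)) x) => b.
move: (partial (lift ord_max i) (fun y => th y 0 (lift ord_max j)) x) => c.
move: (partial (lift ord_max j) (fun y => th y 0 (lift ord_max i)) x) => d.
by ring.
Qed.

End HorizontalCalculus.

Section MinimalForm.
Variable R : realType.
Local Notation M4 := 'rV[R]_4.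
Local Notation B3 := 'rV[R]_3.

(* The minimal Weyl derivative of the metric pi^* h + w^-2 th^2. *)
Definition minimal_form (w : M4 -> R) (th : M4 -> M4) (x : M4) : M4 :=
  vdot th x + (w x)^-1 *: (dfun w x - partial ord_max w x *: th x).

Variables (M : set M4) (h E : B3 -> 'M[R]_3) (aB : B3 -> B3)
  (w : M4 -> R) (th : M4 -> M4) (beta : M4 -> B3).
Hypotheses (oM : open M) (Sw : smooth M w) (w0 : forall x, M x -> 0 < w x)
  (Sth : smooth_row M th) (th1 : forall x, M x -> th x 0 ord_max = 1).

Let n0 x : M x -> w x != 0. Proof. by move=> /w0; exact: lt0r_neq0. Qed.

Lemma smooth_minimal_form : smooth_row M (minimal_form w th).
Proof.
apply: smooth_rowD => //; first exact: smooth_vdot.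
apply: smooth_rowZ => //; first exact: smoothV.
apply: smooth_rowD => //; first exact: smooth_dfun.
apply: smooth_rowN => //; apply: smooth_rowZ => //; exact: smooth_partial.
Qed.

Lemma minimal_form_max x : M x -> minimal_form w th x 0 ord_max = 0.
Proof.
move=> Mx; rewrite !entryE vdotE dfunE (partial_ext _ oM Mx th1) partial_cst.
by rewrite th1// mulr1 subrr mulr0 addr0.
Qed.

Lemma minimal_form_lift x i : minimal_form w th x 0 (lift ord_max i) =
  partial ord_max (fun y => th y 0 (lift ord_max i)) x + (w x)^-1 * hder th i w x.
Proof.
by rewrite !entryE vdotE dfunE [partial ord_max w x * _]mulrC.
Qed.

(** Since the bracket of horizontal lifts is vertical, the horizontal part of the
    exterior derivative of the minimal Weyl derivative is w times the derivative of
    the curvature divided by w along the fibres. *)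
Lemma hor_d_minimal_form x i j : M x -> hor_d th (minimal_form w th) x i j
  = partial ord_max (fun y => hor_d th th y i j) x
    - (w x)^-1 * partial ord_max w x * hor_d th th x i j.
Proof.
move=> Mx; have n := n0 Mx.
have Siw : smooth M (fun y => (w y)^-1) by exact: smoothV.
have S4 k : smooth M (partial ord_max (fun y => th y 0 (lift ord_max k))).
  exact: smooth_partial.
have Sh k : smooth M (hder th k w) by exact: smooth_hder.
have L k l : hder th k (fun y => minimal_form w th y 0 (lift ord_max l)) x
   = hder th k (partial ord_max (fun y => th y 0 (lift ord_max l))) x
     + ((w x)^-1 * hder th k (hder th l w) x + hder th l w x * hder th k (fun y => (w y)^-1) x).
  rewrite (@hder_ext _ _ th oM x Mx k _ (fun y =>
    partial ord_max (fun y => th y 0 (lift ord_max l)) y + (w y)^-1 * hder th l w y)).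
    rewrite (hderD th Mx)//; last exact: smoothM.
    by rewrite (hderM th Mx).
  by move=> y _; exact: minimal_form_lift.
have V k : hder th k (fun y => (w y)^-1) x = - ((w x)^-1 ^+ 2) * hder th k w x.
  rewrite /hder !partialV//; try exact: smooth_derivable Mx.
  by rewrite -exprVn; move: (partial _ w x) (partial _ w x) => a b; ring.
have H y k l : hor_d th th y k l = hder th k (fun y => th y 0 (lift ord_max l)) y
    - hder th l (fun y => th y 0 (lift ord_max k)) y by exact: mxE.
rewrite [LHS]mxE !L !V.
have -> : partial ord_max (fun y => hor_d th th y i j) x
   = hder th i (partial ord_max (fun y => th y 0 (lift ord_max j))) x
     - hder th j (partial ord_max (fun y => th y 0 (lift ord_max i))) x.
  under [X in partial _ X]eq_fun do rewrite H.
  rewrite partialB; last 2 first.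
  - by apply: smooth_derivable Mx; exact: smooth_hder.
  - by apply: smooth_derivable Mx; exact: smooth_hder.
  rewrite !(partial_hder oM Sth Mx)//.
  move: (hder _ _ _ x) (hder _ _ _ x) (partial _ _ x) (partial _ _ x) => a b c d.
  by ring.
have := hder_comm oM Sth Mx i j Sw.
move: (hder th i (hder _ _ _) x) (hder th j (hder _ _ _) x) => a b /eqP.
rewrite subr_eq => /eqP ->.
move: (hor_d th th x i j) (hder _ _ _ x) (hder _ _ _ x) (hder _ _ _ x) (hder _ _ _ x).
by move: (partial _ _ x) (w x)^-1 => e1 e2 e3 e4 e5 e6 e7; ring.
Qed.

Hypotheses (Sbeta : smooth_row M beta)
  (hE : forall x, M x -> h (pr x) = (E (pr x))^T *m E (pr x))
  (dE : forall x, M x -> 0 < \det (E (pr x)))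
  (monopole : forall x, M x -> star1 (h (pr x)) (beta x) = hor_d th th x)
  (betaE : forall x, M x -> beta x *m (dpr R)^T = w x *: (minimal_form w th x - pull1 aB x)).

Let eta x : B3 := (w x)^-1 *: (vdot beta x - ((w x)^-1 * partial ord_max w x) *: beta x).

Lemma vdot_minimal_form x : M x -> vdot (minimal_form w th) x = eta x *m (dpr R)^T.
Proof.
move=> Mx; have n := n0 Mx.
apply/rowP => i; rewrite [LHS]mxE; case: (unliftP ord_max i) => [k ->|->]; last first.
  by rewrite (partial_ext _ oM Mx minimal_form_max) partial_cst max_dpr.
rewrite lift_dpr.
have mb y : M y -> minimal_form w th y 0 (lift ord_max k)
   = aB (pr y) 0 k + (w y)^-1 * beta y 0 k.
  move=> My; rewrite -[beta y 0 k]lift_dpr betaE// scalemxE mulrA mulVf ?n0//.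
  rewrite mul1r [(_ - pull1 _ _) _ _]addmxE oppmxE -[aB (pr y) 0 k]lift_dpr -/(pull1 aB y).
  by rewrite addrC subrK.
rewrite (partial_ext _ oM Mx mb).
have Siw : smooth M (fun y => (w y)^-1) by exact: smoothV.
have -> : partial ord_max (fun y => aB (pr y) 0 k + (w y)^-1 * beta y 0 k) x
    = partial ord_max (fun y => (w y)^-1 * beta y 0 k) x.
  rewrite (@partial_max_ext _ _ (fun y => aB (pr x) 0 k + (w y)^-1 * beta y 0 k)).
    rewrite partialD; first by rewrite partial_cst add0r.
      exact: derivable_cst.
    by apply: smooth_derivable Mx; exact: smoothM.
  by move=> y ->.
rewrite partialM; try exact: smooth_derivable Mx.
rewrite partialV//; last exact: smooth_derivable Mx.
rewrite -exprVn !entryE vdotE.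
by move: (partial _ _ x) (partial _ _ x) (beta x 0 k) => a b c; ring.
Qed.

(** The Faraday curvature is selfdual: its vertical and horizontal parts are both
    determined by the vertical derivative of beta / w. *)
Theorem faraday_selfdual x : M x ->
  star2 (pull2 h x + (w x) ^- 2 *: ((th x)^T *m th x)) (dform (minimal_form w th) x)
  = dform (minimal_form w th) x.
Proof.
move=> Mx; have n := n0 Mx.
have -> : dform (minimal_form w th) x = wedge (th x) (eta x *m (dpr R)^T)
    + dpr R *m star1 (h (pr x)) (w x *: eta x) *m (dpr R)^T.
  rewrite (dform_split (th1 Mx)); last first.
    by move=> i; rewrite (partial_ext _ oM Mx minimal_form_max) partial_cst.
  rewrite vdot_minimal_form//; congr (_ + dpr R *m _ *m _); apply/matrixP => i j.
  have etaE : w x *: eta x = vdot beta x + (- ((w x)^-1 * partial ord_max w x)) *: beta x.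
    by rewrite /eta scalerA mulfV// scale1r scaleNr.
  rewrite hor_d_minimal_form// etaE star1D star1Z monopole//.
  rewrite !entryE -(partial_star1 h i j oM Mx Sbeta) mulNr.
  by congr (_ - _); apply: (partial_ext _ oM Mx) => y My; rewrite monopole.
by rewrite /pull2 hE//; apply: selfdual_split; [exact: dE|exact: w0|exact: th1].
Qed.

End MinimalForm.

Lemma outerE (R : pzRingType) m n (p : 'rV[R]_m) (q : 'rV[R]_n) i j :
  (p^T *m q) i j = p 0 i * q 0 j.
Proof. by rewrite mxE big_ord1 mxE. Qed.

Lemma mulmx_fibT (R : realType) m (A : 'M[R]_(m, 4)) i j :
  (A *m (fib R)^T) i j = A i ord_max.
Proof.
rewrite mxE (bigD1 ord_max)//= big1 => [|l ne]; last by rewrite !mxE (negbTE ne) andbF mulr0.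
by rewrite (ord1 j) !mxE !eqxx mulr1 addr0.
Qed.

Section Submersion.
Variable R : realType.
Local Notation M4 := 'rV[R]_4.
Local Notation B3 := 'rV[R]_3.
Variables (M : set M4) (h E : B3 -> 'M[R]_3) (g : M4 -> 'M[R]_4)
  (lam w : M4 -> R) (th : M4 -> M4).
Hypotheses (oM : open M) (Sh : smooth_mx M (pull2 h))
  (Slam : smooth M lam) (lam0 : forall x, M x -> 0 < lam x)
  (Sw : smooth M w) (w0 : forall x, M x -> 0 < w x)
  (Sth : smooth_row M th) (th1 : forall x, M x -> th x 0 ord_max = 1)
  (hE : forall x, M x -> h (pr x) = (E (pr x))^T *m E (pr x))
  (dE : forall x, M x -> 0 < \det (E (pr x)))
  (gE : forall x, M x -> g x = lam x *: (pull2 h x + (w x) ^- 2 *: ((th x)^T *m th x))).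

(* The squared length of the fibre coordinate vector. *)
Let k x := lam x * (w x) ^- 2.

Let k0 x : M x -> 0 < k x.
Proof. by move=> Mx; rewrite mulr_gt0 ?lam0// invr_gt0 exprn_gt0// w0. Qed.

Let nk x : M x -> k x != 0. Proof. by move=> /k0; exact: lt0r_neq0. Qed.
Let nw x : M x -> w x != 0. Proof. by move=> /w0; exact: lt0r_neq0. Qed.
Let nlam x : M x -> lam x != 0. Proof. by move=> /lam0; exact: lt0r_neq0. Qed.

Let Sk : smooth M k.
Proof.
apply: smoothM => //; apply: smoothV => //; first by move=> x Mx; rewrite expf_neq0 ?nw.
exact: smoothX.
Qed.

Lemma submersion_coframe x : M x ->
  exists F : 'M[R]_4, 0 < \det F /\ g x = lam x *: (F^T *m F).
Proof.
move=> Mx; exists (coframe (E (pr x)) ((w x)^-1 *: th x)); split.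
  by apply: det_coframe_gt0; [exact: dE|exact: w0|exact: th1].
by rewrite gE// /pull2 hE// coframeE.
Qed.

Lemma submersion_sym x : M x -> (g x)^T = g x.
Proof.
by move=> /submersion_coframe[F [_ ->]]; rewrite trmxZ trmx_mul trmxK.
Qed.

Lemma submersion_unit x : M x -> g x \in unitmx.
Proof.
move=> Mx; have [F [F0 ->]] := submersion_coframe Mx.
rewrite unitmxZ ?unitfE ?nlam// unitmx_mul unitmx_tr andbb.
by rewrite unitmxE unitfE gt_eqF.
Qed.

Lemma submersion_pos x X : M x -> X != 0 -> 0 < ip (g x) X X.
Proof.
move=> Mx X0; have [F [F0 ->]] := submersion_coframe Mx.
have uF : F \in unitmx by rewrite unitmxE unitfE gt_eqF.
have Y0 : X *m F^T != 0.
  have uFT : F^T \in unitmx by rewrite unitmx_tr.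
  by apply: contra X0 => /eqP Y; rewrite -(mulmxK uFT X) Y mul0mx.
have -> : ip (lam x *: (F^T *m F)) X X = lam x * \sum_i ((X *m F^T) 0 i) ^+ 2.
  rewrite /ip -scalemxAr -scalemxAl [LHS]mxE -mulmxA; congr (_ * _).
  rewrite -mulmxA mulmxA -[F *m X^T]trmxK trmx_mul !trmxK mxE.
  by apply: eq_bigr => i _; rewrite [_^T i 0]mxE expr2.
rewrite mulr_gt0 ?lam0// lt_neqAle sumr_ge0 ?andbT; last by move=> i _; exact: sqr_ge0.
rewrite eq_sym psumr_eq0; last by move=> i _; exact: sqr_ge0.
apply: contra Y0 => /allP Y; apply/eqP/rowP => i; rewrite [RHS]mxE; apply/eqP.
by have := Y i (mem_index_enum _); rewrite /= sqrf_eq0.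
Qed.

Lemma smooth_submersion : smooth_mx M g.
Proof.
move=> i j; apply: (@smooth_ext _ _ M (fun y => lam y * pull2 h y i j + k y * (th y 0 i * th y 0 j))) => //.
  move=> y My; rewrite gE// !entryE outerE mulrDr !mulrA; congr (_ + _ * _ * _).
apply: smoothD => //; apply: smoothM => //; exact: smoothM.
Qed.

Lemma pull2_fib x : fib R *m pull2 h x = 0.
Proof. by rewrite /pull2 !mulmxA fib_dpr !mul0mx. Qed.

Lemma fib_submersion x : M x -> fib R *m g x = k x *: th x.
Proof.
move=> Mx; rewrite gE// -scalemxAr mulmxDr pull2_fib add0r -scalemxAr scalerA; congr (_ *: _).
by apply/rowP => i; rewrite -rowE mxE outerE th1// mul1r.
Qed.

Lemma submersion_max x i : M x -> g x ord_max i = k x * th x 0 i.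
Proof. by move=> Mx; rewrite -scalemxE -fib_submersion// -rowE mxE. Qed.

Lemma submersion_max2 x : M x -> g x ord_max ord_max = k x.
Proof. by move=> Mx; rewrite submersion_max// th1// mulr1. Qed.

Lemma ip_fib x : M x -> ip (g x) (fib R) (fib R) = k x.
Proof.
by move=> Mx; rewrite /ip fib_submersion// -scalemxAl scalemxE mulmx_fibT th1// mulr1.
Qed.

Lemma xiE x : M x -> xi g x = (Num.sqrt (k x))^-1 *: fib R.
Proof. by move=> Mx; rewrite /xi ip_fib. Qed.

Lemma submersion_length_scale x : M x -> length_scale g lam x = w x.
Proof.
move=> Mx; rewrite /length_scale ip_fib// /k sqrtrM ?ltW ?lam0// -exprVn.
rewrite sqrtr_sqr gtr0_norm ?invr_gt0 ?w0// invfM invrK mulrA mulfV ?mul1r//.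
by rewrite gt_eqF// sqrtr_gt0 lam0.
Qed.

Section MinimalWeyl.
Variables (a : M4 -> M4) (x : M4).
Hypothesis Mx : M x.

Let y4 z := (Num.sqrt (k z))^-1.
Let C := conn_mx (christoffel g a) ord_max x.

Let y4n : y4 x != 0.
Proof. by rewrite invr_eq0 gt_eqF// sqrtr_gt0 k0. Qed.

Let d_y4 : partial ord_max y4 x = - (2^-1 * y4 x * ((k x)^-1 * partial ord_max k x)).
Proof.
have [D E1] := smooth_sqrt_partial ord_max oM k0 Sk Mx.
rewrite /y4 partialV//; last by rewrite gt_eqF// sqrtr_gt0 k0.
rewrite E1 sqr_sqrtr ?ltW ?k0//; move: (partial _ k x) (Num.sqrt (k x))^-1 => p q.
by ring.
Qed.

Let xi_entry i : partial i (fun y => xi g y 0 ord_max) x = partial i y4 x.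
Proof.
by apply: (partial_ext _ oM Mx) => y My; rewrite xiE// scalemxE !mxE !eqxx mulr1.
Qed.

Let xi_entry0 i j : partial i (fun y => xi g y 0 (lift ord_max j)) x = 0.
Proof.
rewrite (@partial_ext _ _ M _ (fun=> 0) x i oM Mx) ?partial_cst// => y My.
by rewrite xiE// scalemxE !mxE eqxx /= eq_sym (negbTE (neq_lift _ _)) mulr0.
Qed.

Let DxiE i l : Dxi g a x i l = (partial i y4 x - a x 0 i * y4 x) * fib R 0 l
  + y4 x * christoffel g a x l i ord_max.
Proof.
rewrite [LHS]mxE xiE//.
have -> : \sum_j christoffel g a x l i j * (y4 x *: fib R) 0 j
    = y4 x * christoffel g a x l i ord_max.
  rewrite (bigD1 ord_max)//= big1 => [|j ne]; last first.
    by rewrite scalemxE !mxE /= (negbTE ne) !mulr0.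
  by rewrite scalemxE !mxE !eqxx /= mulr1 addr0 mulrC.
have -> : partial i (fun y => xi g y 0 l) x = partial i y4 x * fib R 0 l.
  case: (unliftP ord_max l) => [j ->|->]; last by rewrite xi_entry mxE !eqxx mulr1.
  by rewrite xi_entry0 mxE /= eq_sym (negbTE (neq_lift _ _)) mulr0.
rewrite scalemxE -/(y4 x); move: (christoffel _ _ _ _ _ _) (partial _ _ _) (fib R 0 l) => c d e.
by ring.
Qed.

Let gT := submersion_sym.
Let gV := submersion_unit.

Let lower m : (g x *m C) m ord_max = k x * partial ord_max (fun y => th y 0 m) x
  + th x 0 m * partial ord_max k x + 2 * a x 0 ord_max * (k x * th x 0 m)
  - 2^-1 * partial m k x - a x 0 m * k x.
Proof.
rewrite (christoffel_lower _ gV)//.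
have -> : partial ord_max (fun y => g y ord_max m) x
   = k x * partial ord_max (fun y => th y 0 m) x + th x 0 m * partial ord_max k x.
  rewrite (partial_ext ord_max oM Mx (g := fun y => k y * th y 0 m)).
    by rewrite partialM//; exact: smooth_derivable Mx.
  by move=> y My; exact: submersion_max.
rewrite (partial_ext m oM Mx submersion_max2) submersion_max2// submersion_max//.
move: (partial _ _ x) (partial _ _ x) (partial _ _ x) => p q r.
by field.
Qed.

Let row_Dxi m : (fib R *m Dxi g a x *m g x) 0 m = y4 x * (k x * 
   (2^-1 * ((k x)^-1 * partial ord_max k x) * th x 0 m
    + partial ord_max (fun y => th y 0 m) x + a x 0 ord_max * th x 0 m
    - 2^-1 * ((k x)^-1 * partial m k x) - a x 0 m)).
Proof.
have -> : fib R *m Dxi g a x = (partial ord_max y4 x - a x 0 ord_max * y4 x) *: fib R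
    + y4 x *: (C *m (fib R)^T)^T.
  apply/rowP => l; rewrite -rowE mxE DxiE !entryE; congr (_ + _ * _).
  by rewrite [RHS]mxE mulmx_fibT mxE.
have gC : (C *m (fib R)^T)^T *m g x = (g x *m C *m (fib R)^T)^T.
  by rewrite -[g x *m C *m _]mulmxA [RHS]trmx_mul gT.
rewrite mulmxDl -!scalemxAl fib_submersion// gC !entryE.
have -> : ((g x *m C *m (fib R)^T)^T) 0 m = (g x *m C) m ord_max.
  by rewrite [LHS]mxE mulmx_fibT.
rewrite lower d_y4; have := nk Mx.
by move: (partial _ k x) (partial _ _ x) (partial _ _ x) (y4 x) => p q r s n; field.
Qed.

Let d_g : dmx ord_max g x = ((lam x)^-1 * partial ord_max lam x) *: g x
  + (partial ord_max k x - k x * ((lam x)^-1 * partial ord_max lam x)) *: ((th x)^T *m th x)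
  + k x *: ((vdot th x)^T *m th x + (th x)^T *m vdot th x).
Proof.
have gE' y : M y -> g y = lam y *: pull2 h y + k y *: ((th y)^T *m th y).
  by move=> My; rewrite gE// scalerDr scalerA.
apply/matrixP => i j; rewrite [LHS]mxE gE'// !entryE !outerE !vdotE.
rewrite (partial_ext ord_max oM Mx (g := fun y => lam y * pull2 h y i j + k y * (th y 0 i * th y 0 j))); last first.
  by move=> y My; rewrite gE'// !entryE outerE.
have Stt : smooth M (fun y => th y 0 i * th y 0 j) by exact: smoothM.
have H0 : partial ord_max (fun y => pull2 h y i j) x = 0.
  rewrite (@partial_max_ext _ _ (fun=> pull2 h x i j)) ?partial_cst//.
  by move=> y yx; rewrite /pull2 yx.
have D1 : partial ord_max (fun y => lam y * pull2 h y i j) x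
    = pull2 h x i j * partial ord_max lam x.
  by rewrite partialM ?H0 ?mulr0 ?add0r//; exact: smooth_derivable Mx.
have D2 : partial ord_max (fun y => th y 0 i * th y 0 j) x = th x 0 i *
    partial ord_max (fun y => th y 0 j) x + th x 0 j * partial ord_max (fun y => th y 0 i) x.
  by apply: partialM; exact: smooth_derivable Mx.
have D3 : partial ord_max (fun y => k y * (th y 0 i * th y 0 j)) x = k x *
    partial ord_max (fun y => th y 0 i * th y 0 j) x + th x 0 i * th x 0 j * partial ord_max k x.
  by apply: partialM; exact: smooth_derivable Mx.
rewrite partialD; try by apply: smooth_derivable Mx; exact: smoothM.
rewrite D1 D3 D2; have := nlam Mx; move: (pull2 h x i j) (partial _ lam x) (partial _ k x) (k x) => H p q kx.
by move: (partial _ _ x) (partial _ _ x) => r s n1; field.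
Qed.

Let trace_C : \tr C = 2^-1 * (3 * ((lam x)^-1 * partial ord_max lam x)
    + (k x)^-1 * partial ord_max k x) + 4 * a x 0 ord_max.
Proof.
have ug := gV Mx.
have E1 : \tr C + \tr C = \tr (invmx (g x) *m dmx ord_max g x) + 8 * a x 0 ord_max.
  have := congr1 (fun A => \tr (invmx (g x) *m A)) (christoffel_metric a oM gT gV ord_max Mx).
  rewrite -/C mulmxDr mulKmx// trmx_mul (gT Mx) mxtraceD [\tr (_ *m (_ *m _))]mxtrace_mulC.
  rewrite mulmxK// mxtrace_tr => ->; rewrite mulmxDr mxtraceD -scalemxAr mulVmx// mxtraceZ mxtrace1.
  by congr (_ + _); rewrite mulrAC -natrM.
have gth : invmx (g x) *m (th x)^T = (k x)^-1 *: (fib R)^T.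
  apply: (can_inj (mulKmx ug)); rewrite mulKVmx// -scalemxAr.
  rewrite -[g x](gT Mx) -trmx_mul fib_submersion// trmxZ scalerA mulVf ?nk//.
  by rewrite scale1r.
have tr1 (p : M4) : \tr (invmx (g x) *m ((th x)^T *m p)) = (k x)^-1 * p 0 ord_max.
  rewrite mulmxA gth -scalemxAl mxtraceZ mxtrace_mulC; congr (_ * _).
  by rewrite /mxtrace big_ord1 -[p]trmxK -trmx_mul trmxK mxE -rowE !mxE.
have tr2 (p : M4) : \tr (invmx (g x) *m (p^T *m th x)) = (k x)^-1 * p 0 ord_max.
  rewrite -tr1 -[LHS]mxtrace_tr !trmx_mul trmxK mxtrace_mulC trmx_inv (gT Mx).
  by rewrite mulmxA.
have thd : vdot th x 0 ord_max = 0 by rewrite vdotE (partial_ext _ oM Mx th1) partial_cst.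
move: E1; rewrite d_g !mulmxDr -!scalemxAr mulmxDr mulVmx// !mxtraceD !mxtraceZ mxtraceD tr1 tr1 tr2.
rewrite thd th1// mxtrace1; have := nk Mx; have := nlam Mx.
move: (\tr C) (partial _ lam x) (partial _ k x) => c p q n1 n2 E1.
have -> : c = 2^-1 * (c + c) by field.
by rewrite E1; field; rewrite n1 n2.
Qed.

Let trace_Dxi : \tr (Dxi g a x) =
  y4 x * (3 / 2 * ((lam x)^-1 * partial ord_max lam x) + 3 * a x 0 ord_max).
Proof.
have -> : \tr (Dxi g a x) = partial ord_max y4 x - a x 0 ord_max * y4 x + y4 x * \tr C.
  rewrite /mxtrace mulr_sumr; under eq_bigr do rewrite DxiE.
  rewrite big_split/=; congr (_ + _).
    rewrite (bigD1 ord_max)//= big1 => [|j ne]; last by rewrite !mxE /= (negbTE ne) mulr0.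
    by rewrite !mxE !eqxx /= mulr1 addr0.
  by apply: eq_bigr => i _; rewrite mxE (christoffel_sym a oM gT).
rewrite trace_C d_y4.
by move: ((lam x)^-1 * _) ((k x)^-1 * _) (y4 x) => p q s; field.
Qed.

(** The two conditions on the minimal Weyl derivative determine its 1-form: the
    trace gives the vertical component, and then the covariant derivative of xi
    along itself gives the horizontal ones. *)
Lemma minimal_weylP : xi g x *m Dxi g a x = 0 /\ \tr (Dxi g a x) = 0 <->
  a x = minimal_form w th x - (2 * lam x)^-1 *: dfun lam x.
Proof.
pose A m := 2^-1 * ((k x)^-1 * partial ord_max k x) * th x 0 m
    + partial ord_max (fun y => th y 0 m) x - 2^-1 * ((lam x)^-1 * partial ord_max lam x) * th x 0 m
    - 2^-1 * ((k x)^-1 * partial m k x).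
have AE m : (minimal_form w th x - (2 * lam x)^-1 *: dfun lam x) 0 m = A m.
  have dk i : (k x)^-1 * partial i k x = (lam x)^-1 * partial i lam x
      - 2 * ((w x)^-1 * partial i w x).
    rewrite /k partialM; [|exact: smooth_derivable Mx|]; last first.
      apply: (smooth_derivable (U := M)) => //; apply: smoothV => //; last exact: smoothX.
      by move=> y My; rewrite expf_neq0 ?nw.
    rewrite partialV ?expf_neq0 ?nw//; last by apply: (smooth_derivable (U := M)) => //; exact: smoothX.
    have -> : partial i (fun y => w y ^+ 2) x = 2 * w x * partial i w x.
      rewrite (_ : (fun y => _) = fun y => w y * w y); last by apply/funext => y; rewrite expr2.
      rewrite partialM; try exact: smooth_derivable Mx.
      by move: (partial i w x) => p; ring.
    have := nw Mx; have := nlam Mx.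
    by move: (partial i w x) (partial i lam x) => p q n1 n2; field; rewrite n1 n2.
  rewrite /A !dk !entryE vdotE !dfunE.
  have := nw Mx; have := nlam Mx.
  move: (partial _ _ x) (partial _ _ x) (partial _ _ x) (partial _ _ x) (partial _ _ x).
  by move=> p q r s t n1 n2; field; rewrite n1 n2.
have Amax : A ord_max = - (2^-1 * ((lam x)^-1 * partial ord_max lam x)).
  rewrite /A th1// (partial_ext _ oM Mx th1) partial_cst.
  by move: (partial _ lam x) (partial _ k x) => p q; ring.
have s0 : xi g x *m Dxi g a x = 0 <-> fib R *m Dxi g a x *m g x = 0.
  rewrite xiE// -scalemxAl; split=> [/eqP|H].
    by rewrite scaler_eq0 (negbTE y4n) /= => /eqP ->; rewrite mul0mx.
  by rewrite -[fib R *m _](mulmxK (gV Mx)) H mul0mx scaler0.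
rewrite s0; split=> [[H1 H2]|H].
  have a4 : a x 0 ord_max = A ord_max.
    move: H2; rewrite trace_Dxi Amax => /eqP; rewrite mulf_eq0 (negbTE y4n) /= => /eqP.
    by move: ((lam x)^-1 * _) => p H; lra.
  apply/rowP => m; rewrite AE; have /rowP/(_ m) := H1; rewrite row_Dxi [RHS]mxE => /eqP.
  rewrite mulf_eq0 (negbTE y4n) /= mulf_eq0 (negbTE (nk Mx)) /= subr_eq0 => /eqP <-.
  rewrite a4 Amax /A; move: (partial _ _ x) (partial _ _ x) (partial _ _ x) (partial _ _ x) => p q r s.
  by ring.
have aE m : a x 0 m = A m by rewrite H AE.
split; last first.
  by rewrite trace_Dxi aE Amax; move: ((lam x)^-1 * _) => p; field.
apply/rowP => m; rewrite row_Dxi [RHS]mxE !aE Amax /A.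
move: (partial _ _ x) (partial _ _ x) (partial _ _ x) (partial _ _ x) => p q r s.
by ring.
Qed.

End MinimalWeyl.

(** The horizontal part of d xi is a multiple of the curvature of the horizontal
    distribution, and the contraction with xi only sees its star. *)
Lemma omegaE beta x : M x -> star1 (h (pr x)) beta = hor_d th th x ->
  omega g x = - ((w x)^-1 *: (beta *m (dpr R)^T)).
Proof.
move=> Mx bE; have s0 : 0 < Num.sqrt (k x) by rewrite sqrtr_gt0 k0.
have Ss : smooth M (fun y => Num.sqrt (k y)) by apply: smooth_sqrt.
rewrite /omega xiE//; congr (- _).
rewrite (dform_ext oM Mx (q := fun y => Num.sqrt (k y) *: th y)); last first.
  move=> y My; rewrite /xi_flat xiE// -scalemxAl fib_submersion// scalerA.
  have sy : Num.sqrt (k y) != 0 by rewrite gt_eqF// sqrtr_gt0 k0.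
  by rewrite -[X in _ * X](sqr_sqrtr (ltW (k0 My))) expr2 mulKf.
rewrite (dformZ Mx Ss Sth) (dform_split (th1 Mx)); last first.
  by move=> i; rewrite (partial_ext _ oM Mx th1) partial_cst.
have -> : wedge (dfun (fun y => Num.sqrt (k y)) x) (th x) + Num.sqrt (k x) *:
    (wedge (th x) (vdot th x) + dpr R *m hor_d th th x *m (dpr R)^T)
  = wedge (th x) (Num.sqrt (k x) *: vdot th x - dfun (fun y => Num.sqrt (k y)) x)
    + dpr R *m star1 (h (pr x)) (Num.sqrt (k x) *: beta) *m (dpr R)^T.
  rewrite star1Z bE -scalemxAr -scalemxAl.
  move: (dfun _ x) (vdot th x) (_ *m hor_d _ _ _ *m _) (Num.sqrt (k x)) => p q X s.
  by apply/matrixP => i j; rewrite !mxE; ring.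
rewrite gE// /pull2 hE// -scalemxAl vertical_star ?lam0 ?w0 ?th1 ?dE//.
by rewrite -!scalemxAl !scalerA mulrAC mulVf ?mul1r// gt_eqF.
Qed.

Lemma horizontalP x : M x -> forall X, horizontal (g x) X <-> X *m (th x)^T = 0.
Proof.
move=> Mx X; have ipE U : vertical U -> ip (g x) X U = U 0 ord_max * (k x * (X *m (th x)^T) 0 0).
  move=> vU; have -> : U = U 0 ord_max *: fib R.
    apply: row4P; rewrite ?prZ ?pr_fib ?scaler0//.
    by rewrite !mxE !eqxx /= mulr1.
  rewrite /ip trmxZ -scalemxAr -mulmxA -[g x](submersion_sym Mx) -trmx_mul fib_submersion//.
  by rewrite trmxZ -scalemxAr !scalemxE !mxE !eqxx /= mulr1.
split=> [H|H U vU]; last by rewrite ipE// H mxE !mulr0.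
have vf : vertical (fib R) by exact: fib_dpr.
apply/rowP => j; rewrite ord1 [RHS]mxE; apply/eqP.
have := H _ vf; rewrite ipE// => /eqP; rewrite [fib R 0 _]mxE !eqxx /= mul1r mulf_eq0.
by rewrite (negbTE (nk Mx)).
Qed.

Lemma ip_horizontal x X Y : M x -> horizontal (g x) X -> horizontal (g x) Y ->
  ip (g x) X Y = lam x * ip (h (pr x)) (X *m dpr R) (Y *m dpr R).
Proof.
move=> Mx /(horizontalP Mx) HX _; rewrite /ip gE// -scalemxAr -scalemxAl scalemxE; congr (_ * _).
rewrite mulmxDr -scalemxAr [X *m (_^T *m _)]mulmxA HX mul0mx scaler0 addr0 /pull2 trmx_mul !mulmxA.
by [].
Qed.

End Submersion.

(** * Projective structures on the fibres *)

Section OneVariable.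
Variable R : realType.
Implicit Types (J : set R) (f g tau : R -> R) (s : R).

Lemma is_derive_eq_on J f g s (a b : R) : open J -> J s ->
  (forall r, J r -> f r = g r) -> is_derive s 1 f a -> is_derive s 1 g b -> a = b.
Proof.
move=> oJ Js fg df dg; have fg' : \near s, f s = g s.
  by apply: filterS (open_nbhs_nbhs (conj oJ Js)) => r /fg.
have dg' := near_eq_is_derive fg' df.
by rewrite -(@derive_val _ _ _ _ _ _ _ dg') -(@derive_val _ _ _ _ _ _ _ dg).
Qed.

Lemma deriveDE f g s (a b : R) : is_derive s 1 f a -> is_derive s 1 g b ->
  is_derive s 1 (fun r => f r + g r) (a + b).
Proof. by move=> df dg; exact: is_deriveD. Qed.

Lemma deriveBE f g s (a b : R) : is_derive s 1 f a -> is_derive s 1 g b ->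
  is_derive s 1 (fun r => f r - g r) (a - b).
Proof. by move=> df dg; exact: is_deriveB. Qed.

Lemma deriveME f g s (a b : R) : is_derive s 1 f a -> is_derive s 1 g b ->
  is_derive s 1 (fun r => f r * g r) (f s * b + g s * a).
Proof. by move=> df dg; exact: is_deriveM. Qed.

Lemma deriveVE f s (a : R) : f s != 0 -> is_derive s 1 f a ->
  is_derive s 1 (fun r => (f r)^-1) (- (f s ^- 2 * a)).
Proof. by move=> f0 df; have := is_deriveV f0 df; rewrite scaleNr. Qed.

Lemma deriveCE (c : R) s : is_derive s 1 (fun=> c) (0 : R).
Proof. exact: is_derive_cst. Qed.

Lemma derive1n_is_derive J tau k s : smooth1 J tau -> J s ->
  is_derive s 1 (derive1n k tau) (derive1n k.+1 tau s).
Proof.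
by move=> St Js; rewrite derive1nS derive1E; apply/derivableP; exact: St.
Qed.

Lemma smooth1_cst J (c : R) : smooth1 J (fun=> c).
Proof.
move=> k s _; suff [d ->] : exists d : R, derive1n k (fun=> c) = (fun=> d) by exact: derivable_cst.
elim: k => [|k [d IH]]; first by exists c.
by exists 0; apply/funext => r; rewrite derive1nS IH derive1_cst.
Qed.

(** Applied to the constant 1, the defining property of a projective coordinate
    says that tau'^(-1/2) solves the equation of the projective structure. *)
Lemma schwarzian rho J tau s : open J -> projective_coordinate rho J tau -> J s ->
  rho s = derive1n 3 tau s / derive1n 1 tau s
          - 3 / 2 * (derive1n 2 tau s / derive1n 1 tau s) ^+ 2.
Proof.
move=> oJ [St p0 H] Js.
have dp k r := @derive1n_is_derive J tau k r St.
pose p := derive1n 1 tau; pose p1 := derive1n 2 tau; pose p2 := derive1n 3 tau.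
have pp r : J r -> 0 < p r by exact: p0.
have sp r : J r -> Num.sqrt (p r) != 0 by move=> /pp Jr; rewrite gt_eqF// sqrtr_gt0.
have dsq r : J r -> is_derive r 1 (fun r => Num.sqrt (p r)) ((2 * Num.sqrt (p r))^-1 * p1 r).
  by move=> Jr; apply: is_derive1_comp; [exact: is_derive1_sqrt (pp r Jr)|exact: dp].
pose f r := (Num.sqrt (p r))^-1.
pose f1 r := - (2^-1 * (f r * (p1 r * (p r)^-1))).
have df r : J r -> is_derive r 1 f (f1 r).
  move=> Jr; have := @deriveVE (fun r => Num.sqrt (p r)) r _ (sp r Jr) (dsq r Jr).
  congr (is_derive _ _ _ _); rewrite /f1 sqr_sqrtr ?ltW ?pp// /f invfM.
  by move: (Num.sqrt _)^-1 (p r)^-1 (p1 r) => a b c; ring.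
have df1 : is_derive s 1 f1 (- (2^-1 * (f s * (p1 s * - (p s ^- 2 * p1 s) + (p s)^-1 * p2 s)
    + p1 s * (p s)^-1 * f1 s))).
  have n := lt0r_neq0 (pp s Js).
  have d0 := deriveVE n (dp 1%N s Js).
  have d1 := deriveME (dp 2%N s Js) d0.
  have d2 := deriveME (df s Js) d1.
  have d3 := deriveME (deriveCE 2^-1 s) d2.
  have d4 := deriveBE (deriveCE 0 s) d3.
  have := d4; rewrite sub0r mulr0 addr0 (_ : (fun r => _) = f1); first by [].
  by apply/funext => r; rewrite sub0r.
have := H (fun=> 1 : R) (@smooth1_cst setT 1) s Js; rewrite /projective_operator.
rewrite (_ : derive1n 2 (fun=> 1 : R) (tau s) = 0); last first.
  rewrite /derive1n /= (_ : derive1 (fun=> 1 : R) = fun=> 0) ?derive1_cst//.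
  by apply/funext => r; rewrite derive1_cst.
rewrite mul0r (_ : (fun r => _) = f); last first.
  by apply/funext => r; rewrite div1r.
have -> : derive1n 2 f s = - (2^-1 * (f s * (p1 s * - (p s ^- 2 * p1 s) + (p s)^-1 * p2 s)
    + p1 s * (p s)^-1 * f1 s)).
  rewrite derive1nS derive1E.
  have fE : \near s, f1 s = derive1n 1 f s.
    apply: filterS (open_nbhs_nbhs (conj oJ Js)) => r Jr; rewrite derive1n1 derive1E.
    by rewrite (@derive_val _ _ _ _ _ _ _ (df r Jr)).
  have d := near_eq_is_derive fE df1.
  by rewrite (@derive_val _ _ _ _ _ _ _ d).
have -> : 1 / Num.sqrt (derive1 tau s) = f s by rewrite div1r.
rewrite -/p -/p1 -/p2 /f1.
have f0 : f s != 0 by rewrite invr_neq0// sp.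
have n := lt0r_neq0 (pp s Js).
move: (f s : R) (p s : R) (p1 s : R) (p2 s : R) (rho s) f0 n => F P P1 P2 r F0 n E.
have : F * (r - (P2 / P - 3 / 2 * (P1 / P) ^+ 2)) = 0.
  by rewrite -[RHS](mulr0 2) -E; field.
by move/eqP; rewrite mulf_eq0 (negbTE F0) /= subr_eq0 => /eqP.
Qed.

(** Projective vector fields u d/ds are the solutions of a third order linear
    equation, the second symmetric power of the equation of the structure. *)
Lemma projective_ode rho J tau (u u1 u2 u3 r1 : R -> R) c0 c1 c2 : open J ->
  projective_coordinate rho J tau ->
  (forall s, J s -> is_derive s 1 u (u1 s)) -> (forall s, J s -> is_derive s 1 u1 (u2 s)) ->
  (forall s, J s -> is_derive s 1 u2 (u3 s)) -> (forall s, J s -> is_derive s 1 rho (r1 s)) ->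
  (forall s, J s -> u s * derive1 tau s = c0 + c1 * tau s + c2 * tau s ^+ 2) ->
  forall s, J s -> u3 s + 2 * rho s * u1 s + r1 s * u s = 0.
Proof.
move=> oJ pc du du1 du2 dr Q s Js; have [St p0 _] := pc.
pose p := derive1n 1 tau; pose p1 := derive1n 2 tau; pose p2 := derive1n 3 tau.
pose p3 := derive1n 4 tau.
have dt r : J r -> is_derive r 1 tau (p r) by exact: (derive1n_is_derive 0%N St).
have dp r : J r -> is_derive r 1 p (p1 r) by exact: (derive1n_is_derive 1%N St).
have dp1 r : J r -> is_derive r 1 p1 (p2 r) by exact: (derive1n_is_derive 2%N St).
have dp2 r : J r -> is_derive r 1 p2 (p3 r) by exact: (derive1n_is_derive 3%N St).
have np r : J r -> p r != 0 by move=> Jr; rewrite gt_eqF//; exact: p0.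
have E1 r : J r -> u r * p1 r + p r * u1 r = c1 * p r + c2 * (2 * tau r * p r).
  move=> Jr; apply: (is_derive_eq_on oJ Jr (f := fun r => u r * p r)
    (g := fun r => c0 + c1 * tau r + c2 * (tau r * tau r))).
  - by move=> q Jq; rewrite -[LHS]/(u q * derive1 tau q) Q// expr2.
  - exact: deriveME (du r Jr) (dp r Jr).
  have := deriveDE (deriveDE (deriveCE c0 r) (deriveME (deriveCE c1 r) (dt r Jr)))
    (deriveME (deriveCE c2 r) (deriveME (dt r Jr) (dt r Jr))).
  by congr (is_derive _ _ _ _); move: (tau r) (p r) => a b; ring.
have E2 r : J r -> u r * p2 r + p1 r * u1 r + (p r * u2 r + u1 r * p1 r)
    = c1 * p1 r + c2 * (2 * (tau r * p1 r + p r * p r)).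
  move=> Jr; apply: (is_derive_eq_on oJ Jr E1).
    exact: deriveDE (deriveME (du r Jr) (dp1 r Jr)) (deriveME (dp r Jr) (du1 r Jr)).
  have := deriveDE (deriveME (deriveCE c1 r) (dp r Jr)) (deriveME (deriveCE c2 r)
    (deriveME (deriveME (deriveCE 2 r) (dt r Jr)) (dp r Jr))).
  by congr (is_derive _ _ _ _); move: (tau r) (p r) (p1 r) => a b c; ring.
have E3 : u s * p3 s + p2 s * u1 s + (p1 s * u2 s + u1 s * p2 s)
    + (p s * u3 s + u2 s * p1 s + (u1 s * p2 s + p1 s * u2 s))
    = c1 * p2 s + c2 * (2 * (tau s * p2 s + p1 s * p s + (p s * p1 s + p s * p1 s))).
  apply: (is_derive_eq_on oJ Js E2).
    apply: deriveDE; apply: deriveDE.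
    - exact: deriveME (du s Js) (dp2 s Js).
    - exact: deriveME (dp1 s Js) (du1 s Js).
    - exact: deriveME (dp s Js) (du2 s Js).
    - exact: deriveME (du1 s Js) (dp1 s Js).
  have := deriveDE (deriveME (deriveCE c1 s) (dp1 s Js)) (deriveME (deriveCE c2 s)
    (deriveME (deriveCE 2 s) (deriveDE (deriveME (dt s Js) (dp1 s Js)) (deriveME (dp s Js) (dp s Js))))).
  by congr (is_derive _ _ _ _); move: (tau s) (p s) (p1 s) (p2 s) => a b c d; ring.
have S r : J r -> rho r * (p r * p r) = p2 r * p r - 3 / 2 * (p1 r * p1 r).
  by move=> Jr; rewrite (schwarzian oJ pc Jr) -/p -/p1 -/p2; field; exact: np.
have S1 : rho s * (p s * p1 s + p s * p1 s) + p s * p s * r1 s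
    = p2 s * p1 s + p s * p3 s - (3 / 2 * (p1 s * p2 s + p1 s * p2 s)).
  apply: (is_derive_eq_on oJ Js S).
    exact: deriveME (dr s Js) (deriveME (dp s Js) (dp s Js)).
  have := deriveBE (deriveME (dp2 s Js) (dp s Js))
    (deriveME (deriveCE (3 / 2) s) (deriveME (dp1 s Js) (dp1 s Js))).
  by rewrite mulr0 addr0.
have := np s Js; move: (E1 s Js) (E2 s Js) E3 (S s Js) S1.
move: (u s) (u1 s) (u2 s) (u3 s) (p s) (p1 s) (p2 s) (p3 s) (tau s) (rho s) (r1 s).
move=> v v1 v2 v3 q q1 q2 q3 t r0 r1s F1 F2 F3 G0 G1 n.
have r0E : r0 = (q2 * q - 3 / 2 * (q1 * q1)) / (q * q) by rewrite -G0; field.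
have r1E : r1s = (q2 * q1 + q * q3 - (3 / 2 * (q1 * q2 + q1 * q2)) - r0 * (q * q1 + q * q1)) / (q * q).
  by rewrite -G1; field.
have aE : c1 + 2 * c2 * t = (v * q1 + q * v1) / q by rewrite F1; field.
have c2E : c2 = (v * q2 + q1 * v1 + (q * v2 + v1 * q1) - (c1 + 2 * c2 * t) * q1) / (2 * (q * q)).
  by rewrite F2; field.
have v3E : v3 = ((c1 + 2 * c2 * t) * q2 + 6 * c2 * q * q1 - (v * q3 + q2 * v1 + (q1 * v2 + v1 * q2)
    + (v2 * q1 + (v1 * q2 + q1 * v2)))) / q.
  have -> : (c1 + 2 * c2 * t) * q2 + 6 * c2 * q * q1 =
     c1 * q2 + c2 * (2 * (t * q2 + q1 * q + (q * q1 + q * q1))) by ring.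
  by rewrite -F3; field.
by rewrite v3E aE c2E aE r1E r0E; field.
Qed.

Lemma derive0_const J f a b : is_interval J -> (forall s, J s -> is_derive s 1 f (0 : R)) ->
  J a -> J b -> f a = f b.
Proof.
move=> iJ df; wlog ab : a b / a <= b => [H Ja Jb|Ja Jb].
  by case/orP: (le_total a b) => ?; [exact: H|apply/esym; exact: H].
have Jab s : a <= s <= b -> J s by exact: iJ.
have [||c _ E] := @MVT_segment R f (fun=> 0) a b ab.
- by move=> s; rewrite in_itv/= => /andP[sa sb]; apply/df/Jab; rewrite !ltW.
- apply: derivable_within_continuous => s; rewrite in_itv/= => /Jab/df ds.
  exact: ds.(ex_derive).
by move: E; rewrite mul0r => /eqP; rewrite subr_eq0 => /eqP.
Qed.

Lemma derive3_quadratic J f f1 f2 s0 : is_interval J -> J s0 ->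
  (forall s, J s -> is_derive s 1 f (f1 s)) -> (forall s, J s -> is_derive s 1 f1 (f2 s)) ->
  (forall s, J s -> is_derive s 1 f2 (0 : R)) ->
  exists c0 c1 c2 : R, forall s, J s -> f s = c0 + c1 * s + c2 * s ^+ 2.
Proof.
move=> iJ J0 d0 d1 d2; pose c2 := 2^-1 * f2 s0.
have f2E s : J s -> f2 s = 2 * c2.
  by move=> Js; rewrite (derive0_const iJ d2 Js J0) /c2; field.
have did s : is_derive s 1 (fun r : R => r) 1 by exact: is_derive_id.
have E1 s : J s -> is_derive s 1 (fun r => f1 r - 2 * c2 * r) 0.
  move=> Js; have := deriveBE (d1 s Js) (deriveME (deriveCE (2 * c2) s) (did s)).
  by rewrite f2E// mulr1 mulr0 addr0 subrr.
pose c1 := f1 s0 - 2 * c2 * s0.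
have f1E s : J s -> f1 s = c1 + 2 * c2 * s.
  by move=> Js; rewrite /c1 -(derive0_const iJ E1 Js J0) subrK.
have E0 s : J s -> is_derive s 1 (fun r => f r - (c1 * r + c2 * (r * r))) 0.
  move=> Js; have := deriveBE (d0 s Js) (deriveDE (deriveME (deriveCE c1 s) (did s))
    (deriveME (deriveCE c2 s) (deriveME (did s) (did s)))).
  by congr (is_derive _ _ _ _); rewrite f1E//; ring.
exists (f s0 - (c1 * s0 + c2 * (s0 * s0))), c1, c2 => s Js.
by rewrite -(derive0_const iJ E0 Js J0); ring.
Qed.

End OneVariable.

Lemma sum_lift (V : nmodType) (F : 'I_4 -> V) :
  \sum_i F i = \sum_(l < 3) F (lift ord_max l) + F ord_max.
Proof.
rewrite big_ord_recr /=; congr (_ + _); apply: eq_bigr => l _; congr F.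
by apply: val_inj; rewrite /= /bump leqNgt ltn_ord.
Qed.

Section Fibres.
Variable R : realType.
Local Notation M4 := 'rV[R]_4.
Local Notation B3 := 'rV[R]_3.
Implicit Types (N : set M4) (F t : M4 -> R).

Lemma derive1n_fibre N F k b s : open N -> smooth N F -> N (pt b s) ->
  derive1n k (fun r => F (pt b r)) s = iter k (partial ord_max) F (pt b s).
Proof.
move=> oN SF; elim: k s => [//|k IH] s Ns; rewrite derive1nS derive1E iterS.
have SFk : smooth N (iter k (partial ord_max) F).
  by elim: k {IH} => [//|k IH]; rewrite iterS; exact: smooth_partial.
rewrite -(@derive_val _ _ _ _ _ _ _ (is_derive_fibre SFk Ns)).
apply: near_eq_derive.
have nN : nbhs s (fibre N b) by apply: open_nbhs_nbhs; split => //; exact: open_fibre.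
by apply: filterS nN => r /IH.
Qed.

Lemma projective_field_ode rho N U x : open N -> smooth N rho ->
  projective_field rho N U -> N x ->
  let u y := U y 0 ord_max in
  partial ord_max (partial ord_max (partial ord_max u)) x
    + 2 * rho x * partial ord_max u x + partial ord_max rho x * u x = 0.
Proof.
move=> oN Srho [SU _ H] Nx u; have Su : smooth N u by exact: SU.
have Su1 := smooth_partial ord_max Su; have Su2 := smooth_partial ord_max Su1.
rewrite -(pt_pr x) in Nx *; move: (pr x) (x 0 ord_max) Nx => b s0 Ns0.
have [J [tau [c0 [c1 [c2 [oJ Js0 JN pc Q]]]]]] := H b s0 Ns0.
exact: (@projective_ode _ _ J tau (fun s => u (pt b s)) (fun s => partial ord_max u (pt b s))
  (fun s => partial ord_max (partial ord_max u) (pt b s))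
  (fun s => partial ord_max (partial ord_max (partial ord_max u)) (pt b s))
  (fun s => partial ord_max rho (pt b s)) c0 c1 c2 oJ pc
  (fun s Js => is_derive_fibre Su (JN _ Js)) (fun s Js => is_derive_fibre Su1 (JN _ Js))
  (fun s Js => is_derive_fibre Su2 (JN _ Js)) (fun s Js => is_derive_fibre Srho (JN _ Js)) Q).
Qed.

Lemma fibre_const N F x y : (forall b, is_interval (fibre N b)) -> smooth N F ->
  (forall z, N z -> partial ord_max F z = 0) -> N x -> N y -> pr x = pr y -> F x = F y.
Proof.
move=> iN SF F0 Nx Ny xy; rewrite -(pt_pr x) -(pt_pr y) -xy.
apply: (derive0_const (J := fibre N (pr x)) (f := fun s => F (pt (pr x) s)) (iN _)) => [s Ns||].
- by have := is_derive_fibre SF Ns; rewrite F0.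
- by rewrite /fibre /= pt_pr.
- by rewrite /fibre /= xy pt_pr.
Qed.

(** On connected fibres F only depends on the base point, so it can be evaluated at
    any point of the fibre. *)
Lemma descend N F : open N -> (forall b, connected (fibre N b)) -> smooth N F ->
  (forall x, N x -> partial ord_max F x = 0) ->
  exists2 c : B3 -> R, smooth (@pr R @` N) c & forall x, N x -> F x = c (pr x).
Proof.
move=> oN cN SF F0; pose y b := xget (0 : M4) [set x | N x /\ pr x = b].
have iN b : is_interval (fibre N b) by exact/connected_intervalP.
have Fc x : N x -> F x = F (y (pr x)).
  move=> Nx; have [Ny yx] : N (y (pr x)) /\ pr (y (pr x)) = pr x.
    by apply: (xgetPex (0 : M4) (P := [set z | N z /\ pr z = pr x])); exists x.
  exact: (fibre_const iN SF F0).
by exists (fun b => F (y b)) => //; exact: (smooth_descend oN SF).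
Qed.

(** The vertical part of the bracket with a horizontal lift; the lift and the
    vertical field are only known on N. *)
Lemma bracket_lift N (th Y U : M4 -> M4) (X : B3 -> B3) x : open N -> N x ->
  smooth_row N th -> smooth_row N U -> (forall j, smooth N (fun y => X (pr y) 0 j)) ->
  (forall y, N y -> th y 0 ord_max = 1) ->
  (forall y, N y -> Y y *m (th y)^T = 0 /\ Y y *m dpr R = X (pr y)) ->
  (forall y, N y -> U y *m dpr R = 0) ->
  let u y := U y 0 ord_max in
  bracket Y U x = (\sum_l X (pr x) 0 l * (hder th l u x
     + u x * partial ord_max (fun y => th y 0 (lift ord_max l)) x)) *: fib R.
Proof.
move=> oN Nx Sth SU SX th1 YE UE u.
have Yl y l : N y -> Y y 0 (lift ord_max l) = X (pr y) 0 l.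
  by move=> Ny; have [_ <-] := YE y Ny; rewrite -prE.
have Ul y l : N y -> U y 0 (lift ord_max l) = 0.
  by move=> Ny; rewrite -prE /pr UE// mxE.
have Y4 y : N y -> Y y 0 ord_max = - \sum_l X (pr y) 0 l * th y 0 (lift ord_max l).
  move=> Ny; have [/matrixP/(_ 0 0)] := YE y Ny.
  rewrite [X in X = _]mxE sum_lift [_^T _ _]mxE th1// mulr1 [RHS]mxE addrC => /eqP.
  rewrite addr_eq0 => /eqP -> _; congr (- _); apply: eq_bigr => l _.
  by rewrite Yl// [_^T _ _]mxE.
have P0 i (f : M4 -> R) (c : R) : (forall y, N y -> f y = c) -> partial i f x = 0.
  by move=> fc; rewrite (partial_ext _ oN Nx fc) partial_cst.
have U0 i l : partial i (fun y => U y 0 (lift ord_max l)) x = 0.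
  by apply: (P0 _ _ 0) => y; exact: Ul.
have Sx l : smooth N (fun y => X (pr y) 0 l * th y 0 (lift ord_max l)) by exact: smoothM.
have dY4 : partial ord_max (fun y => Y y 0 ord_max) x
    = - \sum_l X (pr x) 0 l * partial ord_max (fun y => th y 0 (lift ord_max l)) x.
  rewrite (partial_ext _ oN Nx Y4) partialN; last first.
    by apply: smooth_derivable Nx; exact: smooth_sum.
  rewrite (partial_sum _ _ oN Nx)//; congr (- _); apply: eq_bigr => l _.
  rewrite partialM; try exact: smooth_derivable Nx.
  by rewrite (partial_pr_max (fun b => X b 0 l)) mulr0 addr0.
apply/rowP => k; rewrite [LHS]mxE scalemxE sum_lift.
case: (unliftP ord_max k) => [l ->|->].
  rewrite U0 mulr0 add0r big1 => [|j _]; last by rewrite U0 Ul// mulr0 mul0r subrr.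
  rewrite [fib R _ _]mxE /= eq_sym (negbTE (neq_lift _ _)) mulr0 add0r.
  have -> : partial ord_max (fun y => Y y 0 (lift ord_max l)) x = 0; last by rewrite mulr0 oppr0.
  by rewrite (partial_ext _ oN Nx (fun y => @Yl y l)) (partial_pr_max (fun b => X b 0 l)).
rewrite [fib R _ _]mxE !eqxx mulr1 dY4 Y4// -/u -/(u x).
under eq_bigr do rewrite Ul// mul0r subr0 Yl//.
rewrite mulrN opprK mulNr addrA mulr_suml -sumrB mulr_sumr -big_split/=.
apply: eq_bigr => l _; rewrite /hder.
by move: (partial _ _ x) (partial _ _ x) (partial _ _ x) => p q r; ring.
Qed.

End Fibres.

(** * Monopole metrics in a fibre coordinate *)

Section Quadratic.
Variable R : realType.
Local Notation M4 := 'rV[R]_4.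
Local Notation B3 := 'rV[R]_3.
Variables (M : set M4) (B : set B3) (t : M4 -> R)
  (w2 w1 w0 : B3 -> R) (A2 A1 A0 aB : B3 -> B3).
Hypotheses (oM : open M) (oB : open B) (MB : forall x, M x -> B (pr x))
  (St : smooth M t) (dt0 : forall x, M x -> 0 < partial ord_max t x)
  (Sw2 : smooth B w2) (Sw1 : smooth B w1) (Sw0 : smooth B w0)
  (SA2 : smooth_row B A2) (SA1 : smooth_row B A1) (SA0 : smooth_row B A0).

Local Notation dt := (partial ord_max t).

(* The multiple of dt + t^2 A2 + t A1 + A0 with last component 1, and the
   relative length scale in terms of the last coordinate. *)
Definition quad_th (x : M4) : M4 := (dt x)^-1 *: quad_form t A2 A1 A0 x.
Definition quad_w (x : M4) : R := (dt x)^-1 * quad_scale t w2 w1 w0 x.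

Let Ah l x := t x ^+ 2 * A2 (pr x) 0 l + t x * A1 (pr x) 0 l + A0 (pr x) 0 l.

Let ndt x : M x -> dt x != 0. Proof. by move=> /dt0; exact: lt0r_neq0. Qed.

Let sub_pr : M `<=` [set x | B (pr x)]. Proof. exact: MB. Qed.

Let Spr (f : B3 -> R) : smooth B f -> smooth M (fun x => f (pr x)).
Proof. by move=> Sf; apply: smooth_sub sub_pr _; exact: smooth_pr. Qed.

Lemma smooth_quad c2 c1 c0 : smooth B c2 -> smooth B c1 -> smooth B c0 ->
  smooth M (quad_scale t c2 c1 c0).
Proof.
move=> S2 S1 S0; apply: smoothD => //; last exact: Spr.
apply: smoothD => //; apply: smoothM => //; [exact: smoothX|exact: Spr|exact: Spr].
Qed.

Lemma partial_quad c2 c1 c0 x : smooth B c2 -> smooth B c1 -> smooth B c0 -> M x ->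
  partial ord_max (quad_scale t c2 c1 c0) x = (2 * t x * c2 (pr x) + c1 (pr x)) * dt x.
Proof.
move=> S2 S1 S0 Mx; have P2 := Spr S2; have P1 := Spr S1; have P0 := Spr S0.
have Stt : smooth M (fun y => t y * t y) by exact: smoothM.
rewrite (_ : quad_scale t c2 c1 c0 = fun y => t y * t y * c2 (pr y) + t y * c1 (pr y) + c0 (pr y)).
  rewrite partialD; try by apply: smooth_derivable Mx => //; apply: smoothD => //; exact: smoothM.
  rewrite partialD; try by apply: smooth_derivable Mx; exact: smoothM.
  rewrite !partialM; try exact: smooth_derivable Mx.
  by rewrite !partial_pr_max; ring.
by apply/funext => y; rewrite /quad_scale expr2.
Qed.

Lemma quad_th_max x : M x -> quad_th x 0 ord_max = 1.
Proof.
by move=> Mx; rewrite /quad_th /quad_form !entryE dfunE /pull1 !max_dpr !mulr0 !addr0 mulVf ?ndt.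
Qed.

Lemma quad_th_lift x l : quad_th x 0 (lift ord_max l)
  = (dt x)^-1 * (partial (lift ord_max l) t x + Ah l x).
Proof. by rewrite /quad_th /quad_form !entryE dfunE /pull1 !lift_dpr /Ah !addrA. Qed.

Let SAh l : smooth M (Ah l).
Proof.
exact: (smooth_quad (c2 := fun b => A2 b 0 l) (c1 := fun b => A1 b 0 l)
  (c0 := fun b => A0 b 0 l)).
Qed.

Let Sdt : smooth M dt. Proof. exact: smooth_partial. Qed.

Let Sidt : smooth M (fun x => (dt x)^-1). Proof. exact: smoothV. Qed.

Lemma smooth_quad_th : smooth_row M quad_th.
Proof.
move=> i; case: (unliftP ord_max i) => [l ->|->].
  under eq_fun do rewrite quad_th_lift.
  exact: (smoothM oM Sidt (smoothD oM (smooth_partial _ St) (SAh l))).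
apply: (smooth_ext oM (f := fun=> 1)); last exact: smooth_cst.
by move=> x Mx; rewrite quad_th_max.
Qed.

Lemma smooth_quad_w : smooth M quad_w.
Proof. by apply: smoothM => //; exact: smooth_quad. Qed.

(* The horizontal derivatives of t are the components of the 1-form A. *)
Lemma hder_quad_t l x : M x -> hder quad_th l t x = - Ah l x.
Proof.
move=> Mx; rewrite /hder quad_th_lift; have := ndt Mx.
by move: (partial _ t x) (dt x) (Ah l x) => p q r n; field.
Qed.

Lemma hder_quad l c2 c1 c0 x : smooth B c2 -> smooth B c1 -> smooth B c0 -> M x ->
  hder quad_th l (quad_scale t c2 c1 c0) x
  = t x ^+ 2 * partial l c2 (pr x) + t x * partial l c1 (pr x) + partial l c0 (pr x)
    - (2 * t x * c2 (pr x) + c1 (pr x)) * Ah l x.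
Proof.
move=> S2 S1 S0 Mx; have P2 := Spr S2; have P1 := Spr S1; have P0 := Spr S0.
have hpr (f : B3 -> R) : hder quad_th l (fun y => f (pr y)) x = partial l f (pr x).
  by rewrite /hder partial_pr_lift partial_pr_max mulr0 subr0.
have Stt : smooth M (fun y => t y * t y) by exact: smoothM.
rewrite (_ : quad_scale t c2 c1 c0 = fun y => t y * t y * c2 (pr y) + t y * c1 (pr y) + c0 (pr y)).
  rewrite (hderD quad_th Mx)//; last by apply: smoothD => //; exact: smoothM.
  rewrite (hderD quad_th Mx); try exact: smoothM.
  rewrite !(hderM quad_th Mx)// !hpr hder_quad_t//.
  by move: (Ah l x) (partial _ _ _) (partial _ _ _) (partial _ _ _) => p q r s; ring.
by apply/funext => y; rewrite /quad_scale expr2.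
Qed.

Let q2 b : 'M[R]_3 := dform A2 b + wedge (A2 b) (A1 b).
Let q1 b : 'M[R]_3 := 2^-1 *: dform A1 b + wedge (A2 b) (A0 b).
Let q0 b : 'M[R]_3 := dform A0 b + wedge (A1 b) (A0 b).

(** Since the horizontal lifts map t to the components of - A, their brackets
    are quadratic in t, with the right hand sides of the monopole equations as
    coefficients. *)
Lemma quad_curvature x : M x -> hor_d quad_th quad_th x
  = (dt x)^-1 *: (t x ^+ 2 *: q2 (pr x) + (2 * t x) *: q1 (pr x) + q0 (pr x)).
Proof.
move=> Mx; apply/matrixP => i j.
have H k l : hder quad_th k (hder quad_th l t) x
   = (2 * t x * A2 (pr x) 0 l + A1 (pr x) 0 l) * Ah k x
     - (t x ^+ 2 * partial k (fun b => A2 b 0 l) (pr x)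
        + t x * partial k (fun b => A1 b 0 l) (pr x) + partial k (fun b => A0 b 0 l) (pr x)).
  rewrite (@hder_ext _ _ quad_th oM x Mx k _ (fun y => - 1 * Ah l y)); last first.
    by move=> y My; rewrite hder_quad_t// mulN1r.
  rewrite (hderM quad_th Mx)//; last exact: smooth_cst.
  rewrite (hder_quad k (SA2 l) (SA1 l) (SA0 l) Mx).
  have -> : hder quad_th k (fun=> -1) x = 0 by rewrite /hder !partial_cst mulr0 subrr.
  by move: (Ah k x) (partial _ _ _) (partial _ _ _) (partial _ _ _) => p q r s; ring.
have := hder_comm oM smooth_quad_th Mx i j St; rewrite !H.
rewrite /q2 /q1 /q0 !entryE.
have dE (p : B3 -> B3) : dform p (pr x) i j = partial i (fun b => p b 0 j) (pr x)
    - partial j (fun b => p b 0 i) (pr x) by exact: mxE.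
have wE (p q : B3) : wedge p q i j = p 0 i * q 0 j - p 0 j * q 0 i by exact: mxE.
rewrite !dE !wE /Ah; have := ndt Mx.
move: (partial i (fun b => A2 b 0 j) _) (partial j (fun b => A2 b 0 i) _) => a a'.
move: (partial i (fun b => A1 b 0 j) _) (partial j (fun b => A1 b 0 i) _) => c c'.
move: (partial i (fun b => A0 b 0 j) _) (partial j (fun b => A0 b 0 i) _) => e e'.
move: (hor_d _ _ _ _ _) (dt x) => F d n E.
have -> : F = - (- F * d) / d by field.
by rewrite -E; field.
Qed.

Let p2 b := weyl_der aB w2 b + w1 b *: A2 b - w2 b *: A1 b.
Let p1 b := 2^-1 *: weyl_der aB w1 b + w0 b *: A2 b - w2 b *: A0 b.
Let p0 b := weyl_der aB w0 b + w0 b *: A1 b - w1 b *: A0 b.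
Hypothesis w_gt0 : forall x, M x -> 0 < quad_scale t w2 w1 w0 x.

Lemma quad_w_gt0 x : M x -> 0 < quad_w x.
Proof. by move=> Mx; rewrite mulr_gt0 ?invr_gt0 ?dt0 ?w_gt0. Qed.

(** The minimal Weyl derivative is quadratic in t as well, with the left hand
    sides of the monopole equations as coefficients. *)
Lemma quad_minimal x : M x -> quad_w x *: (minimal_form quad_w quad_th x - pull1 aB x)
  = ((dt x)^-1 *: (t x ^+ 2 *: p2 (pr x) + (2 * t x) *: p1 (pr x) + p0 (pr x))) *m (dpr R)^T.
Proof.
move=> Mx; apply/rowP => i; case: (unliftP ord_max i) => [l ->|->]; last first.
  rewrite max_dpr scalemxE addmxE oppmxE (minimal_form_max quad_w oM quad_th_max Mx).
  by rewrite /pull1 max_dpr subrr mulr0.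
rewrite lift_dpr 2!entryE minimal_form_lift oppmxE [pull1 _ _]/pull1 lift_dpr.
have n := ndt Mx; have nw : quad_w x != 0 by rewrite gt_eqF// quad_w_gt0.
have dth : partial ord_max (fun y => quad_th y 0 (lift ord_max l)) x
   = (dt x)^-1 * hder quad_th l dt x + (2 * t x * A2 (pr x) 0 l + A1 (pr x) 0 l).
  have := partial_hder oM smooth_quad_th Mx l St.
  rewrite (partial_ext ord_max oM Mx (g := fun y => - 1 * Ah l y)); last first.
    by move=> y My; rewrite hder_quad_t// mulN1r.
  rewrite partialM; [|exact: derivable_cst|exact: smooth_derivable (SAh l) Mx].
  rewrite partial_cst mulr0 addr0 (partial_quad (SA2 l) (SA1 l) (SA0 l) Mx).
  move: (partial ord_max (fun y => _) x) (hder _ _ _ x) (dt x) n => p q d n E.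
  have -> : p = (q - (q - p * d)) / d by field.
  by rewrite -E; field.
have dw : hder quad_th l quad_w x = (dt x)^-1 * (hder quad_th l (quad_scale t w2 w1 w0) x
    - quad_w x * hder quad_th l dt x).
  have := @hder_ext _ _ quad_th oM x Mx l (quad_scale t w2 w1 w0) (fun y => dt y * quad_w y).
  move=> -> => [|y My]; last by rewrite /quad_w mulrA mulfV ?ndt// mul1r.
  rewrite (hderM quad_th Mx)//; last exact: smooth_quad_w.
  by move: (hder _ _ _ x) (hder _ _ _ x) => p q; field.
rewrite dth dw hder_quad// scalemxE /p2 /p1 /p0 /weyl_der !entryE !dfunE.
rewrite /quad_w /quad_scale /Ah in nw *.
move: nw; set W := (_ + w0 (pr x)) => nw.
have nW : W != 0 by move: nw; rewrite mulf_eq0 negb_or => /andP[].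
have WE : W = t x ^+ 2 * w2 (pr x) + t x * w1 (pr x) + w0 (pr x) by [].
clearbody W.
move: (hder _ _ _ x) (partial l w2 _) (partial l w1 _) (partial l w0 _) => d e2 e1 e0.
move: (dt x) n {nw} => D n.
have -> : D^-1 * W * (D^-1 * d + (2 * t x * A2 (pr x) 0 l + A1 (pr x) 0 l)
   + (D^-1 * W)^-1 * (D^-1 * (t x ^+ 2 * e2 + t x * e1 + e0 - (2 * t x * w2 (pr x) + w1 (pr x))
      * (t x ^+ 2 * A2 (pr x) 0 l + t x * A1 (pr x) 0 l + A0 (pr x) 0 l) - D^-1 * W * d))
   - aB (pr x) 0 l)
  = D^-1 * (W * (2 * t x * A2 (pr x) 0 l + A1 (pr x) 0 l)
   + (t x ^+ 2 * e2 + t x * e1 + e0 - (2 * t x * w2 (pr x) + w1 (pr x))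
      * (t x ^+ 2 * A2 (pr x) 0 l + t x * A1 (pr x) 0 l + A0 (pr x) 0 l))
   - W * aB (pr x) 0 l) by field; rewrite n nW.
by rewrite WE; congr (_ * _); field.
Qed.

Lemma quad_metricE h x : M x -> quad_metric h t w2 w1 w0 A2 A1 A0 x
  = pull2 h x + (quad_w x) ^- 2 *: ((quad_th x)^T *m quad_th x).
Proof.
move=> Mx; rewrite /quad_metric; congr (_ + _); rewrite /quad_w /quad_th.
rewrite trmxZ -scalemxAl -scalemxAr !scalerA; congr (_ *: _).
have := ndt Mx; have := lt0r_neq0 (w_gt0 Mx).
by move: (dt x) (quad_scale _ _ _ _ _) => p q n1 n2; field; rewrite n1 n2.
Qed.

End Quadratic.

(** * From the monopole equations to the conformal structure *)

Section FlatProjective.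
Variable R : realType.
Local Notation M4 := 'rV[R]_4.
Local Notation B3 := 'rV[R]_3.
Variable N : set M4.
Hypothesis oN : open N.

Local Notation d4 := (partial ord_max).

Lemma projective_coordinate_id (J : set R) : projective_coordinate (fun=> 0) J id.
Proof.
have id1 s : derive1 (id : R -> R) s = 1 by rewrite derive1E derive_id.
split=> [||phi Sphi s Js].
- move=> k s _; case: k => [|[|k]]; first exact: derivable_id.
    rewrite (_ : derive1n 1 id = fun=> 1 : R); first exact: derivable_cst.
    by apply/funext => r; exact: id1.
  have -> : derive1n k.+2 (id : R -> R) = derive1n k.+1 (fun=> 1 : R).
    by rewrite /derive1n !iterSr; congr (iter k _ (derive1 _)); apply/funext => r; exact: id1.
  exact: (smooth1_cst (J := setT)).
- by move=> s _; rewrite id1.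
rewrite /projective_operator mulr0 mul0r addr0 id1 sqrtr1 expr1n mulr1.
by congr (derive1n 2 _ s); apply/funext => r; rewrite id1 sqrtr1 divr1.
Qed.

(** For rho = 0 the last coordinate is projective, so projective fields are those
    with quadratic coefficient. *)
Lemma projective_field0 U : smooth_row N U -> (forall x, N x -> vertical (U x)) ->
  (forall x, N x -> d4 (d4 (d4 (fun y => U y 0 ord_max))) x = 0) ->
  projective_field (fun=> 0) N U.
Proof.
move=> SU vU U3; split=> // b s0 Ns0.
have nN : nbhs s0 (fibre N b) by apply: open_nbhs_nbhs; split => //; exact: open_fibre.
have /nbhs_ballP[e /= e0 eN] := nN.
pose u (y : M4) := U y 0 ord_max; have Su : smooth N u by exact: SU.
have Su1 := smooth_partial ord_max Su; have Su2 := smooth_partial ord_max Su1.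
have iJ : is_interval (ball s0 e).
  move=> x y Bx By z /andP[xz zy]; move: Bx By; rewrite /ball /= !ltr_distlC.
  move=> /andP[x1 x2] /andP[y1 y2]; apply/andP; split.
    exact: lt_le_trans x1 xz.
  exact: le_lt_trans zy y2.
have [c0 [c1 [c2 Q]]] := @derive3_quadratic R (ball s0 e) (fun s => u (pt b s))
  (fun s => d4 u (pt b s)) (fun s => d4 (d4 u) (pt b s)) s0 iJ (ballxx s0 e0)
  (fun s Js => is_derive_fibre Su (eN _ Js)) (fun s Js => is_derive_fibre Su1 (eN _ Js))
  (fun s Js => eq_ind _ (is_derive s 1 _) (is_derive_fibre Su2 (eN _ Js)) _ (U3 _ (eN _ Js))).
exists (ball s0 e), id, c0, c1, c2; split=> //.
- exact: ball_open.
- exact: ballxx.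
- exact: projective_coordinate_id.
by move=> s Js; rewrite derive1E derive_id mulr1; exact: Q.
Qed.

Variables (th : M4 -> M4).
Hypotheses (Sth : smooth_row N th) (th1 : forall x, N x -> th x 0 ord_max = 1)
  (th3 : forall l x, N x -> d4 (d4 (d4 (fun y => th y 0 (lift ord_max l)))) x = 0).

(* The operator H stands for the derivative along a horizontal lift, and tau for the
   component of the connection form; the bracket of the lift with u d4 is
   H u + u d4 tau. *)
Lemma vertical_derivative3 (tau u : M4 -> R) (H : (M4 -> R) -> M4 -> R) :
  (forall f, smooth N f -> smooth N (H f)) ->
  (forall f x, smooth N f -> N x -> d4 (H f) x = H (d4 f) x - d4 tau x * d4 f x) ->
  (forall f x, (forall y, N y -> f y = 0) -> N x -> H f x = 0) ->
  smooth N tau -> smooth N u ->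
  (forall x, N x -> d4 (d4 (d4 tau)) x = 0) -> (forall x, N x -> d4 (d4 (d4 u)) x = 0) ->
  forall x, N x -> d4 (d4 (d4 (fun y => H u y + u y * d4 tau y))) x = 0.
Proof.
move=> SH dH H0 Stau Su tau3 u3.
have Su1 := smooth_partial ord_max Su; have Su2 := smooth_partial ord_max Su1.
have St1 := smooth_partial ord_max Stau; have St2 := smooth_partial ord_max St1.
have D (p q : M4 -> R) x : smooth N p -> smooth N q -> N x ->
    d4 (fun y => p y + q y) x = d4 p x + d4 q x.
  by move=> Sp Sq Nx; apply: partialD; exact: smooth_derivable Nx.
have Dm (p q : M4 -> R) x : smooth N p -> smooth N q -> N x ->
    d4 (fun y => p y * q y) x = p x * d4 q x + q x * d4 p x.
  by move=> Sp Sq Nx; apply: partialM; exact: smooth_derivable Nx.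
have Sv1 := smoothM oN Su St2; have Sp := smoothM oN St1 Su2; have Sq := smoothM oN Su1 St2.
have v1 x : N x -> d4 (fun y => H u y + u y * d4 tau y) x = H (d4 u) x + u x * d4 (d4 tau) x.
  move=> Nx; rewrite (D _ _ x (SH u Su) (smoothM oN Su St1) Nx) (Dm _ _ x Su St1 Nx).
  by rewrite (dH u x Su Nx) addrCA subrK addrC.
have v2 x : N x -> d4 (d4 (fun y => H u y + u y * d4 tau y)) x
    = (H (d4 (d4 u)) x + - (d4 tau x * d4 (d4 u) x)) + d4 u x * d4 (d4 tau) x.
  move=> Nx; rewrite (partial_ext ord_max oN Nx v1).
  rewrite (D _ _ x (SH _ Su1) Sv1 Nx) (Dm _ _ x Su St2 Nx) (dH _ x Su1 Nx) (tau3 x Nx).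
  by rewrite mulr0 add0r [d4 (d4 tau) x * _]mulrC.
move=> x Nx; rewrite (partial_ext ord_max oN Nx v2).
rewrite (D _ _ x (smoothD oN (SH _ Su2) (smoothN oN Sp)) Sq Nx).
rewrite (D _ _ x (SH _ Su2) (smoothN oN Sp) Nx) (partialN (smooth_derivable Sp Nx)).
have E (a p q c s1 s2 s3 r1 r2 r3 : R) : a = c - s1 * r3 -> p = s1 * r3 + r2 * s2 ->
    q = r1 * s3 + s2 * r2 -> c = 0 -> r3 = 0 -> s3 = 0 -> a - p + q = 0.
  by move=> -> -> -> -> -> ->; ring.
exact: (E _ _ _ _ _ _ _ _ _ _ (dH _ x Su2 Nx) (Dm _ _ x St1 Su2 Nx)
  (Dm _ _ x Su1 St2 Nx) (H0 _ x u3 Nx) (u3 x Nx) (tau3 x Nx)).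
Qed.

(** If the connection form is quadratic in the last coordinate, then brackets with
    horizontal lifts preserve quadratic vertical fields. *)
Lemma quadratic_bracket (X : B3 -> B3) (Y U : M4 -> M4) :
  (forall j, smooth N (fun y => X (pr y) 0 j)) ->
  (forall y, N y -> Y y *m (th y)^T = 0 /\ Y y *m dpr R = X (pr y)) ->
  projective_field (fun=> 0) N U -> projective_field (fun=> 0) N (bracket Y U).
Proof.
move=> SX YE PU; have [SU vU _] := PU.
pose u (y : M4) := U y 0 ord_max; have Su : smooth N u by exact: SU.
have u3 x : N x -> d4 (d4 (d4 u)) x = 0.
  move=> Nx; have := projective_field_ode oN (smooth_cst N 0) PU Nx.
  by rewrite /= partial_cst mulr0 !mul0r !addr0.
have Su1 := smooth_partial ord_max Su; have Su2 := smooth_partial ord_max Su1.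
pose tl l y := th y 0 (lift ord_max l).
have St l : smooth N (tl l) by exact: Sth.
have St1 l := smooth_partial ord_max (St l); have St2 l := smooth_partial ord_max (St1 l).
pose v l y := hder th l u y + u y * d4 (tl l) y.
have Sv l : smooth N (v l).
  by apply: smoothD => //; [exact: smooth_hder|exact: smoothM].
have BE x : N x -> bracket Y U x = (\sum_l X (pr x) 0 l * v l x) *: fib R.
  by move=> Nx; exact: (bracket_lift oN Nx Sth SU SX th1 YE vU).
have SXv : smooth N (fun x => \sum_l X (pr x) 0 l * v l x).
  by apply: smooth_sum => // l _; exact: smoothM.
have D (p q : M4 -> R) x : smooth N p -> smooth N q -> N x ->
    d4 (fun y => p y + q y) x = d4 p x + d4 q x.
  by move=> Sp Sq Nx; apply: partialD; exact: smooth_derivable Nx.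
have Dm (p q : M4 -> R) x : smooth N p -> smooth N q -> N x ->
    d4 (fun y => p y * q y) x = p x * d4 q x + q x * d4 p x.
  by move=> Sp Sq Nx; apply: partialM; exact: smooth_derivable Nx.
have v3 l x : N x -> d4 (d4 (d4 (v l))) x = 0.
  move=> Nx; refine (@vertical_derivative3 (tl l) u (hder th l) _ _ _ (St l) Su _ u3 x Nx).
  - by move=> f Sf; exact: smooth_hder.
  - by move=> f y Sf Ny; exact: (partial_hder oN Sth Ny l Sf).
  - move=> f y f0 Ny; rewrite (hder_ext th oN Ny l f0).
    by rewrite /hder !partial_cst mulr0 subrr.
  - by move=> y Ny; exact: th3 Ny.
have Xd (f : 'I_3 -> M4 -> R) x : (forall l, smooth N (f l)) -> N x ->
    d4 (fun y => \sum_l X (pr y) 0 l * f l y) x = \sum_l X (pr x) 0 l * d4 (f l) x.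
  move=> Sf Nx; rewrite (partial_sum _ _ oN Nx) => [|l]; last exact: smoothM.
  apply: eq_bigr => l _; rewrite Dm//.
  by rewrite (partial_pr_max (fun b => X b 0 l)) mulr0 addr0.
apply: projective_field0.
- move=> i; apply: (smooth_ext oN (f := fun x => (\sum_l X (pr x) 0 l * v l x) * fib R 0 i)).
    by move=> x Nx; rewrite BE// scalemxE.
  by apply: smoothM => //; exact: smooth_cst.
- by move=> x Nx; rewrite /vertical BE// -scalemxAl fib_dpr scaler0.
have B0 x : N x -> bracket Y U x 0 ord_max = \sum_l X (pr x) 0 l * v l x.
  by move=> Nx; rewrite BE// scalemxE [fib R _ _]mxE !eqxx mulr1.
have B1 x : N x -> d4 (fun y => bracket Y U y 0 ord_max) x = \sum_l X (pr x) 0 l * d4 (v l) x.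
  by move=> Nx; rewrite (partial_ext _ oN Nx B0) Xd.
have S1 l : smooth N (d4 (v l)) by exact: smooth_partial.
have B2 x : N x -> d4 (d4 (fun y => bracket Y U y 0 ord_max)) x
    = \sum_l X (pr x) 0 l * d4 (d4 (v l)) x.
  by move=> Nx; rewrite (partial_ext _ oN Nx B1) Xd.
have S2 l : smooth N (d4 (d4 (v l))) by exact: smooth_partial.
move=> x Nx; rewrite (partial_ext _ oN Nx B2) Xd// big1// => l _.
by rewrite v3// mulr0.
Qed.

End FlatProjective.

Section Converse.
Variable R : realType.
Local Notation M4 := 'rV[R]_4.
Local Notation B3 := 'rV[R]_3.
Variables (B : set B3) (h : B3 -> 'M[R]_3) (aB : B3 -> B3)
  (w2 w1 w0 : B3 -> R) (A2 A1 A0 : B3 -> B3) (M : set M4).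
Hypotheses (oB : open B) (hB : is_metric B h) (SaB : smooth_row B aB)
  (Sw2 : smooth B w2) (Sw1 : smooth B w1) (Sw0 : smooth B w0)
  (SA2 : smooth_row B A2) (SA1 : smooth_row B A1) (SA0 : smooth_row B A0)
  (mono : projective_monopole B h aB w2 w1 w0 A2 A1 A0).

Let t (x : M4) := x 0 ord_max.
Let w := quad_scale t w2 w1 w0.
Let th := quad_form t A2 A1 A0.
Let g := quad_metric h t w2 w1 w0 A2 A1 A0.

Hypotheses (oM : open M) (MB : @pr R @` M `<=` B) (w_gt0 : forall x, M x -> 0 < w x).

Let MB' x : M x -> B (pr x). Proof. by move=> Mx; apply: MB; exists x. Qed.

Let dt x : partial ord_max t x = 1. Proof. by rewrite partial_coord eqxx. Qed.
Let dt0 x : M x -> 0 < partial ord_max t x. Proof. by rewrite dt. Qed.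
Let St : smooth M t. Proof. exact: smooth_coord. Qed.

Let thE : quad_th t A2 A1 A0 = th.
Proof. by apply/funext => x; rewrite /quad_th dt invr1 scale1r. Qed.

Let wE : quad_w t w2 w1 w0 = w.
Proof. by apply/funext => x; rewrite /quad_w dt invr1 mul1r. Qed.

Let Sth : smooth_row M th.
Proof. by rewrite -thE; exact: (smooth_quad_th oM oB MB' St dt0 SA2 SA1 SA0). Qed.

Let th1 x : M x -> th x 0 ord_max = 1.
Proof. by rewrite -thE; exact: quad_th_max. Qed.

Let Sw : smooth M w.
Proof. by exact: (smooth_quad oM oB MB' St Sw2 Sw1 Sw0). Qed.

Let p2 b := weyl_der aB w2 b + w1 b *: A2 b - w2 b *: A1 b.
Let p1 b := 2^-1 *: weyl_der aB w1 b + w0 b *: A2 b - w2 b *: A0 b.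
Let p0 b := weyl_der aB w0 b + w0 b *: A1 b - w1 b *: A0 b.
(* The 1-form w (a0 - aB), quadratic in t. *)
Let beta x := t x ^+ 2 *: p2 (pr x) + (2 * t x) *: p1 (pr x) + p0 (pr x).

Let Sbeta : smooth_row M beta.
Proof.
have Sub (p q : B3 -> B3) : smooth_row B p -> smooth_row B q -> smooth_row B (fun b => p b - q b).
  by move=> Sp Sq; apply: smooth_rowD => //; exact: smooth_rowN.
have Sd f : smooth B f -> smooth_row B (weyl_der aB f).
  by move=> Sf; apply: Sub; [exact: smooth_dfun|exact: smooth_rowZ].
have Spr (p : B3 -> B3) : smooth_row B p -> smooth_row M (fun x => p (pr x)).
  by move=> Sp i; apply: smooth_sub (smooth_pr oB (Sp i)).
have S2 : smooth_row B p2.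
  apply: Sub; last exact: smooth_rowZ.
  by apply: smooth_rowD => //; [exact: Sd|exact: smooth_rowZ].
have S1 : smooth_row B p1.
  apply: Sub; last exact: smooth_rowZ.
  apply: smooth_rowD => //; last exact: smooth_rowZ.
  by apply: smooth_rowZ => //; [exact: smooth_cst|exact: Sd].
have S0 : smooth_row B p0.
  apply: Sub; last exact: smooth_rowZ.
  by apply: smooth_rowD => //; [exact: Sd|exact: smooth_rowZ].
apply: smooth_rowD => //; last exact: Spr.
apply: smooth_rowD => //; (apply: smooth_rowZ => //; last exact: Spr).
- exact: smoothX.
- by apply: smoothM => //; exact: smooth_cst.
Qed.

Let monopole x : M x -> star1 (h (pr x)) (beta x) = hor_d th th x.
Proof.
move=> Mx; have [E2 E1 E0] := mono (MB' Mx).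
have := quad_curvature oM oB MB' St dt0 SA2 SA1 SA0 Mx; rewrite thE dt invr1 scale1r => ->.
by rewrite /beta 2!star1D 2!star1Z [star1 _ (p2 _)]E2 [star1 _ (p1 _)]E1 [star1 _ (p0 _)]E0.
Qed.

Let betaE x : M x -> beta x *m (dpr R)^T = w x *: (minimal_form w th x - pull1 aB x).
Proof.
move=> Mx; have := quad_minimal aB oM oB MB' St dt0 Sw2 Sw1 Sw0 SA2 SA1 SA0 w_gt0 Mx.
by rewrite wE thE dt invr1 scale1r => ->.
Qed.

Let gE x : M x -> g x = pull2 h x + (w x) ^- 2 *: ((th x)^T *m th x).
Proof. by move=> Mx; rewrite /g (quad_metricE A2 A1 A0 dt0 w_gt0) // wE thE. Qed.

Let gE1 x : M x -> g x = 1 *: (pull2 h x + (w x) ^- 2 *: ((th x)^T *m th x)).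
Proof. by move=> Mx; rewrite scale1r gE. Qed.

Lemma smooth_pull2 (q : B3 -> 'M[R]_3) : smooth_mx B q -> smooth_mx M (pull2 q).
Proof.
move=> Sq i j; rewrite (_ : (fun x => _) = fun x => match unlift ord_max i, unlift ord_max j with
  | Some i', Some j' => q (pr x) i' j' | _, _ => 0 end).
  case: unliftP => [i' _|_]; last exact: smooth_cst.
  case: unliftP => [j' _|_]; last exact: smooth_cst.
  by apply: smooth_sub (smooth_pr oB (Sq i' j')).
by apply/funext => x; rewrite pullE.
Qed.

Let th3 l x : M x ->
  partial ord_max (partial ord_max (partial ord_max (fun y => th y 0 (lift ord_max l)))) x = 0.
Proof.
move=> Mx.
have S (c : R) : smooth B (fun=> c) := smooth_cst B c.
have S2 (a : B3 -> R) : smooth B a -> smooth B (fun b => 2 * a b).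
  by move=> Sa; apply: smoothM.
have Q c2 c1 c0 y : smooth B c2 -> smooth B c1 -> smooth B c0 -> M y ->
    partial ord_max (quad_scale t c2 c1 c0) y = quad_scale t (fun=> 0) (fun b => 2 * c2 b) c1 y.
  move=> Sc2 Sc1 Sc0 My; rewrite (partial_quad oM oB MB' St Sc2 Sc1 Sc0 My) dt mulr1.
  by rewrite /quad_scale mulr0 add0r mulrCA mulrA.
pose a2 b := A2 b 0 l; pose a1 b := A1 b 0 l; pose a0 b := A0 b 0 l.
have Sa2 : smooth B a2 by exact: SA2.
have Sa1 : smooth B a1 by exact: SA1.
have Sa0 : smooth B a0 by exact: SA0.
have E0 y : M y -> th y 0 (lift ord_max l) = quad_scale t a2 a1 a0 y.
  move=> My; rewrite -thE quad_th_lift dt invr1 mul1r partial_coord.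
  by rewrite eq_sym (negbTE (neq_lift _ _)) add0r.
have E1 y : M y -> partial ord_max (fun y => th y 0 (lift ord_max l)) y
    = quad_scale t (fun=> 0) (fun b => 2 * a2 b) a1 y.
  by move=> My; rewrite (partial_ext _ oM My E0) Q.
have E2 y : M y -> partial ord_max (partial ord_max (fun y => th y 0 (lift ord_max l))) y
    = quad_scale t (fun=> 0) (fun=> 2 * 0) (fun b => 2 * a2 b) y.
  by move=> My; rewrite (partial_ext _ oM My E1) Q//; exact: S2.
rewrite (partial_ext _ oM Mx E2) Q//; last exact: S2.
by rewrite /quad_scale !mulr0 !addr0.
Qed.

(** The projective monopole equations say that the star of beta = w (a0 - aB) is the
    curvature of the horizontal distribution.  This gives the selfduality of the
    metric and of the Faraday curvature, and that aB is the induced Weyl derivative;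
    the submersion is projective for rho = 0. *)
Theorem monopole_submersion : einstein_weyl B h aB ->
  [/\ is_metric M g, selfdual M g,
      (forall x, M x -> forall X, horizontal (g x) X <-> X *m (th x)^T = 0),
      (forall x, M x -> length_scale g (fun=> 1) x = w x) &
      selfdual_projective_submersion M (@pr R @` M) g h aB (fun=> 1) (fun=> 0)].
Proof.
move=> EW; have [E [SE hdE]] := orthonormal_coframe oB hB.
have hE b : B b -> h b = (E b)^T *m E b by move=> /hdE[].
have dE b : B b -> 0 < \det (E b) by move=> /hdE[].
have hE' x : M x -> h (pr x) = (E (pr x))^T *m E (pr x) by move=> /MB'/hE.
have dE' x : M x -> 0 < \det (E (pr x)) by move=> /MB'/dE.
have S1 : smooth M (fun=> 1 : R) by exact: smooth_cst.
have Sh : smooth_mx M (pull2 h) by apply: smooth_pull2; case: hB.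
have lam1 (x : M4) : M x -> 0 < (1 : R) by [].
have horP := horizontalP lam1 w_gt0 th1 hE' dE' gE1.
have lsE := submersion_length_scale lam1 w_gt0 th1 gE1.
split.
- split; first exact: (smooth_submersion oM Sh S1 Sw w_gt0 Sth gE1).
  move=> x Mx; split; first exact: (submersion_sym w_gt0 th1 hE' dE' gE1 Mx).
  by move=> X; exact: (submersion_pos lam1 w_gt0 th1 hE' dE' gE1 Mx).
- apply: (monopole_selfdual oM oB MB' SE hE dE SaB Sw w_gt0 Sth th1 Sbeta monopole) gE => //.
  move=> x Mx; have nw := lt0r_neq0 (w_gt0 Mx).
  by rewrite betaE// scalerBr /minimal_form scalerDr scalerA mulfV// scale1r addrA.
- exact: horP.
- exact: lsE.
split.
- split=> // x Mx; split=> // X Y HX HY.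
  exact: (ip_horizontal lam1 w_gt0 th1 hE' dE' gE1 Mx HX HY).
- exists (minimal_form w th); split.
  + split; first exact: smooth_minimal_form.
    move=> x Mx.
    apply/(minimal_weylP oM Sh S1 lam1 Sw w_gt0 Sth th1 hE' dE' gE1 _ Mx).
    have -> : dfun (fun=> 1 : R) x = 0 by apply/rowP => i; rewrite dfunE partial_cst mxE.
    by rewrite scaler0 subr0.
  + move=> x Mx; rewrite gE//.
    exact: (faraday_selfdual oM Sw w_gt0 Sth th1 Sbeta hE' dE' monopole betaE Mx).
  + move=> x Mx.
    rewrite (omegaE oM S1 lam1 Sw w_gt0 Sth th1 hE' dE' gE1 Mx (monopole Mx)).
    have -> : dfun (fun=> 1 : R) x = 0 by apply/rowP => i; rewrite dfunE partial_cst mxE.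
    rewrite scaler0 addr0 betaE// scalerA mulVf ?scale1r ?gt_eqF ?w_gt0//.
    by rewrite opprB addrC subrK.
split=> [|X Y SX HL N U oN NM PU|f Sf]; first exact: smooth_cst.
- have NB : N `<=` [set x | (@pr R @` M) (pr x)] by move=> x /NM Mx; exists x.
  have opM : open (@pr R @` M) by exact: open_pr_image.
  apply: (@quadratic_bracket R N oN th _ _ _ X Y U) => //.
  + by move=> i; exact: smooth_sub NM (Sth i).
  + by move=> x /NM; exact: th1.
  + by move=> l x /NM; exact: th3.
  + by move=> j; apply: smooth_sub NB (smooth_pr opM (SX j)).
  + by move=> x /NM Mx; have [/(horP x Mx) ? ?] := HL x Mx.
have opM : open (@pr R @` M) by exact: open_pr_image.
have Sfp : smooth M (fun x => f (pr x)).
  by apply: smooth_sub (smooth_pr opM Sf) => x Mx; exists x.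
split=> [i|x Mx|b s0 Ms0].
- apply: (smooth_ext oM (f := fun x => f (pr x) * w x * fib R 0 i)).
    by move=> x Mx; rewrite scalemxE lsE.
  by apply: smoothM => //; [exact: smoothM|exact: smooth_cst].
- by rewrite /vertical -scalemxAl fib_dpr scaler0.
exists (fibre M b), id, (f b * w0 b), (f b * w1 b), (f b * w2 b); split=> //.
- exact: open_fibre.
- exact: projective_coordinate_id.
move=> s Ms; rewrite scalemxE [fib R _ _]mxE !eqxx mulr1 derive1E derive_id mulr1 lsE//.
by rewrite /w /quad_scale /t ptK pt_max; ring.
Qed.

End Converse.

(** * From the conformal structure to the monopole equations *)

Section FibreCoordinate.
Variable R : realType.
Local Notation M4 := 'rV[R]_4.
Local Notation B3 := 'rV[R]_3.
Variables (N : set M4) (t : M4 -> R).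
Hypotheses (oN : open N) (St : smooth N t) (dt0 : forall x, N x -> 0 < partial ord_max t x).

Local Notation d4 := (partial ord_max).

(* Differentiation along the fibres with respect to t. *)
Definition dt_der (f : M4 -> R) (x : M4) : R := (d4 t x)^-1 * d4 f x.

Let ndt x : N x -> d4 t x != 0. Proof. by move=> /dt0; exact: lt0r_neq0. Qed.
Let Sdt : smooth N (d4 t). Proof. exact: smooth_partial. Qed.

Lemma smooth_dt_inv : smooth N (fun x => (d4 t x)^-1). Proof. exact: smoothV. Qed.

Lemma smooth_dt_der f : smooth N f -> smooth N (dt_der f).
Proof. by move=> Sf; exact: (smoothM oN smooth_dt_inv (smooth_partial ord_max Sf)). Qed.

Lemma dt_der_ext f g x : N x -> (forall y, N y -> f y = g y) -> dt_der f x = dt_der g x.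
Proof. by move=> Nx fg; rewrite /dt_der (partial_ext ord_max oN Nx fg). Qed.

Lemma dt_derD f g x : N x -> smooth N f -> smooth N g ->
  dt_der (fun y => f y + g y) x = dt_der f x + dt_der g x.
Proof.
move=> Nx Sf Sg; rewrite /dt_der -mulrDr partialD//; exact: smooth_derivable Nx.
Qed.

Lemma dt_derM f g x : N x -> smooth N f -> smooth N g ->
  dt_der (fun y => f y * g y) x = f x * dt_der g x + g x * dt_der f x.
Proof.
move=> Nx Sf Sg; rewrite /dt_der partialM; try exact: smooth_derivable Nx.
by rewrite mulrDr mulrCA [_ * (g x * _)]mulrCA.
Qed.

Lemma dt_der_cst c x : dt_der (fun=> c) x = 0.
Proof. by rewrite /dt_der partial_cst mulr0. Qed.

Lemma dt_derZ c f x : N x -> smooth N f -> dt_der (fun y => c * f y) x = c * dt_der f x.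
Proof.
move=> Nx Sf; rewrite (dt_derM Nx (smooth_cst N c) Sf) dt_der_cst.
by rewrite mulr0 addr0.
Qed.

Lemma dt_der_t x : N x -> dt_der t x = 1.
Proof. by move=> Nx; rewrite /dt_der mulVf ?ndt. Qed.

Lemma dt_der0 f x : N x -> dt_der f x = 0 -> d4 f x = 0.
Proof.
by move=> Nx /eqP; rewrite mulf_eq0 invr_eq0 (negbTE (ndt Nx)) => /eqP.
Qed.

Lemma dt_der3_ext f g x : N x -> (forall y, N y -> f y = g y) ->
  dt_der (dt_der (dt_der f)) x = dt_der (dt_der (dt_der g)) x.
Proof.
move=> Nx fg.
exact: (dt_der_ext Nx (fun y Ny => dt_der_ext Ny (fun z Nz => dt_der_ext Nz fg))).
Qed.

Lemma dt_der3Z c f x : N x -> smooth N f ->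
  dt_der (dt_der (dt_der (fun y => c * f y))) x = c * dt_der (dt_der (dt_der f)) x.
Proof.
move=> Nx Sf; have Sf1 := smooth_dt_der Sf; have Sf2 := smooth_dt_der Sf1.
rewrite -(dt_derZ c Nx Sf2).
exact: (dt_der_ext Nx (fun y Ny => etrans
  (dt_der_ext Ny (fun z Nz => dt_derZ c Nz Sf)) (dt_derZ c Ny Sf1))).
Qed.

Lemma dt_der3_linear f g c x : N x -> smooth N f -> smooth N g ->
  dt_der (dt_der (dt_der (fun y => f y + c * g y))) x
  = dt_der (dt_der (dt_der f)) x + c * dt_der (dt_der (dt_der g)) x.
Proof.
have L p q y : smooth N p -> smooth N q -> N y ->
    dt_der (fun z => p z + c * q z) y = dt_der p y + c * dt_der q y.
  move=> Sp Sq Ny; rewrite (dt_derD Ny Sp (smoothM oN (smooth_cst N c) Sq)).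
  by rewrite (dt_derZ _ Ny Sq).
move=> Nx Sf Sg; have Sf1 := smooth_dt_der Sf; have Sg1 := smooth_dt_der Sg.
have Sf2 := smooth_dt_der Sf1; have Sg2 := smooth_dt_der Sg1.
rewrite -(L _ _ x Sf2 Sg2 Nx).
exact: (dt_der_ext Nx (fun y Ny => etrans
  (dt_der_ext Ny (fun z Nz => L _ _ z Sf Sg Nz)) (L _ _ y Sf1 Sg1 Ny))).
Qed.

Lemma dt_der3_t f x : N x -> smooth N f ->
  dt_der (dt_der (dt_der (fun y => t y * f y))) x
  = 3 * dt_der (dt_der f) x + t x * dt_der (dt_der (dt_der f)) x.
Proof.
move=> Nx Sf; have Sf1 := smooth_dt_der Sf; have Sf2 := smooth_dt_der Sf1.
have E1 y : N y -> dt_der (fun y => t y * f y) y = t y * dt_der f y + f y.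
  by move=> Ny; rewrite (dt_derM Ny St Sf) (dt_der_t Ny) mulr1.
have E2 y : N y -> dt_der (dt_der (fun y => t y * f y)) y
    = t y * dt_der (dt_der f) y + 2 * dt_der f y.
  move=> Ny; rewrite (dt_der_ext Ny E1) (dt_derD Ny (smoothM oN St Sf1) Sf).
  rewrite (dt_derM Ny St Sf1) (dt_der_t Ny).
  by move: (dt_der f y) (dt_der (dt_der f) y) => p q; ring.
rewrite [LHS](dt_der_ext Nx E2).
rewrite [LHS](dt_derD Nx (smoothM oN St Sf2) (smoothM oN (smooth_cst N 2) Sf1)).
rewrite (dt_derM Nx St Sf2) (dt_der_t Nx) (dt_derZ 2 Nx Sf1).
by move: (dt_der (dt_der f) x) (dt_der _ x) => p q; ring.
Qed.

(** A function whose third derivative with respect to t vanishes is quadratic in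
    t, with coefficients from the base if the fibres are connected. *)
Lemma quadratic_in_t v : (forall b, connected (fibre N b)) -> smooth N v ->
  (forall x, N x -> dt_der (dt_der (dt_der v)) x = 0) ->
  exists c2 c1 c0 : B3 -> R, [/\ smooth (@pr R @` N) c2, smooth (@pr R @` N) c1,
    smooth (@pr R @` N) c0 & forall x, N x -> v x = quad_scale t c2 c1 c0 x].
Proof.
move=> cN Sv v3; have Sv1 := smooth_dt_der Sv; have Sv2 := smooth_dt_der Sv1.
pose f2 x := 2^-1 * dt_der (dt_der v) x.
have Sf2 : smooth N f2 := smoothM oN (smooth_cst N 2^-1) Sv2.
have df2 x : N x -> dt_der f2 x = 0.
  by move=> Nx; rewrite (dt_derZ _ Nx Sv2) v3// mulr0.
pose f1 x := dt_der v x + - 2 * (t x * f2 x).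
have Stf2 := smoothM oN St Sf2.
have Sf1 : smooth N f1 := smoothD oN Sv1 (smoothM oN (smooth_cst N (- 2)) Stf2).
have df1 x : N x -> dt_der f1 x = 0.
  move=> Nx; rewrite (dt_derD Nx Sv1 (smoothM oN (smooth_cst N (- 2)) Stf2)).
  rewrite (dt_derZ _ Nx Stf2) (dt_derM Nx St Sf2) (df2 x Nx) (dt_der_t Nx) /f2.
  by move: (dt_der _ x) => p; field.
pose f0 x := v x + - 1 * (t x * (f1 x + t x * f2 x)).
have Sg : smooth N (fun x => f1 x + t x * f2 x) := smoothD oN Sf1 Stf2.
have Stg := smoothM oN St Sg.
have Sf0 : smooth N f0 := smoothD oN Sv (smoothM oN (smooth_cst N (- 1)) Stg).
have df0 x : N x -> dt_der f0 x = 0.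
  move=> Nx; rewrite (dt_derD Nx Sv (smoothM oN (smooth_cst N (- 1)) Stg)).
  rewrite (dt_derZ _ Nx Stg) (dt_derM Nx St Sg) (dt_derD Nx Sf1 Stf2) (dt_derM Nx St Sf2).
  rewrite (df1 x Nx) (df2 x Nx) (dt_der_t Nx) /f1.
  by move: (dt_der _ x) (f2 x) => p q; ring.
have [c2 Sc2 E2] := descend oN cN Sf2 (fun x Nx => dt_der0 Nx (df2 x Nx)).
have [c1 Sc1 E1] := descend oN cN Sf1 (fun x Nx => dt_der0 Nx (df1 x Nx)).
have [c0 Sc0 E0] := descend oN cN Sf0 (fun x Nx => dt_der0 Nx (df0 x Nx)).
exists c2, c1, c0; split=> // x Nx.
by rewrite /quad_scale -E2// -E1// -E0// /f0; ring.
Qed.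

(* By differentiating twice along the fibres, on which t is not constant. *)
Lemma quad_eq0 c2 c1 c0 x : (forall y, N y -> quad_scale t c2 c1 c0 y = 0) -> N x ->
  [/\ c2 (pr x) = 0, c1 (pr x) = 0 & c0 (pr x) = 0].
Proof.
move=> Q0 Nx; pose a2 := c2 (pr x); pose a1 := c1 (pr x); pose a0 := c0 (pr x).
have dM (f g : M4 -> R) y : smooth N f -> smooth N g -> N y ->
    d4 (fun z => f z * g z) y = f y * d4 g y + g y * d4 f y.
  by move=> Sf Sg Ny; apply: partialM; exact: smooth_derivable Ny.
have dD (f g : M4 -> R) y : smooth N f -> smooth N g -> N y ->
    d4 (fun z => f z + g z) y = d4 f y + d4 g y.
  by move=> Sf Sg Ny; apply: partialD; exact: smooth_derivable Ny.
have D2 (e2 e1 e0 : B3 -> R) : (forall y, N y -> quad_scale t e2 e1 e0 y = 0) ->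
    forall y, N y -> quad_scale t (fun=> 0) (fun b => 2 * e2 b) e1 y = 0.
  move=> H y Ny; pose q z := t z * t z * e2 (pr y) + t z * e1 (pr y) + e0 (pr y).
  have E1 : d4 (quad_scale t e2 e1 e0) y = 0.
    by rewrite (partial_ext ord_max oN Ny H) partial_cst.
  have E2 : d4 (quad_scale t e2 e1 e0) y = d4 q y.
    by apply: partial_max_ext => z zy; rewrite /quad_scale zy expr2.
  have Stt := smoothM oN St St.
  have Sc (c : R) : smooth N (fun=> c) := smooth_cst N c.
  have S2 := smoothM oN Stt (Sc (e2 (pr y))); have S1 := smoothM oN St (Sc (e1 (pr y))).
  have := dD _ _ y (smoothD oN S2 S1) (Sc (e0 (pr y))) Ny; rewrite -/q -E2 E1.
  rewrite (dD _ _ y S2 S1 Ny) (dM _ _ y Stt (Sc _) Ny) (dM _ _ y St (Sc _) Ny).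
  rewrite (dM _ _ y St St Ny) !partial_cst.
  rewrite !mulr0 !add0r addr0 => E3.
  have : d4 t y * quad_scale t (fun=> 0) (fun b => 2 * e2 b) e1 y = 0.
    by rewrite [RHS]E3 /quad_scale; ring.
  by move/eqP; rewrite mulf_eq0 (negbTE (ndt Ny)) => /eqP.
have Q1 := D2 _ _ _ Q0; have Q2 := D2 _ _ _ Q1.
have z2 : c2 (pr x) = 0.
  have := Q2 x Nx; rewrite /quad_scale !mulr0 !add0r => /eqP.
  by rewrite mulf_eq0 pnatr_eq0 => /eqP.
have z1 : c1 (pr x) = 0.
  by have := Q1 x Nx; rewrite /quad_scale z2 !mulr0 !add0r.
split=> //; by have := Q0 x Nx; rewrite /quad_scale z2 z1 !mulr0 !add0r.
Qed.

Variable rho : M4 -> R.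
Let e x := (d4 t x)^-1 * d4 (d4 t) x.
Hypothesis (schw : forall x, N x -> rho x = d4 (d4 (d4 t)) x / d4 t x - 3 / 2 * (d4 (d4 t) x / d4 t x) ^+ 2).

(** In a projective coordinate t the third order equation of the projective
    fields u becomes (u t')''' = 0. *)
Lemma projective_flat u x : smooth N u ->
  (forall y, N y -> d4 (d4 (d4 u)) y + 2 * rho y * d4 u y + d4 rho y * u y = 0) ->
  N x -> dt_der (dt_der (dt_der (fun y => u y * d4 t y))) x = 0.
Proof.
move=> Su ode Nx.
have Su1 := smooth_partial ord_max Su; have Su2 := smooth_partial ord_max Su1.
have St2 := smooth_partial ord_max Sdt.
have Se : smooth N e := smoothM oN smooth_dt_inv St2.
have Se1 := smooth_partial ord_max Se.
have dM (f g : M4 -> R) y : smooth N f -> smooth N g -> N y ->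
    d4 (fun z => f z * g z) y = f y * d4 g y + g y * d4 f y.
  by move=> Sf Sg Ny; apply: partialM; exact: smooth_derivable Ny.
have dD (f g : M4 -> R) y : smooth N f -> smooth N g -> N y ->
    d4 (fun z => f z + g z) y = d4 f y + d4 g y.
  by move=> Sf Sg Ny; apply: partialD; exact: smooth_derivable Ny.
have dtE y : N y -> d4 (d4 t) y = e y * d4 t y.
  by move=> Ny; rewrite /e mulrAC mulVf ?mul1r ?ndt.
have diE y : N y -> d4 (fun z => (d4 t z)^-1) y = - (e y * (d4 t y)^-1).
  move=> Ny; rewrite (partialV (smooth_derivable Sdt Ny) (ndt Ny)) (dtE y Ny) -exprVn.
  by move: (e y) (d4 t y) (ndt Ny) => p q n; field.
have rhoE y : N y -> rho y = d4 e y + - 2^-1 * (e y * e y).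
  move=> Ny; rewrite (schw Ny) (dM _ _ y smooth_dt_inv St2 Ny) (diE y Ny) (dtE y Ny).
  by move: (e y) (d4 (d4 (d4 t)) y) (d4 t y) (ndt Ny) => p q r n; field.
have Sv1 := smoothM oN Su Se.
have E1 y : N y -> dt_der (fun z => u z * d4 t z) y = d4 u y + u y * e y.
  move=> Ny; rewrite /dt_der (dM _ _ y Su Sdt Ny) (dtE y Ny).
  by move: (e y) (u y) (d4 u y) (d4 t y) (ndt Ny) => p q r s n; field.
have Sa := smoothM oN Su1 Se; have Sb := smoothM oN Su Se1.
have Sab := smoothD oN Sa Sb; have Sabc := smoothD oN Su2 Sab.
have E2 y : N y -> dt_der (dt_der (fun z => u z * d4 t z)) y
    = (d4 t y)^-1 * (d4 (d4 u) y + (d4 u y * e y + u y * d4 e y)).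
  move=> Ny; rewrite (dt_der_ext Ny E1) /dt_der (dD _ _ y Su1 Sv1 Ny) (dM _ _ y Su Se Ny).
  by congr (_ * (_ + _)); rewrite addrC [_ * d4 u y]mulrC.
rewrite (dt_der_ext Nx E2) /dt_der (dM _ _ x smooth_dt_inv Sabc Nx) (diE x Nx).
rewrite (dD _ _ x Su2 Sab Nx) (dD _ _ x Sa Sb Nx) (dM _ _ x Su1 Se Nx) (dM _ _ x Su Se1 Nx).
have dr : d4 rho x = d4 (d4 e) x - e x * d4 e x.
  rewrite (partial_ext ord_max oN Nx rhoE).
  rewrite (dD _ _ x Se1 (smoothM oN (smooth_cst N (- 2^-1)) (smoothM oN Se Se)) Nx).
  rewrite (dM _ _ x (smooth_cst N (- 2^-1)) (smoothM oN Se Se) Nx) (dM _ _ x Se Se Nx) partial_cst.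
  by move: (d4 (d4 e) x) (d4 e x) (e x) => p q r; field.
have := ode x Nx; rewrite dr (rhoE x Nx).
move: (d4 (d4 (d4 u)) x) (d4 (d4 u) x) (d4 u x) (d4 (d4 e) x) (d4 e x) (e x) (d4 t x)^-1 (u x).
move=> u3 u2 u1 e2 e1 f q v H.
have -> : u3 = - (2 * (e1 + - 2^-1 * (f * f)) * u1 + (e2 - f * e1) * v).
  by apply/eqP; rewrite -addr_eq0 addrA H.
by field.
Qed.

End FibreCoordinate.

Section Decomposition.
Variable R : realType.
Local Notation M4 := 'rV[R]_4.
Local Notation B3 := 'rV[R]_3.
Variables (M : set M4) (B : set B3) (g : M4 -> 'M[R]_4) (h : B3 -> 'M[R]_3) (lam : M4 -> R).
Hypotheses (oM : open M) (gM : is_metric M g) (cs : conformal_submersion M B g h lam).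

Let k x := g x ord_max ord_max.

(* The 1-form with kernel the horizontal distribution and last component 1. *)
Definition vertical_form (x : M4) : M4 := (k x)^-1 *: row ord_max (g x).

Let kE x : ip (g x) (fib R) (fib R) = k x.
Proof. by rewrite /ip mulmx_fibT -rowE mxE. Qed.

Let k0 x : M x -> 0 < k x.
Proof.
move=> Mx; rewrite -kE; have [_ /(_ x Mx)[_]] := gM; apply.
by apply/eqP => /matrixP/(_ 0 ord_max)/eqP; rewrite !mxE !eqxx oner_eq0.
Qed.

Let nk x : M x -> k x != 0. Proof. by move=> /k0; exact: lt0r_neq0. Qed.

Lemma vertical_form_max x : M x -> vertical_form x 0 ord_max = 1.
Proof. by move=> Mx; rewrite scalemxE mxE mulVf ?nk. Qed.

Let Sk : smooth M k. Proof. by case: gM => Sg _; exact: Sg. Qed.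

Lemma smooth_vertical_form : smooth_row M vertical_form.
Proof.
move=> i; have [Sg _] := gM.
apply: (smooth_ext oM (f := fun x => (k x)^-1 * g x ord_max i)).
  by move=> x Mx; rewrite scalemxE mxE.
apply: smoothM => //; exact: smoothV.
Qed.

Let lam0 x : M x -> 0 < lam x. Proof. by case: cs => _ _ H /H[]. Qed.
Let Slam : smooth M lam. Proof. by case: cs. Qed.

Lemma length_scale_gt0 x : M x -> 0 < length_scale g lam x.
Proof. by move=> Mx; rewrite divr_gt0// sqrtr_gt0 ?kE ?k0 ?lam0. Qed.

Lemma smooth_length_scale : smooth M (length_scale g lam).
Proof.
apply: (smooth_ext oM (f := fun x => Num.sqrt (lam x) * (Num.sqrt (k x))^-1)).
  by move=> x Mx; rewrite /length_scale kE.
apply: smoothM => //; first exact: smooth_sqrt.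
apply: smoothV => //; last exact: smooth_sqrt.
by move=> x Mx; rewrite gt_eqF// sqrtr_gt0 k0.
Qed.

(** Splitting coordinate vectors into their horizontal and vertical parts. *)
Lemma submersion_metric x : M x -> g x = lam x *: (pull2 h x
  + (length_scale g lam x) ^- 2 *: ((vertical_form x)^T *m vertical_form x)).
Proof.
move=> Mx; have [_ _ /(_ x Mx)[l0 H]] := cs; have [_ /(_ x Mx)[gT _]] := gM.
pose th := vertical_form x; have n := nk Mx.
have gf : g x *m (fib R)^T = k x *: th^T.
  apply/colP => i; rewrite mulmx_fibT scalemxE [th^T _ _]mxE scalemxE mxE mulrA mulfV// mul1r.
  by rewrite -[in LHS]gT mxE.
have fg : fib R *m g x = k x *: th by rewrite -{1}gT -[LHS]trmxK trmx_mul trmxK gf linearZ/= trmxK.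
pose P (X : M4) : M4 := X - (X *m th^T) 0 0 *: fib R.
have th_fib : fib R *m th^T = 1%:M.
  by rewrite -[LHS]trmxK trmx_mul trmxK; apply/matrixP => i j; rewrite mxE mulmx_fibT !ord1 vertical_form_max// mxE.
have Pth X : P X *m th^T = 0.
  rewrite /P mulmxBl -scalemxAl th_fib; apply/matrixP => i j; rewrite !ord1 addmxE oppmxE scalemxE.
  by rewrite [1%:M _ _]mxE eqxx mulr1 subrr mxE.
have Phor X : horizontal (g x) (P X).
  move=> U vU; have -> : U = U 0 ord_max *: fib R.
    by apply: row4P; rewrite ?prZ ?pr_fib ?scaler0// !mxE !eqxx mulr1.
  by rewrite /ip trmxZ -scalemxAr -mulmxA gf -scalemxAr Pth !scaler0 mxE.
have Ppr X : P X *m dpr R = X *m dpr R by rewrite mulmxBl -scalemxAl fib_dpr scaler0 subr0.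
have main (X Y : M4) : ip (g x) X Y = lam x * ip (h (pr x)) (X *m dpr R) (Y *m dpr R)
    + k x * ((X *m th^T) 0 0 * (Y *m th^T) 0 0).
  have := H _ _ (Phor X) (Phor Y); rewrite !Ppr => <-.
  have -> : ip (g x) (P X) (P Y) = ip (g x) (P X) Y.
    have Pg : P X *m g x *m (fib R)^T = 0 by rewrite -mulmxA gf -scalemxAr Pth scaler0.
    by rewrite /ip {2}/P linearB/= mulmxBr trmxZ -scalemxAr Pg scaler0 subr0.
  have fgY : fib R *m g x *m Y^T = k x *: (Y *m th^T)^T.
    by rewrite fg -scalemxAl trmx_mul trmxK.
  rewrite /ip /P mulmxBl mulmxBl -!scalemxAl fgY.
  by rewrite addmxE oppmxE !scalemxE [(_^T) 0 0]mxE mulrCA subrK.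
have lsE : lam x * (length_scale g lam x) ^- 2 = k x.
  rewrite /length_scale kE expr_div_n !sqr_sqrtr ?ltW ?k0//.
  by have := lt0r_neq0 l0; move: (lam x) => l nl; field; rewrite nl n.
apply/matrixP => i j; have := main (delta_mx 0 i) (delta_mx 0 j).
have ipE m (G : 'M[R]_m) a b : ip G (delta_mx 0 a) (delta_mx 0 b) = G a b.
  by rewrite /ip -rowE trmx_delta -colE !mxE.
have thE a : ((delta_mx 0 a : M4) *m th^T) 0 0 = th 0 a by rewrite -rowE !mxE.
rewrite ipE !thE => ->.
rewrite [RHS]scalemxE [X in _ = _ * X]addmxE [X in _ = _ * (_ + X)]scalemxE outerE mulrDr.
rewrite [X in _ = _ + X]mulrA lsE.
congr (_ * _ + _).
by rewrite /ip trmx_mul !mulmxA -!mulmxA -rowE /pull2 trmx_delta !mulmxA -colE !mxE.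
Qed.

End Decomposition.

Lemma star1_quad (R : realType) (H : 'M[R]_3) (a b : R) p q r :
  star1 H (a *: p + b *: q + r) = a *: star1 H p + b *: star1 H q + star1 H r.
Proof. by rewrite !star1D !star1Z. Qed.

Section Direct.
Variable R : realType.
Local Notation M4 := 'rV[R]_4.
Local Notation B3 := 'rV[R]_3.
Variables (M : set M4) (B : set B3) (g : M4 -> 'M[R]_4) (h : B3 -> 'M[R]_3)
  (aB : B3 -> B3) (lam rho : M4 -> R) (N : set M4) (t : M4 -> R).
Hypotheses (oM : open M) (oB : open B) (gM : is_metric M g) (hB : is_metric B h)
  (sps : selfdual_projective_submersion M B g h aB lam rho)
  (oN : open N) (NM : N `<=` M) (fpc : fibrewise_projective_coordinate rho N t).

Local Notation d4 := (partial ord_max).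

Let cs : conformal_submersion M B g h lam. Proof. by case: sps. Qed.
Let ps : projective_submersion M B g lam rho. Proof. by case: sps. Qed.
Let Srho : smooth N rho. Proof. by case: ps => Sr _ _; exact: smooth_sub Sr. Qed.
Let St : smooth N t. Proof. by case: fpc. Qed.
Let cN b : connected (fibre N b). Proof. by case: fpc. Qed.

Let pr_t b : projective_coordinate (fun s => rho (pt b s)) (fibre N b)
                  (fun s => t (pt b s)).
Proof. by case: fpc. Qed.

Let MB x : M x -> B (pr x). Proof. by case: cs => <- _ _ Mx; exists x. Qed.

Let dt0 x : N x -> 0 < d4 t x.
Proof.
move=> Nx; have Ns : N (pt (pr x) (x 0 ord_max)) by rewrite pt_pr.
have [_ /(_ _ Ns) + _] := pr_t (pr x).
by rewrite -derive1n1 (derive1n_fibre 1 oN St Ns) /= pt_pr.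
Qed.

Let schw x : N x -> rho x = d4 (d4 (d4 t)) x / d4 t x - 3 / 2 * (d4 (d4 t) x / d4 t x) ^+ 2.
Proof.
move=> Nx; have Ns : N (pt (pr x) (x 0 ord_max)) by rewrite pt_pr.
have oF : open (fibre N (pr x)) by exact: open_fibre.
have := schwarzian oF (pr_t (pr x)) Ns.
by rewrite !(derive1n_fibre _ oN St Ns) /= pt_pr.
Qed.

Let th := vertical_form g.
Let w := length_scale g lam.

Let Sth : smooth_row N th.
Proof. by move=> i; exact: smooth_sub NM (smooth_vertical_form oM gM i). Qed.

Let th1 x : N x -> th x 0 ord_max = 1.
Proof. by move=> /NM Mx; exact: (vertical_form_max gM Mx). Qed.

Let ndt x : N x -> d4 t x != 0. Proof. by move=> /dt0; exact: lt0r_neq0. Qed.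
Let Sdt : smooth N (d4 t). Proof. exact: smooth_partial. Qed.
Let Siq : smooth N (fun x => (d4 t x)^-1). Proof. exact: smooth_dt_inv. Qed.

Let ode_flat u x : smooth N u ->
  (forall y, N y -> d4 (d4 (d4 u)) y + 2 * rho y * d4 u y + d4 rho y * u y = 0) ->
  N x -> dt_der t (dt_der t (dt_der t (fun y => u y * d4 t y))) x = 0.
Proof. exact: (projective_flat oN St dt0 schw). Qed.

Let field_flat U x : projective_field rho N U -> N x ->
  dt_der t (dt_der t (dt_der t (fun y => U y 0 ord_max * d4 t y))) x = 0.
Proof.
move=> PU Nx; apply: ode_flat => //; first by case: PU.
by move=> y Ny; exact: (projective_field_ode oN Srho PU Ny).
Qed.

(* The fields d/dt and t d/dt are projective. *)
Let t_field c0 c1 : let U x := ((d4 t x)^-1 * (c0 + c1 * t x)) *: fib R in projective_field rho N U.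
Proof.
move=> U; split=> [i|x Nx|b s0 Ns0].
- apply: (smooth_ext oN (f := fun x => (d4 t x)^-1 * (c0 + c1 * t x) * fib R 0 i)).
    by move=> x _; rewrite scalemxE.
  apply: (smoothM oN _ (smooth_cst N _)); apply: (smoothM oN Siq).
  by apply: (smoothD oN (smooth_cst N c0)); exact: (smoothM oN (smooth_cst N c1)).
- by rewrite /vertical -scalemxAl fib_dpr scaler0.
exists (fibre N b), (fun s => t (pt b s)), c0, c1, 0; split=> //.
  exact: open_fibre.
move=> s Ns; rewrite scalemxE [fib R _ _]mxE !eqxx mulr1.
rewrite -derive1n1 (derive1n_fibre 1 oN St Ns) /=.
by rewrite mul0r addr0 mulrAC mulVf ?mul1r// ndt.
Qed.

(** The connection form in the coordinate t: brackets of a horizontal lift Y with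
    the fields d/dt and t d/dt show that Y t is quadratic in t. *)
Let lift_flat l x : N x -> dt_der t (dt_der t (dt_der t (hder th l t))) x = 0.
Proof.
move=> Nx; pose X (b : B3) : B3 := delta_mx 0 l.
pose Y x : M4 := delta_mx 0 (lift ord_max l) - th x 0 (lift ord_max l) *: fib R.
have SX : smooth_row B X by move=> i; exact: smooth_cst.
have Yth y : M y -> Y y *m (th y)^T = 0 /\ Y y *m dpr R = X (pr y).
  move=> My; split; last first.
    by rewrite /Y mulmxBl -scalemxAl fib_dpr scaler0 subr0 -[LHS]/(pr _) pr_delta_lift.
  have dthE c : ((delta_mx 0 c : M4) *m (th y)^T) 0 0 = th y 0 c by rewrite -rowE !mxE.
  apply/matrixP => i j; rewrite !ord1 mulmxBl -scalemxAl addmxE oppmxE scalemxE !dthE.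
  by rewrite (vertical_form_max gM My) mulr1 subrr mxE.
have [E [SE hdE]] := orthonormal_coframe oB hB.
have lam0 y : M y -> 0 < lam y by case: cs => _ _ H /H[].
have hE' y : M y -> h (pr y) = (E (pr y))^T *m E (pr y) by move=> /MB/hdE[].
have dE' y : M y -> 0 < \det (E (pr y)) by move=> /MB/hdE[].
have HL : horizontal_lift M g X Y.
  move=> y My; have [Y1 Y2] := Yth y My; split=> //.
  have gE z : M z -> g z = lam z *: (pull2 h z + (w z) ^- 2 *: ((th z)^T *m th z)).
    exact: (submersion_metric gM cs).
  have lw0 z : M z -> 0 < w z by exact: (length_scale_gt0 gM cs).
  have t1 z : M z -> th z 0 ord_max = 1 by exact: (vertical_form_max gM).
  by apply/(horizontalP lam0 lw0 t1 hE' dE' gE My).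
have [_ /(_ X Y SX HL N) br _] := ps.
have SXN j : smooth N (fun y => X (pr y) 0 j) by exact: smooth_cst.
have YthN y : N y -> Y y *m (th y)^T = 0 /\ Y y *m dpr R = X (pr y) by move=> /NM; exact: Yth.
pose T := hder th l t; have ST : smooth N T by exact: smooth_hder.
have SdT : smooth N (dt_der t T) by exact: smooth_dt_der.
have key c0 c1 z : N z -> dt_der t (dt_der t (dt_der t
    (fun y => - 1 * ((c0 + c1 * t y) * dt_der t T y) + c1 * T y))) z = 0.
  move=> Nz; pose U y := ((d4 t y)^-1 * (c0 + c1 * t y)) *: fib R.
  have PU : projective_field rho N U := t_field c0 c1.
  have PB := br U oN NM PU; have := field_flat PB Nz.
  pose u (y : M4) := U y 0 ord_max; have SU : smooth_row N U by case: PU.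
  have Su : smooth N u by exact: SU.
  have vU y : N y -> U y *m dpr R = 0 by case: PU => _ vU _ /vU.
  have Sq1 : smooth N (fun y => c0 + c1 * t y).
    exact: (smoothD oN (smooth_cst N c0) (smoothM oN (smooth_cst N c1) St)).
  have uE y : N y -> c0 + c1 * t y = u y * d4 t y.
    move=> Ny; rewrite /u /U scalemxE [fib R _ _]mxE !eqxx mulr1.
    by rewrite mulrAC mulVf ?mul1r// ndt.
  have bE y : N y -> bracket Y U y 0 ord_max * d4 t y
      = - 1 * ((c0 + c1 * t y) * dt_der t T y) + c1 * T y.
    move=> Ny; rewrite (bracket_lift oN Ny Sth SU SXN th1 YthN vU) scalemxE.
    rewrite [fib R _ _]mxE !eqxx mulr1 (bigD1 l)//= big1 => [|j ne]; last first.
      by rewrite [X _ _ _]mxE /= (negbTE ne) mul0r.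
    rewrite [X _ _ _]mxE !eqxx mul1r addr0 -/u.
    have := hder_ext th oN Ny l uE.
    rewrite (hderD th Ny l (smooth_cst N c0) (smoothM oN (smooth_cst N c1) St)).
    rewrite (hderM th Ny l (smooth_cst N c1) St) (hderM th Ny l Su Sdt) -/T.
    have hc c : hder th l (fun=> c : R) y = 0 by rewrite /hder !partial_cst mulr0 subrr.
    rewrite !hc add0r mulr0 addr0 => HE.
    have := partial_hder oN Sth Ny l St; rewrite -/T => dT.
    have uE' := uE y Ny; rewrite uE' /dt_der.
    have HH : hder th l u y * d4 t y = c1 * T y - u y * hder th l (d4 t) y.
      by rewrite HE [RHS]addrC addKr mulrC.
    rewrite mulrDl HH dT; have := ndt Ny.
    rewrite -/(u y); move: (hder th l (d4 t) y) (u y) (d4 t y) (T y) (d4 _ y) => p q r s v n.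
    by field.
  by move=> <-; apply/esym; exact: (dt_der3_ext t oN Nz bE).
have D1 z : N z -> dt_der t (dt_der t (dt_der t (dt_der t T))) z = 0.
  move=> Nz; have E1 := dt_der3Z oN St dt0 (- 1) Nz SdT.
  have E2 := key 1 0 z Nz; apply/eqP; rewrite -oppr_eq0 -mulN1r -E1 -E2; apply/eqP.
  by apply: (dt_der3_ext t oN Nz) => y _; rewrite !mul0r !addr0 mul1r.
have StdT : smooth N (fun y => t y * dt_der t T y) := smoothM oN St SdT.
have L (a b c d q r : R) : a = b -> a = c + - 1 * d -> d = 3 * c + r * q -> q = 0 -> b = 0 -> c = 0.
  move=> -> H1 H2 H3 H4; move: H1; rewrite H2 H3 H4 mulr0 addr0 mulN1r => H1.
  have : 2 * c = - (c - 3 * c) by ring.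
  by rewrite -H1 oppr0 => /eqP; rewrite mulf_eq0 pnatr_eq0 => /eqP.
have E2 := key 0 1 x Nx; have E1 := dt_der3_linear oN St dt0 (- 1) Nx ST StdT.
have E0 := dt_der3_ext t oN Nx (f := fun y => T y + - 1 * (t y * dt_der t T y))
  (g := fun y => - 1 * ((0 + 1 * t y) * dt_der t T y) + 1 * T y)
  (fun y _ => _).
have E3 := dt_der3_t oN St dt0 Nx SdT; have E4 := D1 x Nx.
by apply: (L _ _ _ _ _ _ (E0 _) E1 E3 E4 E2) => y; rewrite !mul1r add0r addrC.
Qed.

(* In the coordinate t the relative length scale is w d4 t. *)
Let scale_flat x : N x -> dt_der t (dt_der t (dt_der t (fun y => w y * d4 t y))) x = 0.
Proof.
move=> Nx; have [SrM _ /(_ (fun=> 1) (smooth_cst B 1)) PF] := ps.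
have Sw : smooth N w by exact: smooth_sub NM (smooth_length_scale oM gM cs).
apply: (ode_flat Sw) => // y Ny; have My := NM Ny.
have := projective_field_ode oM SrM PF My.
have wE z : (1 * length_scale g lam z *: fib R) 0 ord_max = w z.
  by rewrite scalemxE [fib R _ _]mxE !eqxx mul1r mulr1.
by rewrite (_ : (fun z => _) = w)//; apply/funext => z.
Qed.

(** By the flatness above, w d4 t and the components of the connection form are
    quadratic in t.  The star of beta = w (a0 - aB) is then the curvature of the
    horizontal distribution; both are quadratic in t up to the same factor, and their
    coefficients are the two sides of the projective monopole equations. *)
Theorem submersion_monopole :
  exists (w2 w1 w0 : B3 -> R) (A2 A1 A0 : B3 -> B3),
    [/\ [/\ smooth (@pr R @` N) w2, smooth (@pr R @` N) w1 & smooth (@pr R @` N) w0],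
        [/\ smooth_row (@pr R @` N) A2, smooth_row (@pr R @` N) A1
          & smooth_row (@pr R @` N) A0],
        (forall x, N x -> 0 < quad_scale t w2 w1 w0 x /\
           g x = lam x *: quad_metric h t w2 w1 w0 A2 A1 A0 x) &
        projective_monopole (@pr R @` N) h aB w2 w1 w0 A2 A1 A0].
Proof.
have Sw : smooth N w by exact: smooth_sub NM (smooth_length_scale oM gM cs).
have [w2 [w1 [w0 [Sw2 Sw1 Sw0 wE]]]] :=
  quadratic_in_t oN St dt0 cN (smoothM oN Sw Sdt) scale_flat.
have /choice[c2 H2] l : exists c2 : B3 -> R, exists c1 c0 : B3 -> R,
    [/\ smooth (@pr R @` N) c2, smooth (@pr R @` N) c1, smooth (@pr R @` N) c0 &
    forall x, N x -> - 1 * hder th l t x = quad_scale t c2 c1 c0 x].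
  have ST : smooth N (hder th l t) by exact: smooth_hder.
  apply: (quadratic_in_t oN St dt0 cN (smoothM oN (smooth_cst N (- 1)) ST)) => x Nx.
  apply: (etrans (dt_der3Z oN St dt0 (- 1) Nx ST)).
  exact: (etrans (congr1 ( *%R (- 1)) (lift_flat l Nx)) (mulr0 _)).
have /choice[c1 H1] := H2; have /choice[c0 H0] := H1.
pose A2 b : B3 := \row_l c2 l b; pose A1 b : B3 := \row_l c1 l b; pose A0 b : B3 := \row_l c0 l b.
have SA2 : smooth_row (@pr R @` N) A2.
  by move=> l; under eq_fun do rewrite mxE; case: (H0 l).
have SA1 : smooth_row (@pr R @` N) A1.
  by move=> l; under eq_fun do rewrite mxE; case: (H0 l).
have SA0 : smooth_row (@pr R @` N) A0.
  by move=> l; under eq_fun do rewrite mxE; case: (H0 l).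
have AE l x : N x -> hder th l t x = - (t x ^+ 2 * A2 (pr x) 0 l + t x * A1 (pr x) 0 l + A0 (pr x) 0 l).
  move=> Nx; have [_ _ _ /(_ x Nx)] := H0 l; rewrite /quad_scale !mxE => <-.
  by rewrite mulN1r opprK.
have qthE x : N x -> quad_th t A2 A1 A0 x = th x.
  move=> Nx; apply/rowP => i; case: (unliftP ord_max i) => [l ->|->]; last first.
    by rewrite th1// (quad_th_max A2 A1 A0 dt0 Nx).
  rewrite quad_th_lift; have := AE l x Nx.
  set Q := _ + A0 (pr x) 0 l; rewrite /hder => /eqP; rewrite -eqr_oppLR => /eqP <-.
  have := ndt Nx; move: (partial _ t x) (d4 t x) (th x 0 _) => p d s n.
  by field.
have qwE x : N x -> quad_w t w2 w1 w0 x = w x.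
  by move=> Nx; rewrite /quad_w -wE// mulrCA mulVf ?mulr1// ndt.
have w_gt0 x : N x -> 0 < quad_scale t w2 w1 w0 x.
  by move=> Nx; rewrite -wE// mulr_gt0 ?dt0// (length_scale_gt0 gM cs)//; exact: NM.
have gE x : N x -> g x = lam x *: quad_metric h t w2 w1 w0 A2 A1 A0 x.
  move=> Nx; rewrite (quad_metricE _ _ _ dt0 w_gt0)// qthE// qwE//.
  by rewrite (submersion_metric gM cs (NM Nx)).
exists w2, w1, w0, A2, A1, A0; split=> //.
  by move=> x Nx; split; [exact: w_gt0|exact: gE].
have oP : open (@pr R @` N) by exact: open_pr_image.
have NP x : N x -> (@pr R @` N) (pr x) by exists x.
have [E [SE hdE]] := orthonormal_coframe oB hB.
have hE x : N x -> h (pr x) = (E (pr x))^T *m E (pr x) by move=> /NM/MB/hdE[].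
have dE x : N x -> 0 < \det (E (pr x)) by move=> /NM/MB/hdE[].
have lam0 x : N x -> 0 < lam x by move=> /NM Mx; case: cs => _ _ /(_ x Mx)[].
have Slam : smooth N lam by case: cs => _ Sl _; exact: smooth_sub NM Sl.
have Sh : smooth_mx N (pull2 h).
  by apply: (smooth_pull2 oB) => [_ [x Nx <-]|]; [exact/MB/NM|case: hB].
have Sqw := smooth_quad_w oN oP NP St dt0 Sw2 Sw1 Sw0.
have Sqth := smooth_quad_th oN oP NP St dt0 SA2 SA1 SA0.
have qth1 x : N x -> quad_th t A2 A1 A0 x 0 ord_max = 1 by exact: quad_th_max.
have qw0 x : N x -> 0 < quad_w t w2 w1 w0 x by move=> Nx; exact: (quad_w_gt0 dt0 w_gt0 Nx).
have gE' x : N x -> g x = lam x *: (pull2 h x + (quad_w t w2 w1 w0 x) ^- 2 *: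
    ((quad_th t A2 A1 A0 x)^T *m quad_th t A2 A1 A0 x)).
  by move=> Nx; rewrite gE// (quad_metricE _ _ _ dt0 w_gt0).
pose p2 b := weyl_der aB w2 b + w1 b *: A2 b - w2 b *: A1 b.
pose p1 b := 2^-1 *: weyl_der aB w1 b + w0 b *: A2 b - w2 b *: A0 b.
pose p0 b := weyl_der aB w0 b + w0 b *: A1 b - w1 b *: A0 b.
pose q2 b : 'M[R]_3 := dform A2 b + wedge (A2 b) (A1 b).
pose q1 b : 'M[R]_3 := 2^-1 *: dform A1 b + wedge (A2 b) (A0 b).
pose q0 b : 'M[R]_3 := dform A0 b + wedge (A1 b) (A0 b).
have poly x : N x -> t x ^+ 2 *: star1 (h (pr x)) (p2 (pr x)) + (2 * t x) *: star1 (h (pr x)) (p1 (pr x))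
    + star1 (h (pr x)) (p0 (pr x)) = t x ^+ 2 *: q2 (pr x) + (2 * t x) *: q1 (pr x) + q0 (pr x).
  move=> Nx; have [a0 [[Sa0 mw] _ iw]] : exists a0, [/\ minimal_weyl M g a0,
      forall x, M x -> star2 (g x) (dform a0 x) = dform a0 x & induces_weyl M g lam a0 aB].
    by case: sps.
  have := mw x (NM Nx); rewrite (minimal_weylP oN Sh Slam lam0 Sqw qw0 Sqth qth1 hE dE gE' a0 Nx) => a0E.
  have [beta bE] := star1_surj (dE x Nx) (hor_d_tr (quad_th t A2 A1 A0) (quad_th t A2 A1 A0) x).
  rewrite -hE// in bE.
  have := iw x (NM Nx); rewrite a0E (omegaE oN Slam lam0 Sqw qw0 Sqth qth1 hE dE gE' Nx bE).
  rewrite addrAC subrK => /eqP; rewrite subr_eq addrC -subr_eq => /eqP mE.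
  have nq := lt0r_neq0 (qw0 x Nx).
  have := quad_minimal aB oN oP NP St dt0 Sw2 Sw1 Sw0 SA2 SA1 SA0 w_gt0 Nx.
  rewrite mE scalerA mulfV// scale1r => /(congr1 (fun X => X *m dpr R)).
  rewrite -!mulmxA dprK !mulmx1 => betaE.
  have := bE; rewrite betaE (quad_curvature oN oP NP St dt0 SA2 SA1 SA0 Nx).
  rewrite star1Z => /(scalerI (invr_neq0 (ndt Nx))).
  by rewrite star1_quad.
have coef x i j : N x -> [/\ star1 (h (pr x)) (p2 (pr x)) i j = q2 (pr x) i j,
    star1 (h (pr x)) (p1 (pr x)) i j = q1 (pr x) i j &
    star1 (h (pr x)) (p0 (pr x)) i j = q0 (pr x) i j].
  move=> Nx; have Z y : N y -> quad_scale t
      (fun b => star1 (h b) (p2 b) i j - q2 b i j)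
      (fun b => 2 * (star1 (h b) (p1 b) i j - q1 b i j))
      (fun b => star1 (h b) (p0 b) i j - q0 b i j) y = 0.
    move=> Ny; have /matrixP/(_ i j) := poly y Ny; rewrite 4!addmxE !scalemxE /quad_scale.
    move: (star1 _ (p2 _) i j) (star1 _ (p1 _) i j) (star1 _ (p0 _) i j).
    move: (q2 _ i j) (q1 _ i j) (q0 _ i j) => r2 r1 r0 s2 s1 s0 /eqP.
    by rewrite -subr_eq0 => /eqP H; rewrite -[RHS]H; ring.
  have [Z2 Z1 Z0] := quad_eq0 oN St dt0 Z Nx.
  split; apply/eqP; rewrite -subr_eq0; apply/eqP => //.
  by move/eqP: Z1; rewrite mulf_eq0 pnatr_eq0 => /eqP.
move=> _ [x Nx <-]; split; apply/matrixP => i j; by case: (coef x i j Nx).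
Qed.

End Direct.

Theorem mainTheorem6 (R : realType) :
  (forall (M : set 'rV[R]_4) (B : set 'rV[R]_3)
     (g : 'rV[R]_4 -> 'M[R]_4) (h : 'rV[R]_3 -> 'M[R]_3)
     (aB : 'rV[R]_3 -> 'rV[R]_3) (lam rho : 'rV[R]_4 -> R),
     open M -> open B ->
     is_metric M g -> selfdual M g ->
     is_metric B h -> smooth_row B aB -> einstein_weyl B h aB ->
     selfdual_projective_submersion M B g h aB lam rho ->
     forall (N : set 'rV[R]_4) (t : 'rV[R]_4 -> R),
       open N -> N `<=` M -> fibrewise_projective_coordinate rho N t ->
       exists (w2 w1 w0 : 'rV[R]_3 -> R) (A2 A1 A0 : 'rV[R]_3 -> 'rV[R]_3),
         [/\ [/\ smooth (@pr R @` N) w2, smooth (@pr R @` N) w1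
                & smooth (@pr R @` N) w0],
             [/\ smooth_row (@pr R @` N) A2, smooth_row (@pr R @` N) A1
                & smooth_row (@pr R @` N) A0],
             (forall x, N x -> 0 < quad_scale t w2 w1 w0 x /\
                g x = lam x *: quad_metric h t w2 w1 w0 A2 A1 A0 x) &
             projective_monopole (@pr R @` N) h aB w2 w1 w0 A2 A1 A0])
  /\
  (forall (B : set 'rV[R]_3) (h : 'rV[R]_3 -> 'M[R]_3)
     (aB : 'rV[R]_3 -> 'rV[R]_3)
     (w2 w1 w0 : 'rV[R]_3 -> R) (A2 A1 A0 : 'rV[R]_3 -> 'rV[R]_3),
     open B -> is_metric B h -> smooth_row B aB -> einstein_weyl B h aB ->
     smooth B w2 -> smooth B w1 -> smooth B w0 ->
     smooth_row B A2 -> smooth_row B A1 -> smooth_row B A0 ->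
     projective_monopole B h aB w2 w1 w0 A2 A1 A0 ->
     forall M : set 'rV[R]_4,
       let t (x : 'rV[R]_4) := x 0 ord_max in
       let w := quad_scale t w2 w1 w0 in
       let th := quad_form t A2 A1 A0 in
       let g := quad_metric h t w2 w1 w0 A2 A1 A0 in
       open M -> @pr R @` M `<=` B -> (forall x, M x -> 0 < w x) ->
       [/\ is_metric M g, selfdual M g,
           (forall x, M x -> forall X, horizontal (g x) X <-> X *m (th x)^T = 0),
           (forall x, M x -> length_scale g (fun=> 1) x = w x) &
           selfdual_projective_submersion M (@pr R @` M) g h aB
             (fun=> 1) (fun=> 0)]).
Proof.
split=> [M B g h aB lam rho oM oB gM _ hB _ _ sps N t oN NM fpc|].
  exact: submersion_monopole oM oB gM hB sps oN NM fpc.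
move=> B h aB w2 w1 w0 A2 A1 A0 oB hB SaB EW Sw2 Sw1 Sw0 SA2 SA1 SA0 mono M t w th g oM MB w_gt0.
exact: (monopole_submersion oB hB SaB Sw2 Sw1 Sw0 SA2 SA1 SA0 mono oM MB w_gt0 EW).
Qed.
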